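(* Let $\mathbb{V}^{(0)},\mathbb{V}^{(1)},\mathbb{V}^{(2)},\mathbb{V}^{(\mathrm r)}$ be the function spaces, and $\mathcal{A}^{(kl)},\mathcal{L}^{(kl)}$ ($k,l\in\{0,1,2,\mathrm r\}$) the operators, defined in the context for the linearized Boltzmann equation $\partial_tf+\xi_k\partial_{x_k}f=\frac{1}{\mathrm{Kn}}\mathcal{L}f$. Then the regularized 13-moment system $$ \begin{aligned} &\partial_tf^{(0)}+\mathcal{A}^{(00)}f^{(0)}+\mathcal{A}^{(01)}f^{(1)}+\mathcal{A}^{(02)}f^{(2)}=0,\\ &\partial_tf^{(1)}+\mathcal{A}^{(10)}f^{(0)}+\mathcal{A}^{(11)}f^{(1)}+\mathcal{A}^{(12)}f^{(2)}=\tfrac{1}{\mathrm{Kn}}\left(\mathcal{L}^{(11)}f^{(1)}+\mathcal{L}^{(12)}f^{(2)}\right),\\ &\mathcal{A}^{(20)}f^{(0)}+\mathcal{A}^{(21)}f^{(1)}=\tfrac{1}{\mathrm{Kn}}\left(\mathcal{L}^{(21)}f^{(1)}+\mathcal{L}^{(22)}f^{(2)}\right) \end{aligned} $$ for $f^{(k)}(t,\boldsymbol{x},\cdot)\in\mathbb{V}^{(k)}$, $k=0,1,2$, has super-Burnett order: the closed equation for $f^{(0)}$ obtained from this system by three Maxwellian iterations (as defined in the context) coincides with the super-Burnett equation, i.e. the closed equation for $f^{(0)}$ obtained by three Maxwellian iterations from the full linearized Boltzmann equation.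
   Context: Inner product: $\langle f,g\rangle=\int_{\mathbb{R}^3}f(\boldsymbol\xi)g(\boldsymbol\xi)(2\pi)^{-3/2}e^{-|\boldsymbol\xi|^2/2}\,\mathrm{d}\boldsymbol\xi$. $\mathcal{L}$ is the linearized Boltzmann collision operator (acting on $\boldsymbol\xi$): self-adjoint, negative semidefinite, rotationally invariant, with kernel $\mathrm{span}\{1,\xi_1,\xi_2,\xi_3,|\boldsymbol\xi|^2\}$. As usual in such derivations, all expansions are formal: the infinite series are assumed to make sense, and the inverses used below, including those of the diagonal blocks and Schur complements of $\mathcal{L}$ on $(\ker\mathcal L)^\perp$, are assumed to exist. Basis: $\psi^n_{i_1\cdots i_l}(\boldsymbol\xi)=\bar L_n^{(l+1/2)}(|\boldsymbol\xi|^2/2)\,\xi_{\langle i_1}\cdots\xi_{i_l\rangle}$, where $\langle\cdots\rangle$ denotes the symmetric trace-free part and $$\bar L_n^{(l+1/2)}(x)=\sqrt{\frac{\sqrt\pi}{2^{l+1}n!\,\Gamma(n+l+3/2)}}\;x^{-(l+1/2)}\left(\frac{\mathrm d}{\mathrm dx}-1\right)^nx^{n+l+1/2}.$$ By rotational invariance $\mathcal{L}\psi^{n'}_{i_1\cdots i_l}=\sum_na_{lnn'}\psi^n_{i_1\cdots i_l}$ with $a_{lnn'}=a_{ln'n}$. For fixed $l,n_0$, $(b^{(n_0)}_{lnn'})_{n,n'\geqslant n_0}$ is the inverse of the infinite matrix $(a_{lnn'})_{n,n'\geqslant n_0}$. Coefficients: $\beta_1^{n}=b^{(1)}_{11n}$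 ($n\ge1$), $\beta_2^{n}=b^{(0)}_{20n}$ ($n\ge0$), and $$\gamma_0^n=\sum_{n'\ge2}b^{(2)}_{0nn'}\frac{\sqrt{2n'+3}\,\beta_1^{n'}-\sqrt{2n'}\,\beta_1^{n'-1}}{\beta_1^1},\quad \gamma_{t1}^n=\sum_{n'\ge2}b^{(2)}_{1nn'}\frac{\beta_1^{n'}}{\beta_1^1},\quad \gamma_{s1}^n=\sum_{n'\ge2}b^{(2)}_{1nn'}\frac{\sqrt{2n'+5}\,\beta_2^{n'}-\sqrt{2n'}\,\beta_2^{n'-1}}{\beta_2^0},$$ $$\gamma_{t2}^n=\sum_{n'\ge1}b^{(1)}_{2nn'}\frac{\beta_2^{n'}}{\beta_2^0},\quad \gamma_{s2}^n=\frac25\sum_{n'\ge1}b^{(1)}_{2nn'}\frac{\sqrt{2n'+5}\,\beta_1^{n'}-\sqrt{2(n'+1)}\,\beta_1^{n'+1}}{\beta_1^1},$$ $$\gamma_3^n=\frac37\sum_{n'\ge0}b^{(0)}_{3nn'}\frac{\sqrt{2n'+7}\,\beta_2^{n'}-\sqrt{2(n'+1)}\,\beta_2^{n'+1}}{\beta_2^0}.$$ Put $d^n_{02}=\gamma_0^n/\gamma_0^2$, $d^n_{30}=\gamma_3^n/\gamma_3^0$, $$d^n_{12}=\frac{\gamma_{t1}^n\gamma_{s1}^3-\gamma_{s1}^n\gamma_{t1}^3}{\gamma_{s1}^3\gamma_{t1}^2-\gamma_{s1}^2\gamma_{t1}^3},\quad d^n_{13}=\frac{\gamma_{s1}^n\gamma_{t1}^2-\gamma_{t1}^n\gamma_{s1}^2}{\gamma_{s1}^3\gamma_{t1}^2-\gamma_{s1}^2\gamma_{t1}^3},\quad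 d^n_{21}=\frac{\gamma_{t2}^n\gamma_{s2}^2-\gamma_{s2}^n\gamma_{t2}^2}{\gamma_{s2}^2\gamma_{t2}^1-\gamma_{s2}^1\gamma_{t2}^2},\quad d^n_{22}=\frac{\gamma_{s2}^n\gamma_{t2}^1-\gamma_{t2}^n\gamma_{s2}^1}{\gamma_{s2}^2\gamma_{t2}^1-\gamma_{s2}^1\gamma_{t2}^2},$$ all denominators being assumed nonzero. Spaces: write $\hat\psi_i^n=\psi_i^n-\frac{\beta_1^n}{\beta_1^1}\psi_i^1$ and $\hat\psi_{ij}^n=\psi_{ij}^n-\frac{\beta_2^n}{\beta_2^0}\psi_{ij}^0$. With (closed) spans over all tensor indices, $$\mathbb{S}^{(2)}=\mathrm{span}\{\hat\psi_i^n: n\ge1\}\oplus\mathrm{span}\{\hat\psi_{ij}^n: n\ge0\}\oplus\mathrm{span}\{\psi^n: n\ge2\}\oplus\mathrm{span}\{\psi^n_{i_1\cdots i_l}: l\ge3,\,n\ge0\},$$ $$\begin{aligned}\mathbb{S}^{(3)}=\;&\mathrm{span}\{\psi^n-d_{02}^n\psi^2: n\ge3\}\oplus\mathrm{span}\{\hat\psi_i^n-d_{12}^n\hat\psi_i^2-d_{13}^n\hat\psi_i^3: n\ge4\}\\&\oplus\mathrm{span}\{\hat\psi_{ij}^n-d_{21}^n\hat\psi_{ij}^1-d_{22}^n\hat\psi_{ij}^2: n\ge3\}\oplus\mathrm{span}\{\psi_{ijk}^n-d_{30}^n\psi_{ijk}^0: n\ge1\}\oplus\mathrm{span}\{\psi^n_{i_1\cdots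 i_l}: l\ge4,\,n\ge0\},\end{aligned}$$ $$\mathbb{V}^{(0)}=\mathrm{span}\{\psi^0,\psi^1,\psi_i^0\},\quad \mathbb{V}^{(1)}=(\mathbb{V}^{(0)})^\perp\cap(\mathbb{S}^{(2)})^\perp,\quad \mathbb{V}^{(2)}=\mathbb{S}^{(2)}\cap(\mathbb{S}^{(3)})^\perp,\quad \mathbb{V}^{(\mathrm r)}=\mathbb{S}^{(3)}.$$ These are mutually orthogonal and span the whole space; $\mathcal{P}^{(k)}$ is the orthogonal projection onto $\mathbb{V}^{(k)}$ and $f^{(k)}=\mathcal{P}^{(k)}f$. For $g\in\mathbb{V}^{(l)}$ depending on $(t,\boldsymbol{x})$: $\mathcal{A}^{(kl)}g=\partial_{x_i}\mathcal{P}^{(k)}(\xi_ig)$ (sum over $i$), $\mathcal{L}^{(kl)}g=\mathcal{P}^{(k)}\mathcal{L}g$. Maxwellian iterations for the Boltzmann equation: start with $f_0^{(1)}=f_0^{(2)}=f_0^{(\mathrm r)}=0$, and given the $j$th iterates determine the $(j+1)$th ones from $$\partial_tf_j^{(k)}+\mathcal{A}^{(k0)}f^{(0)}+\sum_{l\in\{1,2,\mathrm r\}}\mathcal{A}^{(kl)}f_j^{(l)}=\frac{1}{\mathrm{Kn}}\sum_{l\in\{1,2,\mathrm r\}}\mathcal{L}^{(kl)}f_{j+1}^{(l)},\qquad k\in\{1,2,\mathrm r\}.$$ Each iterate is a polynomial in $\mathrm{Kn}$ whose coefficients are spatial differential operators applied to $f^{(0)}$; in $\partial_tf_j^{(k)}$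 the derivative $\partial_tf^{(0)}$ is replaced by $-\mathcal{A}^{(00)}f^{(0)}-\sum_{l\in\{1,2,\mathrm r\}}\mathcal{A}^{(0l)}f_j^{(l)}$, and terms of degree larger than $j$ in $\mathrm{Kn}$ on the left-hand side are discarded. The super-Burnett equation is $\partial_tf^{(0)}+\mathcal{A}^{(00)}f^{(0)}+\mathcal{A}^{(01)}f_3^{(1)}+\mathcal{A}^{(02)}f_3^{(2)}+\mathcal{A}^{(0\mathrm r)}f_3^{(\mathrm r)}=0$. Maxwellian iterations for the regularized 13-moment system are defined in the same way from its second and third equations (with index set $\{1,2\}$: left-hand sides evaluated at iterate $j$, right-hand sides at iterate $j+1$, starting from $f_0^{(1)}=f_0^{(2)}=0$), the resulting closed equation being $\partial_tf^{(0)}+\mathcal{A}^{(00)}f^{(0)}+\mathcal{A}^{(01)}f_3^{(1)}+\mathcal{A}^{(02)}f_3^{(2)}=0$. *)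

(* Defs.v *)
From HB Require Import structures.
From mathcomp Require Import all_boot all_order all_fingroup all_algebra.
From mathcomp Require Import all_classical all_reals all_analysis.

Set Implicit Arguments.
Unset Strict Implicit.
Unset Printing Implicit Defensive.

Import Order.TTheory GRing.Theory Num.Theory.
Import numFieldNormedType.Exports.

Local Open Scope classical_set_scope.
Local Open Scope ring_scope.

Definition velocity (R : realType) : Type :=
  (measurableTypeR R * measurableTypeR R * measurableTypeR R)%type.

Definition vfun (R : realType) : Type := velocity R -> R.

Definition vcoord (R : realType) (i : 'I_3) (x : velocity R) : R :=
  match val i with 0%N => x.1.1 | 1%N => x.1.2 | _ => x.2 end.

Definition norm2 (R : realType) (x : velocity R) : R :=
  \sum_(i < 3) vcoord i x ^+ 2.

Definition lebesgue3 (R : realType) :=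
  ((@lebesgue_measure R \x @lebesgue_measure R) \x @lebesgue_measure R)%E.

HB.instance Definition _ (R : realType) := Measure.on (@lebesgue3 R).

Definition maxwellian (R : realType) (x : velocity R) : R :=
  (2 * pi) `^ (- (3 / 2)) * expR (- (norm2 x / 2)).

Definition ip (R : realType) (f g : vfun R) : R :=
  \int[@lebesgue3 R]_x (f x * g x * maxwellian x).

Definition L2norm (R : realType) (f : vfun R) : R := Num.sqrt (ip f f).

Definition L2 (R : realType) : set (vfun R) :=
  [set f : vfun R |
           measurable_fun [set: velocity R] (f : _ -> measurableTypeR R) /\
           (@lebesgue3 R).-integrable setT
             (fun x => (f x ^+ 2 * maxwellian x)%:E)].

(* Elements of L2 are functions, not classes; equations between them are
   understood almost everywhere. *)
Definition aeq (R : realType) (f g : vfun R) : Prop :=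
  ae_eq (@lebesgue3 R) setT f g.

Definition mulxi (R : realType) (i : 'I_3) (f : vfun R) : vfun R :=
  fun x => vcoord i x * f x.

Definition lin (R : realType) (c : R) (f g : vfun R) : vfun R :=
  fun x => c * f x + g x.

Definition fspan (R : realType) (G : set (vfun R)) : set (vfun R) :=
  [set f | exists (n : nat) (c : 'I_n -> R) (g : 'I_n -> vfun R),
     (forall i, G (g i)) /\ f = (fun x => \sum_(i < n) c i * g i x)].

Definition cspan (R : realType) (G : set (vfun R)) : set (vfun R) :=
  [set f | L2 f /\ forall e : R, 0 < e ->
     exists2 g, fspan G g & L2norm (fun x => f x - g x) < e].

Definition orth (R : realType) (V : set (vfun R)) : set (vfun R) :=
  [set f | L2 f /\ forall g, V g -> ip f g = 0].

Definition is_orthproj (R : realType) (V : set (vfun R)) (f g : vfun R) :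
    Prop :=
  V g /\ forall h, V h -> ip (fun x => f x - g x) h = 0.

(* A representative of the orthogonal projection; it is determined up to null
   sets when it exists. *)
Definition orthproj (R : realType) (V : set (vfun R)) (f : vfun R) : vfun R :=
  xget (fun=> 0) [set g | is_orthproj V f g].

Definition is_subspace (R : realType) (E : set (vfun R)) : Prop :=
  [/\ E `<=` @L2 R,
      E (fun=> 0),
      forall c f g, E f -> E g -> E (lin c f g) &
      forall f g, E f -> L2 g -> aeq f g -> E g].

Definition tensor (R : realType) (l : nat) : Type :=
  {ffun 'I_l -> 'I_3} -> R.

Definition sym_tensor (R : realType) (l : nat) (A : tensor R l) : Prop :=
  forall (s : 'S_l) (I : {ffun 'I_l -> 'I_3}), A [ffun k => I (s k)] = A I.

Definition tracefree_tensor (R : realType) (l : nat) (A : tensor R l) : Prop :=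
  forall (p q : 'I_l), p != q -> forall I : {ffun 'I_l -> 'I_3},
    \sum_(m < 3) A [ffun r => if (r == p) || (r == q) then m else I r] = 0.

Definition is_stf (R : realType) (l : nat) (A : tensor R l) : Prop :=
  sym_tensor A /\ tracefree_tensor A.

(* The symmetric trace-free part of A is its orthogonal projection, for the
   Frobenius product, onto the symmetric trace-free tensors. *)
Definition is_stf_part (R : realType) (l : nat) (A B : tensor R l) : Prop :=
  is_stf B /\
  forall C : tensor R l, is_stf C -> \sum_I (A I - B I) * C I = 0.

Definition stf (R : realType) (l : nat) (A : tensor R l) : tensor R l :=
  xget (fun=> 0) [set B | is_stf_part A B].

Definition xi_tensor (R : realType) (l : nat) (x : velocity R) : tensor R l :=
  fun I => \prod_(k < l) vcoord (I k) x.

Definition Gamma (R : realType) (z : R) : R :=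
  \int[@lebesgue_measure R]_(t in `]0, +oo[) (t `^ (z - 1) * expR (- t)).

(* The Rodrigues formula is meaningful for x > 0 only; this leaves out the
   single velocity 0. *)
Definition Lbar (R : realType) (l n : nat) (x : R) : R :=
  Num.sqrt (Num.sqrt pi /
            (2 ^+ l.+1 * n`!%:R * Gamma (n%:R + l%:R + 3 / 2))) *
  x `^ (- (l%:R + 1 / 2)) *
  iter n (fun (g : R -> R) y => derive1 g y - g y)
       (fun y => y `^ (n%:R + l%:R + 1 / 2)) x.

Definition psi (R : realType) (l n : nat) (I : {ffun 'I_l -> 'I_3}) : vfun R :=
  fun x => Lbar l n (norm2 x / 2) * stf (@xi_tensor R l x) I.

Definition mkvel (R : realType) (v : 'I_3 -> R) : velocity R :=
  (v (inord 0), v (inord 1), v (inord 2)).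

Definition rotate (R : realType) (Q : 'M[R]_3) (x : velocity R) : velocity R :=
  mkvel (fun i => \sum_(j < 3) Q i j * vcoord j x).

(* L is possibly unbounded, with domain dom. *)
Record collision_operator (R : realType) (dom : set (vfun R))
    (L : vfun R -> vfun R) : Prop := {
  co_subspace : is_subspace dom ;
  co_L2 : forall f, dom f -> L2 (L f) ;
  co_aeq : forall f g, dom f -> dom g -> aeq f g -> aeq (L f) (L g) ;
  co_linear : forall c f g, dom f -> dom g ->
    aeq (L (lin c f g)) (lin c (L f) (L g)) ;
  co_dense : forall f, L2 f -> forall e : R, 0 < e ->
    exists2 g, dom g & L2norm (fun x => f x - g x) < e ;
  co_selfadjoint : forall g h, L2 g -> L2 h ->
    (forall f, dom f -> ip (L f) g = ip f h) <-> (dom g /\ aeq (L g) h) ;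
  co_negative : forall f, dom f -> ip (L f) f <= 0 ;
  co_kernel : forall f, (dom f /\ aeq (L f) (fun=> 0)) <->
    (L2 f /\ exists (c0 c2 : R) (c1 : 'I_3 -> R),
       aeq f (fun x => c0 + (\sum_(i < 3) c1 i * vcoord i x) + c2 * norm2 x)) ;
  co_rotation : forall (Q : 'M[R]_3) f, Q *m Q^T = 1%:M -> \det Q = 1 ->
    dom f -> dom (f \o rotate Q) /\
             aeq (L (f \o rotate Q)) (L f \o rotate Q) }.

(* L psi^{n'}_I = \sum_n a l n n' psi^n_I, the series converging in L2. *)
Definition collision_matrix (R : realType) (L : vfun R -> vfun R)
    (a : nat -> nat -> nat -> R) : Prop :=
  (forall l n n', a l n n' = a l n' n) /\
  (forall l n' (I : {ffun 'I_l -> 'I_3}),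
    (fun N => L2norm (fun x => L (@psi R l n' I) x
                               - \sum_(n < N) a l n n' * @psi R l n I x))
      @ \oo --> (0 : R)).

Definition inverse_from (R : realType) (n0 : nat) (A B : nat -> nat -> R) :
    Prop :=
  forall n n', (n0 <= n)%N -> (n0 <= n')%N ->
    (fun N => \sum_(n0 <= k < N) A n k * B k n') @ \oo --> ((n == n')%:R : R) /\
    (fun N => \sum_(n0 <= k < N) B n k * A k n') @ \oo --> ((n == n')%:R : R).

(* [b n0 l n n'] stands for b^{(n0)}_{l n n'}. *)

Definition beta1 (R : realType) (b : nat -> nat -> nat -> nat -> R) (n : nat) :=
  b 1%N 1%N 1%N n.

Definition beta2 (R : realType) (b : nat -> nat -> nat -> nat -> R) (n : nat) :=
  b 0%N 2%N 0%N n.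

Definition sqrtn (R : realType) (n : nat) : R := Num.sqrt n%:R.

Definition term_0 (R : realType) (b : nat -> nat -> nat -> nat -> R)
    (n k : nat) : R :=
  b 2%N 0%N n k *
  ((sqrtn R (2 * k + 3) * beta1 b k - sqrtn R (2 * k) * beta1 b k.-1)
     / beta1 b 1).

Definition term_t1 (R : realType) (b : nat -> nat -> nat -> nat -> R)
    (n k : nat) : R :=
  b 2%N 1%N n k * (beta1 b k / beta1 b 1).

Definition term_s1 (R : realType) (b : nat -> nat -> nat -> nat -> R)
    (n k : nat) : R :=
  b 2%N 1%N n k *
  ((sqrtn R (2 * k + 5) * beta2 b k - sqrtn R (2 * k) * beta2 b k.-1)
     / beta2 b 0).

Definition term_t2 (R : realType) (b : nat -> nat -> nat -> nat -> R)
    (n k : nat) : R :=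
  b 1%N 2%N n k * (beta2 b k / beta2 b 0).

Definition term_s2 (R : realType) (b : nat -> nat -> nat -> nat -> R)
    (n k : nat) : R :=
  b 1%N 2%N n k *
  ((sqrtn R (2 * k + 5) * beta1 b k - sqrtn R (2 * (k + 1)) * beta1 b k.+1)
     / beta1 b 1).

Definition term_3 (R : realType) (b : nat -> nat -> nat -> nat -> R)
    (n k : nat) : R :=
  b 0%N 3%N n k *
  ((sqrtn R (2 * k + 7) * beta2 b k - sqrtn R (2 * (k + 1)) * beta2 b k.+1)
     / beta2 b 0).

Definition sum_from (R : realType) (n0 : nat) (u : nat -> R) : R :=
  limn (fun N => \sum_(n0 <= k < N) u k).

Definition cvg_from (R : realType) (n0 : nat) (u : nat -> R) : Prop :=
  cvgn (fun N => \sum_(n0 <= k < N) u k).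

Definition gamma_0 (R : realType) (b : nat -> nat -> nat -> nat -> R) n : R :=
  sum_from 2 (term_0 b n).

Definition gamma_t1 (R : realType) (b : nat -> nat -> nat -> nat -> R) n : R :=
  sum_from 2 (term_t1 b n).

Definition gamma_s1 (R : realType) (b : nat -> nat -> nat -> nat -> R) n : R :=
  sum_from 2 (term_s1 b n).

Definition gamma_t2 (R : realType) (b : nat -> nat -> nat -> nat -> R) n : R :=
  sum_from 1 (term_t2 b n).

Definition gamma_s2 (R : realType) (b : nat -> nat -> nat -> nat -> R) n : R :=
  2 / 5 * sum_from 1 (term_s2 b n).

Definition gamma_3 (R : realType) (b : nat -> nat -> nat -> nat -> R) n : R :=
  3 / 7 * sum_from 0 (term_3 b n).

Definition gamma_converge (R : realType)
    (b : nat -> nat -> nat -> nat -> R) : Prop :=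
  [/\ forall n, (2 <= n)%N -> cvg_from 2 (term_0 b n),
      forall n, (2 <= n)%N -> cvg_from 2 (term_t1 b n) /\
                              cvg_from 2 (term_s1 b n),
      forall n, (1 <= n)%N -> cvg_from 1 (term_t2 b n) /\
                              cvg_from 1 (term_s2 b n) &
      forall n, cvg_from 0 (term_3 b n)].

Definition den1 (R : realType) (b : nat -> nat -> nat -> nat -> R) : R :=
  gamma_s1 b 3 * gamma_t1 b 2 - gamma_s1 b 2 * gamma_t1 b 3.

Definition den2 (R : realType) (b : nat -> nat -> nat -> nat -> R) : R :=
  gamma_s2 b 2 * gamma_t2 b 1 - gamma_s2 b 1 * gamma_t2 b 2.

Definition d02 (R : realType) (b : nat -> nat -> nat -> nat -> R) n : R :=
  gamma_0 b n / gamma_0 b 2.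

Definition d30 (R : realType) (b : nat -> nat -> nat -> nat -> R) n : R :=
  gamma_3 b n / gamma_3 b 0.

Definition d12 (R : realType) (b : nat -> nat -> nat -> nat -> R) n : R :=
  (gamma_t1 b n * gamma_s1 b 3 - gamma_s1 b n * gamma_t1 b 3) / den1 b.

Definition d13 (R : realType) (b : nat -> nat -> nat -> nat -> R) n : R :=
  (gamma_s1 b n * gamma_t1 b 2 - gamma_t1 b n * gamma_s1 b 2) / den1 b.

Definition d21 (R : realType) (b : nat -> nat -> nat -> nat -> R) n : R :=
  (gamma_t2 b n * gamma_s2 b 2 - gamma_s2 b n * gamma_t2 b 2) / den2 b.

Definition d22 (R : realType) (b : nat -> nat -> nat -> nat -> R) n : R :=
  (gamma_s2 b n * gamma_t2 b 1 - gamma_t2 b n * gamma_s2 b 1) / den2 b.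

Definition denominators_nonzero (R : realType)
    (b : nat -> nat -> nat -> nat -> R) : Prop :=
  [/\ beta1 b 1 != 0, beta2 b 0 != 0, gamma_0 b 2 != 0, gamma_3 b 0 != 0 &
      den1 b != 0 /\ den2 b != 0].

Definition psihat1 (R : realType) (b : nat -> nat -> nat -> nat -> R)
    (n : nat) (I : {ffun 'I_1 -> 'I_3}) : vfun R :=
  fun x => @psi R 1 n I x - beta1 b n / beta1 b 1 * @psi R 1 1 I x.

Definition psihat2 (R : realType) (b : nat -> nat -> nat -> nat -> R)
    (n : nat) (I : {ffun 'I_2 -> 'I_3}) : vfun R :=
  fun x => @psi R 2 n I x - beta2 b n / beta2 b 0 * @psi R 2 0 I x.

Definition S2 (R : realType) (b : nat -> nat -> nat -> nat -> R) :
    set (vfun R) :=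
  cspan ([set f | exists n I, (1 <= n)%N /\ f = psihat1 b n I]
     `|` [set f | exists n I, f = psihat2 b n I]
     `|` [set f | exists n I, (2 <= n)%N /\ f = @psi R 0 n I]
     `|` [set f | exists l n I, (3 <= l)%N /\ f = @psi R l n I]).

Definition S3 (R : realType) (b : nat -> nat -> nat -> nat -> R) :
    set (vfun R) :=
  cspan ([set f | exists n I, (3 <= n)%N /\
            f = (fun x => @psi R 0 n I x - d02 b n * @psi R 0 2 I x)]
     `|` [set f | exists n I, (4 <= n)%N /\
            f = (fun x => psihat1 b n I x - d12 b n * psihat1 b 2 I x
                                          - d13 b n * psihat1 b 3 I x)]
     `|` [set f | exists n I, (3 <= n)%N /\
            f = (fun x => psihat2 b n I x - d21 b n * psihat2 b 1 I x
                                          - d22 b n * psihat2 b 2 I x)]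
     `|` [set f | exists n I, (1 <= n)%N /\
            f = (fun x => @psi R 3 n I x - d30 b n * @psi R 3 0 I x)]
     `|` [set f | exists l n I, (4 <= l)%N /\ f = @psi R l n I]).

Definition V0 (R : realType) : set (vfun R) :=
  fspan ([set f | exists I, f = @psi R 0 0 I]
     `|` [set f | exists I, f = @psi R 0 1 I]
     `|` [set f | exists I, f = @psi R 1 0 I]).

Inductive block := B0 | B1 | B2 | Br.

Definition V (R : realType) (b : nat -> nat -> nat -> nat -> R) (k : block) :
    set (vfun R) :=
  match k with
  | B0 => @V0 R
  | B1 => orth (@V0 R) `&` orth (S2 b)
  | B2 => S2 b `&` orth (S3 b)
  | Br => S3 b
  end.

Definition Lop (R : realType) (b : nat -> nat -> nat -> nat -> R)
    (L : vfun R -> vfun R) (k : block) (g : vfun R) : vfun R :=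
  orthproj (V b k) (L g).

(* The multiplications by xi_i and L are unbounded. D is a space of functions
   stable under them and under the decomposition into the V^{(k)}. *)
Record formal_domain (R : realType) (b : nat -> nat -> nat -> nat -> R)
    (dom : set (vfun R)) (L : vfun R -> vfun R) (D : set (vfun R)) : Prop := {
  fd_subspace : is_subspace D ;
  fd_dom : D `<=` dom ;
  fd_psi : forall l n (I : {ffun 'I_l -> 'I_3}), D (@psi R l n I) ;
  fd_L : forall f, D f -> D (L f) ;
  fd_mulxi : forall i f, D f -> D (mulxi i f) ;
  fd_decomposition : forall f, D f -> exists g : block -> vfun R,
    (forall k, V b k (g k) /\ D (g k)) /\
    aeq f (fun x => g B0 x + g B1 x + g B2 x + g Br x) }.

Definition inverse_used (l n0 : nat) : bool :=
  (l, n0) \in [:: (1, 1); (2, 0); (0, 2); (1, 2); (2, 1); (3, 0)]%N.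

Definition matrix_inverses (R : realType) (a : nat -> nat -> nat -> R)
    (b : nat -> nat -> nat -> nat -> R) (D : set (vfun R)) : Prop :=
  forall l n0, inverse_used l n0 ->
    inverse_from n0 (a l) (b n0 l) /\
    forall n' (I : {ffun 'I_l -> 'I_3}), (n0 <= n')%N ->
      exists2 f, D f &
        (fun N => L2norm (fun x => f x
                   - \sum_(n0 <= n < N) b n0 l n n' * @psi R l n I x))
          @ \oo --> (0 : R).

Definition boltzmann_blocks : pred block :=
  fun k => if k is B0 then false else true.

Definition r13_blocks : pred block :=
  fun k => match k with B1 | B2 => true | _ => false end.

(* Sum over the l in ks; B0 is never in ks. *)
Definition bsum (U : zmodType) (ks : pred block) (F : block -> U) : U :=
  \sum_(l <- [:: B1; B2; Br] | ks l) F l.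

(* Solvability of the block system (L^{(kl)})_{k, l in ks}. *)
Definition block_invertible (R : realType)
    (b : nat -> nat -> nat -> nat -> R) (L : vfun R -> vfun R)
    (D : set (vfun R)) (ks : pred block) : Prop :=
  forall h : block -> vfun R, (forall k, ks k -> V b k (h k) /\ D (h k)) ->
  exists2 u : block -> vfun R,
    forall k, ks k -> V b k (u k) /\ D (u k) &
    forall k, ks k -> aeq (fun x => bsum ks (fun l => Lop b L k (u l) x)) (h k).

Definition multi : Type := 'I_3 -> nat.

(* [S m alpha w] is the coefficient of Kn^m and of the derivative of order
   alpha: S represents the operator taking f^{(0)} to
   \sum_m Kn^m \sum_alpha S m alpha (d_x^alpha f^{(0)}),
   where each S m alpha maps V^{(0)} to one of the V^{(k)}. *)
Definition diffop (R : realType) : Type :=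
  nat -> multi -> vfun R -> vfun R.

Definition is_diffop (R : realType) (b : nat -> nat -> nat -> nat -> R)
    (D : set (vfun R)) (k : block) (S : diffop R) : Prop :=
  [/\ forall m al w, V0 w -> V b k (S m al w) /\ D (S m al w),
      forall m al c w1 w2, V0 w1 -> V0 w2 ->
        aeq (S m al (lin c w1 w2)) (lin c (S m al w1) (S m al w2)) &
      exists N : nat, forall m al w, V0 w ->
        (N < m + \sum_(i < 3) al i)%N -> aeq (S m al w) (fun=> 0)].

Definition opadd (R : realType) (S T : diffop R) : diffop R :=
  fun m al w x => S m al w x + T m al w x.

Definition opopp (R : realType) (S : diffop R) : diffop R :=
  fun m al w x => - S m al w x.

Definition opsum (R : realType) (ks : pred block) (F : block -> diffop R) :
    diffop R :=
  fun m al w x => bsum ks (fun l => F l m al w x).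

(* f^{(0)} itself *)
Definition opid (R : realType) : diffop R :=
  fun m al w x =>
    if (m == 0%N) && [forall i : 'I_3, al i == 0%N] then w x else 0.

(* A^{(kl)} g = d_{x_i} P^{(k)} (xi_i g), for any l. *)
Definition Aop (R : realType) (b : nat -> nat -> nat -> nat -> R) (k : block)
    (S : diffop R) : diffop R :=
  fun m al w x =>
    \sum_(i < 3 | (0 < al i)%N)
      orthproj (V b k) (mulxi i (S m (fun j => al j - (j == i))%N w)) x.

(* S applied to G f^{(0)}, where the coefficients of G map V^{(0)} to itself *)
Definition opcomp (R : realType) (S G : diffop R) : diffop R :=
  fun m al w x =>
    \sum_(p < m.+1) \sum_(be : {dffun forall i : 'I_3, 'I_(al i).+1})
      S p (fun i => be i : nat) (G (m - p)%N (fun i => al i - be i)%N w) x.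

(* A^{(00)} f^{(0)} + \sum_(l in ks) A^{(0l)} f^{(l)} *)
Definition closed_op (R : realType) (b : nat -> nat -> nat -> nat -> R)
    (ks : pred block) (F : block -> diffop R) : diffop R :=
  opadd (Aop b B0 (@opid R)) (opsum ks (fun l => Aop b B0 (F l))).

(* d_t f^{(k)}, where d_t f^{(0)} is replaced using the balance laws *)
Definition ddt (R : realType) (b : nat -> nat -> nat -> nat -> R)
    (ks : pred block) (F : block -> diffop R) (k : block) : diffop R :=
  opcomp (F k) (opopp (closed_op b ks F)).

Definition lhs_boltzmann (R : realType) (b : nat -> nat -> nat -> nat -> R)
    (F : block -> diffop R) (k : block) : diffop R :=
  opadd (ddt b boltzmann_blocks F k)
    (opadd (Aop b k (@opid R))
          (opsum boltzmann_blocks (fun l => Aop b k (F l)))).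

Definition lhs_r13 (R : realType) (b : nat -> nat -> nat -> nat -> R)
    (F : block -> diffop R) (k : block) : diffop R :=
  match k with
  | B1 => opadd (ddt b r13_blocks F B1)
            (opadd (Aop b B1 (@opid R))
                  (opadd (Aop b B1 (F B1)) (Aop b B1 (F B2))))
  | B2 => opadd (Aop b B2 (@opid R)) (Aop b B2 (F B1))
  | _ => fun _ _ _ _ => 0
  end.

(* Kn times the part of S of degree at most j in Kn *)
Definition kn_truncate (R : realType) (j : nat) (S : diffop R) : diffop R :=
  fun m al w x =>
    if m is m'.+1 then (if (m' <= j)%N then S m' al w x else 0) else 0.

(* [F j k] is the j-th iterate f_j^{(k)}; both sides of the equations are
   multiplied by Kn and compared coefficientwise. *)
Definition maxwellian_iterates (R : realType)
    (b : nat -> nat -> nat -> nat -> R) (L : vfun R -> vfun R)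
    (D : set (vfun R)) (ks : pred block)
    (lhs : (block -> diffop R) -> block -> diffop R)
    (F : nat -> block -> diffop R) : Prop :=
  [/\ forall j k, ks k -> is_diffop b D k (F j k),
      forall k, ks k -> F 0%N k = (fun _ _ _ _ => 0) &
      forall j k, ks k -> forall m al w, V0 w ->
        aeq (fun x => bsum ks (fun l => Lop b L k (F j.+1 l m al w) x))
            (kn_truncate j (lhs (F j) k) m al w)].

Definition boltzmann_iterates (R : realType)
    (b : nat -> nat -> nat -> nat -> R) (L : vfun R -> vfun R)
    (D : set (vfun R)) (F : nat -> block -> diffop R) : Prop :=
  maxwellian_iterates b L D boltzmann_blocks (lhs_boltzmann b) F.

Definition r13_iterates (R : realType)
    (b : nat -> nat -> nat -> nat -> R) (L : vfun R -> vfun R)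
    (D : set (vfun R)) (F : nat -> block -> diffop R) : Prop :=
  maxwellian_iterates b L D r13_blocks (lhs_r13 b) F.

(* Main.v *)
(* Write phi for the functions L^-1 psi^1_i and L^-1 psi^0_ij.  They lie in
   V^(1), and xi_i V^(0) is contained in V^(0) + L(span phi), so that the first
   iterates are f_1^(1) in span phi and f_1^(2) = f_1^(r) = 0.  The sources of
   the second iteration are therefore combinations of phi and xi_i phi.  Pairing
   such a source with L^-1 of a generator of S^(3) of rank at most 3 gives a
   combination of the gamma coefficients, which the choice of the d coefficients
   makes vanish; since L does not couple different ranks, what is left of
   f_2^(r) is orthogonal to the source, and f_2^(r) = 0 because L is definite
   off V^(0).  Hence the second iterates of the two systems coincide.  The third
   iterate enters the closed equation only through <f_3, xi_i v> with v in
   V^(0); as xi_i v = v' + L phi, this is <L f_3, phi>, the pairing of phi with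
   the V^(1) source of the third iteration, which is the same in both systems. *)

Require Import Defs.
From HB Require Import structures.
From mathcomp Require Import all_boot all_order all_fingroup all_algebra.
From mathcomp Require Import all_classical all_reals all_analysis.
From mathcomp Require Import -(notations) mpoly.
From mathcomp Require Import measurable_realfun.
From mathcomp Require Import ring lra zify.

Set Implicit Arguments.
Unset Strict Implicit.
Unset Printing Implicit Defensive.

Import Order.TTheory GRing.Theory Num.Theory.
Import numFieldNormedType.Exports.

Local Open Scope classical_set_scope.
Local Open Scope ring_scope.

Local Notation idx l := {ffun 'I_l -> 'I_3}.

(** The functions [psi] are given by a Rodrigues formula, a Gamma integral and a chosen tensor
    projection, so nothing can be paired until they are recognised almost everywhere as polynomials.
    Two facts are extracted from that: the Gram matrix of the psi^n_I is diagonal in n with entries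
    independent of n, and xi_i psi^n_I is a combination of neighbouring psi whose tensor
    coefficients do not depend on n. The square roots in this recurrence are those in the gamma
    coefficients. The hats have a similar origin. When the first row and column of a matrix block
    are dropped, L maps column n of the inverse to psi^n minus a multiple of the dropped function,
    and symmetry of L identifies this multiple as a quotient of betas. Columns of the reduced
    inverse are thus preimages of the psihat, and the gamma coefficients are pairings with them.
    Completeness of the family psi is not among the hypotheses, and L is controlled on D only.
    Equalities are therefore tested by pairings, and the missing completeness is replaced by the
    invariance under L of the orthogonal complement of all psi. *)

Lemma integrable_setU d (T : measurableType d) (R : realType)
    (mu : {measure set T -> \bar R}) (A B : set T) (f : T -> \bar R) :
  measurable A -> measurable B -> [disjoint A & B] ->
  mu.-integrable A f -> mu.-integrable B f -> mu.-integrable (A `|` B) f.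
Proof.
move=> mA mB AB iA iB.
have mU : measurable_fun (A `|` B) f.
  by apply/(measurable_funU _ mA mB); split;
    [exact: (measurable_int _ iA)|exact: (measurable_int _ iB)].
apply/integrableP; split=> //.
rewrite ge0_integral_setU//=; last exact: measurableT_comp.
by apply: lte_add_pinfty; [case/integrableP : iA|case/integrableP : iB].
Qed.

Section HalfLine.
Variable R : realType.
Notation mu := (@lebesgue_measure R).

(** Integrands coming from integration by parts change sign, so nonnegativity is asked only beyond
    c. The compact piece is handled by the ordinary fundamental theorem and the tail by its version
    for nonnegative functions; the latter also yields integrability. *)
Lemma eventually_ge0_FTC2y (f F : R -> R) (a c l : R) :
  a < c -> (forall x, c <= x -> 0 <= f x) ->
  {within `[a, +oo[, continuous f} ->
  F x @[x --> +oo] --> l ->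
  (forall x, a < x -> derivable F x 1) -> F x @[x --> a^'+] --> F a ->
  {in `]a, +oo[, derive1 F =1 f} ->
  mu.-integrable `[a, +oo[ (EFin \o f) /\
  \int[mu]_(x in `[a, +oo[) f x = l - F a.
Proof.
move=> ac f0 cf Fl dF Fa dFE.
have ItvU : `[a, +oo[%classic = `[a, c] `|` `]c, +oo[ :> set R.
  by rewrite -itv_bndbnd_setU// bnd_simp// ltW.
have cFc : {for c, continuous F}.
  by apply: differentiable_continuous; apply/derivable1_diffP/dF.
have cac : {within `[a, c], continuous f}.
  apply: continuous_subspaceW cf => x /=.
  by rewrite !in_itv/= => /andP[-> _].
have ccy : {within `[c, +oo[, continuous f}.
  apply: continuous_subspaceW cf => x /=.
  by rewrite !in_itv/= !andbT => cx; rewrite (le_trans (ltW ac)).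
have iac : mu.-integrable `[a, c] (EFin \o f).
  by apply: continuous_compact_integrable => //; exact: segment_compact.
have eac : (\int[mu]_(x in `[a, c]) (f x)%:E = (F c)%:E - (F a)%:E)%E.
  apply: continuous_FTC2 => //.
  - split => //.
      by move=> x; rewrite in_itv/= => /andP[ax _]; exact: dF.
    by apply: cvg_at_left_filter; exact: cFc.
  - move=> x; rewrite in_itv/= => /andP[ax _]; apply: dFE.
    by rewrite in_itv/= ax.
have ecy : (\int[mu]_(x in `[c, +oo[) (f x)%:E = l%:E - (F c)%:E)%E.
  apply: ge0_continuous_FTC2y => //.
  - by move=> x cx; apply: dF; rewrite (lt_trans ac).
  - by apply: cvg_at_right_filter; exact: cFc.
  - move=> x; rewrite in_itv/= andbT => cx; apply: dFE.
    by rewrite in_itv/= andbT (lt_trans ac).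
have mcy : measurable_fun `[c, +oo[ f.
  by apply: subspace_continuous_measurable_fun.
have icy : mu.-integrable `[c, +oo[ (EFin \o f).
  apply/integrableP; split; first exact/measurable_EFinP.
  under eq_integral.
    move=> x; rewrite inE/= in_itv/= andbT => cx.
    rewrite /= ger0_norm; last exact: f0.
    over.
  by rewrite ecy -EFinB ltry.
have icy' : mu.-integrable `]c, +oo[ (EFin \o f).
  apply: (integrableS _ _ _ icy) => // x /=.
  by rewrite !in_itv/= !andbT; exact: ltW.
have ecy' : (\int[mu]_(x in `]c, +oo[) (f x)%:E = l%:E - (F c)%:E)%E.
  by rewrite integral_itv_obnd_cbnd// -?ecy//; apply/measurable_EFinP;
    apply: measurable_funS mcy => // x /=; rewrite !in_itv/= !andbT => /ltW.
have dis : [disjoint `[a, c]%classic & `]c, +oo[%classic].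
  rewrite disj_set2E; apply/eqP/seteqP; split => x//=.
  by rewrite !in_itv/= andbT => -[/andP[_ xc]]; rewrite ltNge xc.
have iU : mu.-integrable (`[a, c] `|` `]c, +oo[) (EFin \o f).
  by apply: integrable_setU => //; exact: measurable_itv.
rewrite ItvU; split=> //.
by rewrite Rintegral_setU//= /Rintegral eac ecy' -!EFinB/=; ring.
Qed.

End HalfLine.

(** * The Gamma function *)

Section Gamma.
Variable R : realType.
Notation mu := (@lebesgue_measure R).

(** The Taylor bound e^x >= x^(k+1)/(k+1)! leaves at most (k+1)!/x. *)
Lemma cvg_exprM_expRN (k : nat) : (fun x : R => x ^+ k * expR (- x)) @ +oo --> (0 : R).
Proof.
apply: (@squeeze_cvgr _ _ _ _ (fun=> 0) (fun x : R => k.+1`!%:R * x^-1)).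
- near=> x.
  have x0 : 0 < x by near: x; exact: nbhs_pinfty_gt.
  rewrite mulr_ge0 ?exprn_ge0 ?expR_ge0 ?(ltW x0)//= expRN.
  rewrite -[leRHS]mulr1 ler_pdivrMr ?expR_gt0// mulr1.
  have /(le_trans _) : x ^+ k.+1 / k.+1`!%:R <= expR x.
    by apply: le_trans (expR_ge1Dxn k (ltW x0)); rewrite lerDr.
  move=> /(_ _ (lexx _)) h.
  rewrite -mulrA mulrC -ler_pdivrMr ?ltr0n ?fact_gt0//.
  rewrite ler_pdivlMl//; move: h; rewrite exprS; lra.
- exact: cvg_cst.
- rewrite -[X in _ --> X](mulr0 (k.+1`!%:R : R)).
  apply: cvgM; first exact: cvg_cst.
  apply/cvgrPdist_lt => e e0; near=> x.
  have x0 : 0 < x by near: x; exact: nbhs_pinfty_gt.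
  rewrite sub0r normrN normfV (gtr0_norm x0).
  rewrite -[ltRHS]invrK ltf_pV2 ?posrE ?invr_gt0//.
  by near: x; apply: nbhs_pinfty_gt; exact: num_real.
Unshelve. all: by end_near. Qed.

Lemma is_derive_expRN (x : R) :
  is_derive x 1 (fun t : R => expR (- t)) (- expR (- x)).
Proof.
by rewrite -mulrN1; apply: (@is_derive1_comp _ (@expR R) -%R).
Qed.

Lemma is_derive_powR_expRN (z x : R) : 0 < x ->
  is_derive x 1 (fun t : R => - (t `^ z * expR (- t)))
    (x `^ z * expR (- x) - z * (x `^ (z - 1) * expR (- x))).
Proof.
move=> x0.
have h1 := is_derive1_powR z x0.
have h2 := is_derive_expRN x.
have h := is_deriveN (is_deriveM h1 h2).
rewrite (_ : _ - _ = - (x `^ z *: - expR (- x) + expR (- x) *: (z * x `^ (z - 1)))) //.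
by rewrite /GRing.scale/=; ring.
Qed.

Lemma continuous_powR_expRN (z : R) : 0 < z ->
  {within `[0, +oo[, continuous (fun t : R => t `^ z * expR (- t))}.
Proof.
move=> z0; apply/continuous_within_itvcyP; split.
  move=> x; rewrite in_itv/= andbT => x0.
  have h := is_deriveM (is_derive1_powR z x0) (is_derive_expRN x).
  apply: (@differentiable_continuous _ _ _ _ ((powR (R:=R))^~ z * (fun t => expR (- t)))).
  by apply/derivable1_diffP; case: h.
rewrite powR0 ?gt_eqF// mul0r -[X in _ --> X](mul0r (expR (- 0) : R)).
apply: cvgM; first exact: powR_cvg0.
have h : {for 0, continuous (fun t : R => expR (- t))}.
  apply: differentiable_continuous; apply/derivable1_diffP.
  by have := is_derive_expRN 0.
exact: cvg_at_right_filter.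
Qed.


Lemma cvg_powR_expRN (z : R) :
  (fun x : R => x `^ z * expR (- x)) @ +oo --> (0 : R).
Proof.
have [k zk] : exists k : nat, z <= k%:R.
  by exists (Num.truncn z).+1; rewrite ltW// truncnS_gt.
apply: (@squeeze_cvgr _ _ _ _ (fun=> 0) (fun x : R => x ^+ k * expR (- x))).
- near=> x.
  have x1 : 1 <= x by near: x; exact: nbhs_pinfty_ge.
  rewrite mulr_ge0 ?powR_ge0 ?expR_ge0//= ler_wpM2r ?expR_ge0//.
  by rewrite -powR_mulrn ?(le_trans ler01)// ler_powR.
- exact: cvg_cst.
- exact: cvg_exprM_expRN.
Unshelve. all: by end_near. Qed.

(** The recurrence Gamma(z+1) = z Gamma(z) before it is split into two integrals. Integrability of
    the difference comes first, because that of the separate terms is deduced from it by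
    induction. *)
Lemma Gamma_FTC (z : R) : 1 < z ->
  mu.-integrable `[0, +oo[ (EFin \o (fun t : R =>
    t `^ z * expR (- t) - z * (t `^ (z - 1) * expR (- t)))) /\
  \int[mu]_(t in `[0, +oo[)
    (t `^ z * expR (- t) - z * (t `^ (z - 1) * expR (- t))) = 0.
Proof.
move=> z1; have z0 : 0 < z by rewrite (lt_trans _ z1).
have e : 0 - - (0 `^ z * expR (- 0) : R) = 0.
  by rewrite powR0 ?gt_eqF// mul0r oppr0 subr0.
rewrite -[X in _ = X]e.
(* The integrand is t^(z-1) (t - z) e^(-t), nonnegative from t = z on. *)
apply: (@eventually_ge0_FTC2y R _ (fun t => - (t `^ z * expR (- t))) 0 z 0) => //.
- move=> x zx; have x0 : 0 < x by rewrite (lt_le_trans z0).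
  rewrite mulrA -mulrBl mulr_ge0 ?expR_ge0// subr_ge0.
  by rewrite -(mulr_powRB1 (ltW x0) z0) ler_wpM2r ?powR_ge0.
- have h : {within `[0, +oo[, continuous ((fun t : R => t `^ z * expR (- t)) -
     (fun=> z) * (fun t : R => t `^ (z - 1) * expR (- t)))}.
    move=> x; apply: cvgB; first exact: continuous_powR_expRN.
    apply: cvgM; first exact: cvg_cst.
    by apply: continuous_powR_expRN; rewrite subr_gt0.
  exact: h.
- rewrite -[X in _ --> X]oppr0; apply: cvgN; exact: cvg_powR_expRN.
- by move=> x x0; case: (is_derive_powR_expRN z x0).
- rewrite -[X in _ --> X](_ : - (0 `^ z * expR (- 0)) = _)//; apply: cvgN.
  have h := continuous_powR_expRN z0.
  by move/continuous_within_itvcyP : h => [].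
- move=> x; rewrite in_itv/= andbT => x0.
  by have h := is_derive_powR_expRN z x0; rewrite derive1E derive_val.
Qed.


(** Dominating function for two base cases on t >= 0: sqrt t e^(-t) <= 2 e^(-t/2), and later
    e^(-t^2/2) <= e^(1/8) e^(-t/2). *)
Lemma integrable_expRN_half : mu.-integrable `[0, +oo[
  (EFin \o (fun t : R => expR (- (t / 2)))).
Proof.
have d (x : R) : is_derive x 1 (fun t : R => - 2 * expR (- (t / 2)))
    (expR (- (x / 2))).
  have h1 : is_derive x 1 ((2^-1 : R) *: id) (2^-1 *: (1 : R)) by exact: is_deriveZ.
  have h2 := @is_derive1_comp _ (fun t => expR (- t)) (2^-1 *: id) x _ _
    (is_derive_expRN _) h1.
  have h3 := is_deriveZ (-2 : R) h2.
  have -> : expR (- (x / 2)) = -2 *: (- expR (- (2^-1 *: x)) * (2^-1 *: 1)) :> R.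
    by rewrite /GRing.scale/= (mulrC 2^-1 x); field.
  suff -> : (fun t : R => - 2 * expR (- (t / 2))) =
    (-2 : R) *: ((fun t : R => expR (- t)) \o (2^-1 *: id)) by [].
  by apply/funext => t; rewrite /GRing.scale/= /GRing.scale/= (mulrC t).
have [] // := @eventually_ge0_FTC2y R (fun t : R => expR (- (t / 2)))
  (fun t : R => - 2 * expR (- (t / 2))) 0 1 0.
- apply: continuous_subspaceT => x.
  have h : is_derive x 1 (fun t : R => expR (- (t / 2))) (- 2^-1 * expR (- (x / 2))).
    have := is_deriveZ (- 2^-1 : R) (d x); congr is_derive.
    by apply/funext => t; rewrite /GRing.scale/= /GRing.scale/=; field.
  by apply: differentiable_continuous; apply/derivable1_diffP; case: h.
- rewrite -[X in _ --> X](mulr0 (-2 : R)); apply: cvgM; first exact: cvg_cst.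
  apply: (@cvg_comp _ _ _ (fun t : R => t / 2) (fun t : R => expR (- t)) _ (+oo)%R).
    apply/cvgryPge => A; near=> t.
    rewrite ler_pdivlMr//; near: t; apply: nbhs_pinfty_ge; exact: num_real.
  exact: cvgr_expR.
- have h : {for 0, continuous (fun t : R => - 2 * expR (- (t / 2)))}.
    apply: differentiable_continuous.
    by apply/derivable1_diffP; case: (d 0).
  exact: cvg_at_right_filter.
- by move=> x _; rewrite derive1E; have h := d x; rewrite derive_val.
Unshelve. all: by end_near. Qed.

(** Induction through [Gamma_FTC]: the power k + 3/2 is the integrable difference plus a multiple of
    the power k + 1/2. *)
Lemma integrable_powR_expRN (k : nat) : mu.-integrable `[0, +oo[
  (EFin \o (fun t : R => t `^ (k%:R + 1 / 2) * expR (- t))).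
Proof.
elim: k => [|k IH].
  have h : mu.-integrable `[0, +oo[ (fun t : R => 2%:E * (expR (- (t / 2)))%:E)%E.
    by apply: integrableZl => //; exact: integrable_expRN_half.
  apply: le_integrable h => //.
  - apply/measurable_EFinP; apply: subspace_continuous_measurable_fun => //.
    by apply: continuous_powR_expRN; lra.
  - move=> t; rewrite /= in_itv/= andbT => t0; rewrite lee_fin add0r.
    rewrite ger0_norm ?mulr_ge0 ?powR_ge0 ?expR_ge0//.
    rewrite ger0_norm ?mulr_ge0 ?expR_ge0//.
    have -> : expR (- (t / 2)) = expR (- t) * expR (t / 2).
      by rewrite -expRD; congr expR; lra.
    rewrite mulrCA mulrC ler_wpM2l ?expR_ge0//.
    have h : 1 + t / 2 <= expR (t / 2) by exact: expR_ge1Dx.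
    apply: (@le_trans _ _ (1 + t)); last lra.
    have [t1|/ltW t1] := leP t 1.
      apply: (@le_trans _ _ 1); last by rewrite lerDl.
      have e1 : 1 `^ (1 / 2) = 1 :> R by rewrite powR1.
      by rewrite -[leRHS]e1 ge0_ler_powR ?nnegrE//; lra.
    apply: (@le_trans _ _ t); last by rewrite lerDr.
    by rewrite -[leRHS]powRr1// ler_powR//; lra.
have z1 : 1 < k.+1%:R + 1 / 2 :> R.
  by rewrite -(natr1 k); have := ler0n R k; lra.
have [h _] := Gamma_FTC z1.
pose g t : R := t `^ (k.+1%:R + 1 / 2) * expR (- t) -
      (k.+1%:R + 1 / 2) * (t `^ (k.+1%:R + 1 / 2 - 1) * expR (- t)).
pose p t : R := t `^ (k%:R + 1 / 2) * expR (- t).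
have -> : EFin \o (fun t : R => t `^ (k.+1%:R + 1 / 2) * expR (- t)) =
  ((EFin \o g) \+ (fun t => (k.+1%:R + 1 / 2)%:E * (p t)%:E))%E.
  apply/funext => t /=; rewrite -EFinM -EFinD /g /p; congr EFin.
  have -> : k.+1%:R + 1 / 2 - 1 = k%:R + 1 / 2 :> R by rewrite -(natr1 k); field.
  by rewrite subrK.
by apply: integrableD => //; exact: integrableZl.
Qed.

(** Only half-integers from 3/2 on are treated, these being the arguments in the normalisation of
    [Lbar]. *)
Lemma GammaS (k : nat) :
  Gamma (k%:R + 5 / 2 : R) = (k%:R + 3 / 2) * Gamma (k%:R + 3 / 2 : R).
Proof.
have z1 : 1 < k.+1%:R + 1 / 2 :> R.
  by rewrite -(natr1 k); have := ler0n R k; lra.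
have [_] := Gamma_FTC z1.
have e : k.+1%:R + 1 / 2 - 1 = k%:R + 1 / 2 :> R by rewrite -(natr1 k); field.
rewrite e RintegralB//; last 2 first.
- exact: integrable_powR_expRN.
- by apply: (integrableZl _ _ (integrable_powR_expRN k)).
rewrite RintegralZl//; last exact: integrable_powR_expRN.
have i0 j : mu.-integrable `]0, +oo[
    (EFin \o (fun t : R => t `^ (j%:R + 1 / 2) * expR (- t))).
  apply: (integrableS _ _ _ (integrable_powR_expRN j)) => // t /=.
  by rewrite !in_itv/= !andbT => /ltW.
rewrite /Gamma.
have -> : k%:R + 5 / 2 - 1 = k.+1%:R + 1 / 2 :> R by rewrite -(natr1 k); field.
have -> : k%:R + 3 / 2 - 1 = k%:R + 1 / 2 :> R by field.
have -> : k%:R + 3 / 2 = k.+1%:R + 1 / 2 :> R by rewrite -(natr1 k); field.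
by rewrite !Rintegral_itv_obnd_cbnd// => /eqP; rewrite subr_eq0 => /eqP.
Qed.

Lemma Gamma_gt0 (k : nat) : 0 < Gamma (k%:R + 3 / 2 : R).
Proof.
elim: k => [|k IH]; last first.
  have -> : k.+1%:R + 3 / 2 = k%:R + 5 / 2 :> R by rewrite -(natr1 k); field.
  by rewrite GammaS mulr_gt0//; have := ler0n R k; lra.
have e : 0%:R + 3 / 2 - 1 = 0%:R + 1 / 2 :> R by field.
rewrite /Gamma Rintegral_itv_obnd_cbnd e; last first.
  apply: (integrableS _ _ _ (integrable_powR_expRN 0)) => // t /=.
  by rewrite !in_itv/= !andbT => /ltW.
rewrite -lte_fin fineK; last first.
  by apply: integrable_fin_num => //; exact: integrable_powR_expRN.
have mf : measurable_fun `[(0 : R), +oo[ (fun t : R => t `^ (0%:R + 1 / 2) * expR (- t)).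
  by apply/measurable_EFinP; exact: (measurable_int _ (integrable_powR_expRN 0)).
have sub : `[(1 : R), 2]%classic `<=` `[0, +oo[%classic.
  by move=> t /=; rewrite !in_itv/= andbT => /andP[t1 _]; rewrite (le_trans ler01).
pose f (t : R) := t `^ (0%:R + 1 / 2) * expR (- t).
(* On [1, 2] the integrand is at least e^(-2). *)
have h1 : (0 < \int[mu]_(t in `[1%R, 2%R]) (expR (- 2))%:E)%E.
  rewrite integral_cst//= lebesgue_measure_itv/= lte_fin ltr1n -EFinB -EFinM.
  by rewrite lte_fin mulr_gt0 ?expR_gt0//; lra.
have h2 : (\int[mu]_(t in `[1%R, 2%R]) (expR (- 2))%:E <=
    \int[mu]_(t in `[1%R, 2%R]) (f t)%:E)%E.
  apply: ge0_le_integral => //.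
  - by apply/measurable_EFinP; apply: measurable_funS mf.
  - move=> t /=; rewrite in_itv/= => /andP[t1 t2]; rewrite lee_fin.
    rewrite -[leLHS]mul1r ler_pM ?expR_ge0//; last by rewrite ler_expR lerN2.
    have e1 : 1 `^ (0%:R + 1 / 2) = 1 :> R by rewrite powR1.
    by rewrite -[leLHS]e1 ge0_ler_powR ?nnegrE//; lra.
apply: (lt_le_trans h1 (le_trans h2 _)).
apply: ge0_subset_integral => //; first exact/measurable_EFinP.
by move=> t _; rewrite lee_fin mulr_ge0 ?powR_ge0 ?expR_ge0.
Qed.

End Gamma.

(** * Gaussian integrals *)

Section Gauss1.
Variable R : realType.
Notation mu := (@lebesgue_measure R).

Definition gaussian (x : R) : R := expR (- (x ^+ 2 / 2)).

Lemma gaussian_gt0 x : 0 < gaussian x. Proof. exact: expR_gt0. Qed.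

Lemma gaussianN x : gaussian (- x) = gaussian x.
Proof. by rewrite /gaussian sqrrN. Qed.

Let scaleE (a b : R) : a *: b = a * b. Proof. by []. Qed.

Lemma is_derive_gaussian (x : R) :
  is_derive x 1 gaussian (- (x * gaussian x)).
Proof.
have h1 := is_deriveZ (2^-1 : R) (is_deriveX 2 (is_derive_id x (1 : R))).
have h2 := is_derive1_comp (is_derive_expRN _) h1.
have e1 : gaussian = (fun t : R => expR (- t)) \o (2^-1 *: (id ^+ 2)).
  by apply/funext => t; rewrite /gaussian !fctE scaleE mulrC.
have -> : - (x * gaussian x) =
  - expR (- (2^-1 *: (id ^+ 2)) x) * (2^-1 *: ((2%:R * id x ^+ 2.-1) *: 1)).
  rewrite /gaussian !fctE !scaleE/= expr1 (mulrC 2^-1 (_ ^+ 2)).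
  by field.
rewrite e1.
exact: h2.
Qed.

(** At k = 0 the exponent [k.-1] is 0 again, but its coefficient vanishes; the moment recurrences
    below keep this convention. *)
Lemma is_derive_exprM_gaussian (k : nat) (x : R) :
  is_derive x 1 (fun t : R => - (t ^+ k * gaussian t))
    (x ^+ k.+1 * gaussian x - k%:R * (x ^+ k.-1 * gaussian x)).
Proof.
have h := is_deriveN (is_deriveM (is_deriveX k (is_derive_id x (1 : R)))
  (is_derive_gaussian x)).
have -> : (fun t : R => - (t ^+ k * gaussian t)) = - ((id ^+ k) * gaussian).
  by apply/funext => t; rewrite !fctE.
rewrite (_ : _ - _ = - ((id ^+ k) x *: - (x * gaussian x) +
    gaussian x *: ((k%:R * id x ^+ k.-1) *: 1))) //.
by rewrite !fctE !scaleE/= exprS; ring.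
Qed.

Lemma continuous_exprM_gaussian (k : nat) :
  continuous (fun t : R => t ^+ k * gaussian t).
Proof.
move=> x; have h := is_derive_exprM_gaussian k x.
have -> : (fun t : R => t ^+ k * gaussian t) =
    - (fun t : R => - (t ^+ k * gaussian t)).
  by apply/funext => t /=; rewrite opprK.
apply: differentiable_continuous; apply/derivable1_diffP.
by apply: derivableN; case: h.
Qed.

Lemma gaussian_le x : gaussian x <= expR (1 / 2) * expR (- x).
Proof.
by rewrite -expRD ler_expR; have := sqr_ge0 (x - 1); rewrite sqrrB1; lra.
Qed.

Lemma cvg_exprM_gaussian (k : nat) :
  (fun x : R => x ^+ k * gaussian x) @ +oo --> (0 : R).
Proof.
apply: (@squeeze_cvgr _ _ _ _ (fun=> 0)
  (fun x : R => expR (1 / 2) * (x ^+ k * expR (- x)))).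
- near=> x.
  have x0 : 0 < x by near: x; exact: nbhs_pinfty_gt.
  apply/andP; split.
    by rewrite mulr_ge0 ?exprn_ge0 ?(ltW x0) ?ltW ?gaussian_gt0.
  by rewrite [leRHS]mulrCA ler_wpM2l ?gaussian_le// exprn_ge0// ltW.
- exact: cvg_cst.
- rewrite -[X in _ --> X](mulr0 (expR (1 / 2) : R)).
  by apply: cvgM; [exact: cvg_cst|exact: cvg_exprM_expRN].
Unshelve. all: by end_near. Qed.

(** Gaussian integration by parts on the half-line. For k > 0 the integrand is t^(k-1) (t^2 - k)
    times the Gaussian, hence nonnegative beyond k + 1; the boundary term at 0 survives only for k =
    0. *)
Lemma gaussian_FTC (k : nat) :
  mu.-integrable `[0, +oo[ (EFin \o (fun t : R =>
    t ^+ k.+1 * gaussian t - k%:R * (t ^+ k.-1 * gaussian t))) /\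
  \int[mu]_(t in `[0, +oo[)
    (t ^+ k.+1 * gaussian t - k%:R * (t ^+ k.-1 * gaussian t)) =
  (0 ^+ k * gaussian 0 : R).
Proof.
rewrite -[RHS]opprK -[X in _ = X]sub0r.
apply: (@eventually_ge0_FTC2y R _ (fun t => - (t ^+ k * gaussian t)) 0 k.+1%:R 0) => //.
- move=> x kx; have k1 := ler0n R k.
  have x1 : 1 <= x by apply: le_trans kx; rewrite ler1n.
  have x0 : 0 <= x by rewrite (le_trans ler01).
  case: k kx k1 => [|k] kx k1.
    by rewrite mul0r subr0 mulr_ge0 ?exprn_ge0// ltW// gaussian_gt0.
  rewrite /= mulrA -mulrBl mulr_ge0//; last by rewrite ltW// gaussian_gt0.
  rewrite subr_ge0 !exprS mulrA ler_wpM2r ?exprn_ge0//.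
  apply: (@le_trans _ _ x); last by rewrite ler_peMr.
  by apply: le_trans kx; rewrite ler_nat.
- apply: continuous_subspaceT.
  have h : continuous ((fun t : R => t ^+ k.+1 * gaussian t) -
     (fun=> k%:R) * (fun t : R => t ^+ k.-1 * gaussian t)).
    move=> x; apply: cvgB; first exact: continuous_exprM_gaussian.
    by apply: cvgM; [exact: cvg_cst|exact: continuous_exprM_gaussian].
  exact: h.
- by rewrite -[X in _ --> X]oppr0; apply: cvgN; exact: cvg_exprM_gaussian.
- by move=> x x0; case: (is_derive_exprM_gaussian k x).
- have h : {for 0, continuous (fun t : R => - (t ^+ k * gaussian t))}.
    by apply: cvgN; exact: continuous_exprM_gaussian.
  exact: cvg_at_right_filter.
- by move=> x _; have h := is_derive_exprM_gaussian k x; rewrite derive1E derive_val.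
Qed.

(** The recurrence links exponents two apart, so two consecutive exponents are carried through the
    induction. Exponent 0 is dominated using (t - 1/2)^2 >= 0, and exponent 1 is [gaussian_FTC] at k
    = 0. *)
Lemma integrable_exprM_gaussian0 (k : nat) :
  mu.-integrable `[0, +oo[ (EFin \o (fun t : R => t ^+ k * gaussian t)).
Proof.
suff [] : mu.-integrable `[0, +oo[ (EFin \o (fun t : R => t ^+ k * gaussian t))
  /\ mu.-integrable `[0, +oo[ (EFin \o (fun t : R => t ^+ k.+1 * gaussian t)) by [].
elim: k => [|k [IH1 IH2]].
  split.
    have h : mu.-integrable `[0, +oo[
        (fun t : R => (expR (1 / 8))%:E * (expR (- (t / 2)))%:E)%E.
      by apply: integrableZl => //; exact: integrable_expRN_half.
    apply: le_integrable h => //.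
      by apply/measurable_EFinP; apply/measurable_funTS;
        apply: continuous_measurable_fun; exact: continuous_exprM_gaussian.
    move=> t _; rewrite lee_fin expr0 mul1r.
    rewrite !ger0_norm ?mulr_ge0 ?expR_ge0//= -expRD ler_expR.
    by have := sqr_ge0 (t - 1 / 2); rewrite sqrrB; lra.
  have [h _] := gaussian_FTC 0.
  apply: eq_integrable h => // t _ /=.
  by rewrite mul0r subr0.
split=> //.
have [h _] := gaussian_FTC k.+1.
pose g t : R := t ^+ k.+2 * gaussian t - k.+1%:R * (t ^+ k.+1.-1 * gaussian t).
pose p t : R := t ^+ k * gaussian t.
have -> : EFin \o (fun t : R => t ^+ k.+2 * gaussian t) =
  ((EFin \o g) \+ (fun t => (k.+1%:R)%:E * (p t)%:E))%E.
  apply/funext => t /=; rewrite -EFinM -EFinD /g /p; congr EFin.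
  by rewrite /= subrK.
by apply: integrableD => //; exact: integrableZl.
Qed.

Lemma integrable_exprM_gaussian (k : nat) :
  mu.-integrable setT (EFin \o (fun t : R => t ^+ k * gaussian t)).
Proof.
have m : measurable_fun setT (fun t : R => t ^+ k * gaussian t).
  by apply: continuous_measurable_fun; exact: continuous_exprM_gaussian.
apply/integrableP; split; first exact/measurable_EFinP.
under eq_integral do rewrite /= normrM normrX (gtr0_norm (gaussian_gt0 _)).
rewrite ge0_symfun_integralT.
- have -> : [set x : R | 0 <= x] = `[0, +oo[%classic.
    by apply/seteqP; split => x/=; rewrite in_itv/= andbT.
  apply: lte_mul_pinfty => //.
  have /integrableP[_] := integrable_exprM_gaussian0 k.
  congr (_ < _)%E; apply: eq_integral => t; rewrite inE/= in_itv/= andbT => t0.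
  by rewrite normrM normrX (gtr0_norm (gaussian_gt0 _)).
- by move=> t; rewrite mulr_ge0 ?exprn_ge0// ltW// gaussian_gt0.
- have -> : (fun t : R => `|t| ^+ k * gaussian t) =
      Num.norm \o (fun t => t ^+ k * gaussian t).
    by apply/funext => t /=; rewrite normrM normrX (gtr0_norm (gaussian_gt0 _)).
  move=> t; apply: continuous_comp; first exact: continuous_exprM_gaussian.
  exact: norm_continuous.
- by move=> t /=; rewrite normrN gaussianN.
Qed.

Lemma Rintegral_oppr (f : R -> R) : mu.-integrable setT (EFin \o f) ->
  mu.-integrable setT (EFin \o (f \o -%R)) -> \int[mu]_x f x = \int[mu]_x f (- x).
Proof.
move=> fi fiN; rewrite /Rintegral; congr fine.
transitivity (\int[pushforward mu (-%R : measurableTypeR R -> measurableTypeR R)]_x (f x)%:E)%E.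
  by apply: eq_measure_integral => A mA _; exact/esym/lebesgue_measureN.
by rewrite integral_pushforward//=; case/integrableP : fi.
Qed.

(** Parity reduces the claim to the half-line: odd moments vanish and even ones are twice the
    half-line moments. In the remaining case k is odd, so the boundary term of [gaussian_FTC] is
    0. *)
Lemma gaussian_moment_rec (k : nat) :
  \int[mu]_x (x ^+ k.+1 * gaussian x) =
  k%:R * \int[mu]_x (x ^+ k.-1 * gaussian x) :> R.
Proof.
have odd0 j : odd j -> \int[mu]_x (x ^+ j * gaussian x) = 0 :> R.
  move=> oj; have i := integrable_exprM_gaussian j.
  have e x : (- x) ^+ j * gaussian (- x) = - 1 * (x ^+ j * gaussian x).
    by rewrite gaussianN exprNn -signr_odd oj expr1 mulrA.
  have := Rintegral_oppr i; rewrite (_ : _ \o -%R = fun x => - 1 * (x ^+ j * gaussian x)); last first.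
    by apply/funext => x; exact: e.
  move=> /(_ (integrableZl measurableT (-1) i)).
  under [RHS]eq_Rintegral.
    by move=> x _; rewrite e; over.
  rewrite RintegralZl//.
  by lra.
have even2 j : ~~ odd j -> \int[mu]_x (x ^+ j * gaussian x) =
    2 * \int[mu]_(x in `[0, +oo[) (x ^+ j * gaussian x) :> R.
  move=> oj; rewrite /Rintegral ge0_symfun_integralT.
  - have -> : [set x : R | 0 <= x] = `[0, +oo[%classic.
      by apply/seteqP; split => x/=; rewrite in_itv/= andbT.
    by rewrite fineM// integrable_fin_num//; exact: integrable_exprM_gaussian0.
  - by move=> t; rewrite mulr_ge0 ?(ltW (gaussian_gt0 _))// exprn_even_ge0.
  - exact: continuous_exprM_gaussian.
  - by move=> t/=; rewrite gaussianN exprNn -signr_odd (negbTE oj) expr0 mul1r.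
have [ok|ek] := boolP (odd k); last first.
  rewrite odd0//=.
  by case: k ek => [|k] ek; rewrite ?mul0r//= odd0 ?mulr0//; move: ek => /=; case: odd.
case: k ok => // k ok.
have ek : ~~ odd k by [].
rewrite !even2//= ?negbK//.
have [_] := gaussian_FTC k.+1.
rewrite RintegralB//; last 2 first.
- exact: integrable_exprM_gaussian0.
- by apply: (integrableZl _ _ (integrable_exprM_gaussian0 k)).
rewrite RintegralZl//; last exact: integrable_exprM_gaussian0.
by rewrite expr0n mul0r => /eqP; rewrite subr_eq0 => /eqP ->; rewrite mulrCA.
Qed.

Lemma gaussian_integral_gt0 : 0 < \int[mu]_x gaussian x.
Proof.
have i0 : mu.-integrable setT (EFin \o gaussian).
  have := integrable_exprM_gaussian 0; apply: eq_integrable => // x _ /=.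
  by rewrite expr0 mul1r.
rewrite -lte_fin fineK; last exact: integrable_fin_num.
have mg : measurable_fun setT gaussian by apply/measurable_EFinP; exact: (measurable_int _ i0).
have h1 : (0 < \int[mu]_(t in `[0%R, 1%R]) (expR (- 1))%:E)%E.
  rewrite integral_cst//= lebesgue_measure_itv/= lte_fin ltr01 -EFinB -EFinM.
  by rewrite lte_fin mulr_gt0 ?expR_gt0//; lra.
have h2 : (\int[mu]_(t in `[0%R, 1%R]) (expR (- 1))%:E <=
    \int[mu]_(t in `[0%R, 1%R]) (gaussian t)%:E)%E.
  apply: ge0_le_integral => //.
  - by apply/measurable_EFinP; apply: measurable_funS mg.
  - move=> t /=; rewrite in_itv/= => /andP[t1 t2]; rewrite lee_fin ler_expR.
    have := mulr_ge0 t1 t1; nra.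
apply: (lt_le_trans h1 (le_trans h2 _)).
apply: ge0_subset_integral => //; first exact/measurable_EFinP.
by move=> t _; rewrite lee_fin ltW// gaussian_gt0.
Qed.

End Gauss1.

(** * Product measures and Gaussian moments in three variables *)

Definition lebesgue2 (R : realType) :=
  (@lebesgue_measure R \x @lebesgue_measure R)%E.

HB.instance Definition _ (R : realType) := measure_function.Measure.on (@lebesgue2 R).

(** Fubini for the outer product in [lebesgue3] needs a sigma-finite first factor, so the planar
    measure is named and exhausted by squares. *)
Lemma lebesgue2_sigma_finite (R : realType) : sigma_finite setT (@lebesgue2 R).
Proof.
exists (fun n : nat => `]- n%:R, n%:R[ `*` `]- n%:R, n%:R[).
  apply/seteqP; split=> // -[x y] _.
  exists (Num.truncn (`|x| + `|y|)).+1 => //.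
  have := truncnS_gt (`|x| + `|y|); move: (_.+1) => n h.
  by split; rewrite /= in_itv/=; apply/andP; split;
    have := ler_norm x; have := ler_norm (- x);
    have := ler_norm y; have := ler_norm (- y); rewrite !normrN; lra.
move=> n; split; first exact: measurableX.
rewrite /lebesgue2 product_measure1E//.
have h : (@lebesgue_measure R `](- (n%:R : R))%R, (n%:R : R)%R[ < +oo)%E.
  by rewrite lebesgue_measure_itv/=; case: ifP => // _; rewrite -EFinB ltry.
by apply: lte_mul_pinfty => //; rewrite ge0_fin_numE.
Qed.

HB.instance Definition _ (R : realType) :=
  @Measure_isSigmaFinite.Build _ _ _ (@lebesgue2 R) (@lebesgue2_sigma_finite R).

Section ProductFunctions.
Local Open Scope ereal_scope.
Context d1 d2 (T1 : measurableType d1) (T2 : measurableType d2) (R : realType).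
Variable m1 : {sigma_finite_measure set T1 -> \bar R}.
Variable m2 : {sigma_finite_measure set T2 -> \bar R}.
Variables (f : T1 -> R) (h : T2 -> R).
Hypotheses (fi : m1.-integrable setT (EFin \o f))
  (hi : m2.-integrable setT (EFin \o h)).

Lemma integrable_prodM :
  (m1 \x m2).-integrable setT (EFin \o (fun z => f z.1 * h z.2)%R).
Proof.
have mf : measurable_fun setT f by apply/measurable_EFinP; exact: measurable_int fi.
have mh : measurable_fun setT h by apply/measurable_EFinP; exact: measurable_int hi.
apply/integrable12ltyP.
  apply/measurable_EFinP; apply: measurable_funM.
    exact: (measurableT_comp mf measurable_fst).
  exact: (measurableT_comp mh measurable_snd).
under eq_integral => x _.
  under eq_integral do rewrite /= normrM EFinM.
  rewrite ge0_integralZl//; last by apply/measurable_EFinP; exact: measurableT_comp.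
  over.
have hb : \int[m2]_y (`|h y|)%:E < +oo by case/integrableP : hi.
have fb : \int[m1]_y (`|f y|)%:E < +oo by case/integrableP : fi.
rewrite ge0_integralZr//; last 2 first.
- by apply/measurable_EFinP; exact: measurableT_comp.
- exact: integral_ge0.
apply: lte_mul_pinfty => //; first exact: integral_ge0.
by rewrite ge0_fin_numE//; exact: integral_ge0.
Qed.

Lemma Rintegral_prodM : (\int[m1 \x m2]_z (f z.1 * h z.2) =
  \int[m1]_x f x * \int[m2]_y h y)%R.
Proof.
have hf := integrable_fin_num measurableT hi.
pose c : R := fine (\int[m2]_y (h y)%:E).
have e x : \int[m2]_y (f x * h y)%:E = c%:E * (f x)%:E.
  have -> : \int[m2]_y (f x * h y)%:E = (f x)%:E * \int[m2]_y (h y)%:E.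
    by rewrite -(integralZl measurableT hi).
  by rewrite -(fineK hf) muleC.
rewrite /Rintegral -(integral12_prod_meas1 integrable_prodM) /fubini_F/=.
rewrite (eq_integral (fun x => c%:E * (f x)%:E)); last by move=> x _; exact: e.
rewrite (integralZl measurableT fi) fineM//; first by rewrite /= mulrC.
exact: (integrable_fin_num measurableT fi).
Qed.

End ProductFunctions.

Section Gauss3.
Variable R : realType.
Notation mu := (@lebesgue_measure R).

Lemma lebesgue3_prod (f1 f2 f3 : R -> R) :
  mu.-integrable setT (EFin \o f1) -> mu.-integrable setT (EFin \o f2) ->
  mu.-integrable setT (EFin \o f3) ->
  (@lebesgue3 R).-integrable setT
    (EFin \o (fun z : velocity R => f1 z.1.1 * f2 z.1.2 * f3 z.2)) /\
  \int[@lebesgue3 R]_z (f1 z.1.1 * f2 z.1.2 * f3 z.2) =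
    \int[mu]_x f1 x * \int[mu]_x f2 x * \int[mu]_x f3 x.
Proof.
move=> i1 i2 i3.
have i12 : (@lebesgue2 R).-integrable setT (EFin \o (fun z => f1 z.1 * f2 z.2)).
  exact: integrable_prodM.
split; first exact: (@integrable_prodM _ _ _ _ _ (@lebesgue2 R) mu _ _ i12 i3).
have := @Rintegral_prodM _ _ _ _ _ (@lebesgue2 R) mu _ _ i12 i3.
by rewrite /lebesgue3 => ->; congr (_ * _); rewrite Rintegral_prodM.
Qed.

Lemma maxwellianE (x : velocity R) :
  maxwellian x = (2 * pi) `^ (- (3 / 2)) *
    (gaussian x.1.1 * gaussian x.1.2 * gaussian x.2).
Proof.
rewrite /maxwellian; congr (_ * _); rewrite /gaussian -!expRD; congr expR.
by rewrite /norm2 !big_ord_recr big_ord0/= /vcoord/=; field.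
Qed.

Definition gmon (m : 'I_3 -> nat) (x : velocity R) : R :=
  \prod_(i < 3) vcoord i x ^+ m i * maxwellian x.

Definition moment (k : nat) : R := \int[mu]_x (x ^+ k * gaussian x).

Lemma moment_rec k : moment k.+1 = k%:R * moment k.-1.
Proof. exact: gaussian_moment_rec. Qed.

Lemma moment0_gt0 : 0 < moment 0.
Proof.
rewrite /moment; under eq_Rintegral do rewrite expr0 mul1r.
exact: gaussian_integral_gt0.
Qed.

Definition maxwellian_peak : R := (2 * pi) `^ (- (3 / 2)).

Lemma maxwellian_peak_gt0 : 0 < maxwellian_peak.
Proof. by rewrite powR_gt0// mulr_gt0// pi_gt0. Qed.

Lemma gmonE m : gmon m = fun x => maxwellian_peak *
  ((x.1.1 ^+ m ord0 * gaussian x.1.1) *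
   (x.1.2 ^+ m (inord 1) * gaussian x.1.2) *
   (x.2 ^+ m (inord 2) * gaussian x.2)).
Proof.
apply/funext => x; rewrite /gmon maxwellianE -/maxwellian_peak.
rewrite !big_ord_recl big_ord0/=.
have -> : lift ord0 ord0 = inord 1 :> 'I_3 by apply/val_inj; rewrite /= inordK.
have -> : lift ord0 (lift ord0 ord0) = inord 2 :> 'I_3.
  by apply/val_inj; rewrite /= inordK.
by rewrite /vcoord/= !inordK//=; ring.
Qed.

Lemma integrable_gmon m : (@lebesgue3 R).-integrable setT (EFin \o gmon m).
Proof.
rewrite gmonE.
have [h _] := lebesgue3_prod (integrable_exprM_gaussian R (m ord0))
  (integrable_exprM_gaussian R (m (inord 1)))
  (integrable_exprM_gaussian R (m (inord 2))).
exact: (integrableZl measurableT maxwellian_peak h).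
Qed.

Lemma Rintegral_gmon m : \int[@lebesgue3 R]_x gmon m x =
  maxwellian_peak * \prod_(i < 3) moment (m i).
Proof.
rewrite gmonE.
have [h e] := lebesgue3_prod (integrable_exprM_gaussian R (m ord0))
  (integrable_exprM_gaussian R (m (inord 1)))
  (integrable_exprM_gaussian R (m (inord 2))).
rewrite RintegralZl// e; congr (_ * _); rewrite !big_ord_recl big_ord0 mulr1.
have -> : lift ord0 ord0 = inord 1 :> 'I_3 by apply/val_inj; rewrite /= inordK.
have -> : lift ord0 (lift ord0 ord0) = inord 2 :> 'I_3.
  by apply/val_inj; rewrite /= inordK.
by rewrite mulrA.
Qed.

Definition polyvfun (p : mpoly 3 R) : vfun R :=
  fun x => meval (fun i => vcoord i x) p.

Lemma polyvfunX m : polyvfun (mpolyX R m) = fun x => \prod_(i < 3) vcoord i x ^+ m i.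
Proof. by apply/funext => x; rewrite /polyvfun mevalX. Qed.

Lemma integrable_polyvfun p :
  (@lebesgue3 R).-integrable setT (EFin \o (fun x => polyvfun p x * maxwellian x)).
Proof.
elim/mpolyind: p => [|c m p _ _ IH].
  rewrite (_ : _ \o _ = cst 0%E); first exact: integrable0.
  by apply/funext => x /=; rewrite /polyvfun meval0 mul0r.
have h := integrableD measurableT (integrableZl measurableT c (integrable_gmon m)) IH.
apply: eq_integrable h => // x _ /=.
rewrite /polyvfun mevalD mevalZ mevalX -EFinM -EFinD; congr EFin.
by rewrite /gmon; ring.
Qed.

(** Integral of a polynomial against the Maxwellian weight. Pairings of basis functions become
    values of this functional and are then computed by polynomial algebra. *)
Definition gexp (p : mpoly 3 R) : R :=
  \int[@lebesgue3 R]_x (polyvfun p x * maxwellian x).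

Lemma gexpD p q : gexp (p + q) = gexp p + gexp q.
Proof.
rewrite /gexp -RintegralD//; try exact: integrable_polyvfun.
by apply: eq_Rintegral => x _; rewrite /polyvfun mevalD mulrDl.
Qed.

Lemma gexpZ c p : gexp (c *: p) = c * gexp p.
Proof.
rewrite /gexp -RintegralZl//; try exact: integrable_polyvfun.
by apply: eq_Rintegral => x _; rewrite /polyvfun mevalZ mulrA.
Qed.

Lemma gexp0 : gexp 0 = 0.
Proof. by rewrite -(scale0r 0) gexpZ mul0r. Qed.

Lemma gexp_sum I (r : seq I) (P : pred I) F :
  gexp (\sum_(i <- r | P i) F i) = \sum_(i <- r | P i) gexp (F i).
Proof.
elim: r => [|i r IH]; first by rewrite !big_nil gexp0.
by rewrite !big_cons; case: ifP => // _; rewrite gexpD IH.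
Qed.

Lemma gexpX m : gexp (mpolyX R m) = maxwellian_peak * \prod_(i < 3) moment (m i).
Proof. by rewrite -Rintegral_gmon /gexp polyvfunX. Qed.

Lemma gexp1_gt0 : 0 < gexp 1.
Proof.
rewrite -mpolyX0 gexpX mulr_gt0 ?maxwellian_peak_gt0// prodr_gt0// => i _.
by rewrite mnm0E moment0_gt0.
Qed.

Lemma gexp_IBP i p : gexp (mpolyX R (mnm1 i) * p) = gexp (mderiv i p).
Proof.
elim/mpolyind: p => [|c m p _ _ IH]; first by rewrite mulr0 mderiv0.
rewrite mulrDr mderivD !gexpD IH -scalerAr mderivZ !gexpZ; congr (_ * _ + _).
rewrite -mpolyXD mderivX gexpZ !gexpX mulrCA; congr (_ * _).
rewrite (bigD1 i)//= [in RHS](bigD1 i)//= mulrA.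
rewrite !mnmE eqxx add1n subn1 moment_rec; congr (_ * _).
by apply: eq_bigr => j ji; rewrite !mnmE eq_sym (negbTE ji) add0n subn0.
Qed.

End Gauss3.

(** * The weighted space L2 *)

Section LinClosed.
Variables (R : realType) (E : vfun R -> Prop).
Hypotheses (E0 : E (fun=> 0)) (El : forall c f g, E f -> E g -> E (lin c f g)).

(** Closure properties are derived once for any predicate stable under [lin], then instantiated for
    [L2], [D], [V b k], spans and [weighted]. *)
Lemma lin_closedZ c f : E f -> E (fun x => c * f x).
Proof.
by move=> /(El c)/(_ E0); congr E; apply/funext => x; rewrite /lin addr0.
Qed.

Lemma lin_closedD f g : E f -> E g -> E (fun x => f x + g x).
Proof.
by move=> Ef /(El 1 Ef); congr E; apply/funext => x; rewrite /lin mul1r.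
Qed.

Lemma lin_closedN f : E f -> E (fun x => - f x).
Proof. by move/(lin_closedZ (-1)); congr E; apply/funext => x; rewrite mulN1r. Qed.

Lemma lin_closedB f g : E f -> E g -> E (fun x => f x - g x).
Proof. by move=> Ef Eg; apply: lin_closedD => //; exact: lin_closedN. Qed.

Lemma lin_closed_sum I (r : seq I) (P : pred I) (F : I -> vfun R) :
  (forall i, P i -> E (F i)) -> E (fun x => \sum_(i <- r | P i) F i x).
Proof.
move=> EF; elim: r => [|i r IH].
  by move: E0; congr E; apply/funext => x; rewrite big_nil.
have [Pi|Pi] := boolP (P i).
  have := lin_closedD (EF i Pi) IH; congr E; apply/funext => x.
  by rewrite big_cons Pi.
by move: IH; congr E; apply/funext => x; rewrite big_cons (negbTE Pi).
Qed.

End LinClosed.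

Section L2.
Variable R : realType.
Implicit Types (f g h : vfun R) (c : R).
Notation mu := (@lebesgue3 R).
Notation mfun f := (measurable_fun [set: velocity R] (f : velocity R -> measurableTypeR R)).

Lemma maxwellian_gt0 (x : velocity R) : 0 < maxwellian x.
Proof.
by rewrite /maxwellian mulr_gt0 ?expR_gt0// powR_gt0// mulr_gt0// pi_gt0.
Qed.

Let maxwellian_ge0 (x : velocity R) : 0 <= maxwellian x.
Proof. exact/ltW/maxwellian_gt0. Qed.

Lemma measurable_maxwellian : mfun (@maxwellian R).
Proof.
have i := integrable_polyvfun (1 : mpoly 3 R).
have : measurable_fun setT (EFin \o (fun x : velocity R => polyvfun 1 x * maxwellian x)).
  exact: (measurable_int _ i).
move=> /measurable_EFinP; congr measurable_fun.
by apply/funext => x; rewrite /polyvfun meval1 mul1r.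
Qed.

Lemma measurable_vcoord (i : 'I_3) : mfun (fun x : velocity R => vcoord i x).
Proof.
rewrite /vcoord; case: (val i) => [|[|k]].
- exact: (measurableT_comp measurable_fst measurable_fst).
- exact: (measurableT_comp measurable_snd measurable_fst).
- exact: measurable_snd.
Qed.

Lemma measurable_polyvfun (p : mpoly 3 R) : mfun (polyvfun p).
Proof.
elim/mpolyind: p => [|k m p _ _ IH].
  rewrite (_ : polyvfun 0 = cst 0); first exact: measurable_cst.
  by apply/funext => x; rewrite /polyvfun meval0.
rewrite (_ : polyvfun _ = fun x => k * (\prod_(i < 3) vcoord i x ^+ m i) + polyvfun p x).
  apply: measurable_funD => //; apply: measurable_funM; first exact: measurable_cst.
  rewrite [X in measurable_fun _ X](_ : _ = fun x : velocity R =>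
     vcoord ord0 x ^+ m ord0 * (vcoord (lift ord0 ord0) x ^+ m (lift ord0 ord0) *
     vcoord (lift ord0 (lift ord0 ord0)) x ^+ m (lift ord0 (lift ord0 ord0)))).
    by repeat apply: measurable_funM; apply: measurable_funX; exact: measurable_vcoord.
  by apply/funext => x; rewrite !big_ord_recl big_ord0 mulr1.
by apply/funext => x; rewrite /polyvfun mevalD mevalZ mevalX.
Qed.

Lemma L2_polyvfun (p : mpoly 3 R) : L2 (polyvfun p).
Proof.
split; first exact: measurable_polyvfun.
have := integrable_polyvfun (p * p); apply: eq_integrable => // x _ /=.
by rewrite /polyvfun mevalM expr2.
Qed.

(** The bound |f g| <= f^2 + g^2 supplies the dominating function. *)
Lemma L2_integrable f g : L2 f -> L2 g ->
  mu.-integrable setT (EFin \o (fun x => f x * g x * maxwellian x)).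
Proof.
move=> [mf fi] [mg gi].
have h := integrableD measurableT fi gi.
apply: le_integrable h => //.
  apply/measurable_EFinP; apply: measurable_funM; last exact: measurable_maxwellian.
  exact: measurable_funM.
move=> x _ /=; rewrite lee_fin.
rewrite -mulrDl [leLHS]normrM [leRHS]normrM ler_wpM2r// normrM.
rewrite [leRHS]ger0_norm ?addr_ge0 ?sqr_ge0//.
rewrite -(real_normK (num_real (f x))) -(real_normK (num_real (g x))).
have := sqr_ge0 (`|f x| - `|g x|).
have := normr_ge0 (f x); have := normr_ge0 (g x); nra.
Qed.

Lemma L2_lin c f g : L2 f -> L2 g -> L2 (lin c f g).
Proof.
move=> Lf Lg; have := L2_integrable Lf Lg; case: Lf Lg => [mf fi] [mg gi] fg.
split.
  by apply: measurable_funD => //; apply: measurable_funM => //; exact: measurable_cst.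
have i1 := integrableZl measurableT (c ^+ 2) fi.
have i2 := integrableZl measurableT (2 * c) fg.
have := integrableD measurableT (integrableD measurableT i1 i2) gi.
apply: eq_integrable => // x _ /=.
by rewrite -!EFinM -!EFinD /lin; congr EFin; ring.
Qed.

Lemma L2_0 : L2 (fun=> 0 : R).
Proof.
have := L2_polyvfun 0; congr L2; apply/funext => x; by rewrite /polyvfun meval0.
Qed.

Lemma L2_Z c f : L2 f -> L2 (fun x => c * f x).
Proof. exact: lin_closedZ L2_0 (@L2_lin) _ _. Qed.

Lemma L2_D f g : L2 f -> L2 g -> L2 (fun x => f x + g x).
Proof. exact: lin_closedD (@L2_lin) _ _. Qed.

Lemma L2_N f : L2 f -> L2 (fun x => - f x).
Proof. exact: lin_closedN L2_0 (@L2_lin) _. Qed.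

Lemma L2_B f g : L2 f -> L2 g -> L2 (fun x => f x - g x).
Proof. exact: lin_closedB L2_0 (@L2_lin) _ _. Qed.

Lemma L2_sum I (r : seq I) (P : pred I) (F : I -> vfun R) :
  (forall i, P i -> L2 (F i)) -> L2 (fun x => \sum_(i <- r | P i) F i x).
Proof. exact: lin_closed_sum L2_0 (@L2_lin) _ _ _ _. Qed.

Lemma ipC f g : ip f g = ip g f.
Proof. by apply: eq_Rintegral => x _; rewrite (mulrC (f x)). Qed.

Lemma ip_linl c f g h : L2 f -> L2 g -> L2 h ->
  ip (lin c f g) h = c * ip f h + ip g h.
Proof.
move=> Lf Lg Lh; rewrite /ip -RintegralZl//; last exact: L2_integrable.
rewrite -RintegralD//; last 2 first.
- exact: (integrableZl measurableT c (L2_integrable Lf Lh)).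
- exact: L2_integrable.
by apply: eq_Rintegral => x _; rewrite /lin; ring.
Qed.

Lemma ip0l h : ip (fun=> 0) h = 0.
Proof.
rewrite /ip; under eq_Rintegral do rewrite !mul0r.
by rewrite Rintegral_cst// mul0r.
Qed.

Lemma ip0r h : ip h (fun=> 0) = 0. Proof. by rewrite ipC ip0l. Qed.

Lemma ipZl c f h : L2 f -> L2 h -> ip (fun x => c * f x) h = c * ip f h.
Proof.
move=> Lf Lh; have := ip_linl c Lf L2_0 Lh; rewrite ip0l addr0 => <-.
by congr ip; apply/funext => x; rewrite /lin addr0.
Qed.

Lemma ipDl f g h : L2 f -> L2 g -> L2 h ->
  ip (fun x => f x + g x) h = ip f h + ip g h.
Proof.
move=> Lf Lg Lh; have := ip_linl 1 Lf Lg Lh; rewrite mul1r => <-.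
by congr ip; apply/funext => x; rewrite /lin mul1r.
Qed.

Lemma ipNl f h : L2 f -> L2 h -> ip (fun x => - f x) h = - ip f h.
Proof.
move=> Lf Lh; rewrite -mulN1r -ipZl//.
by congr ip; apply/funext => x; rewrite mulN1r.
Qed.

Lemma ipBl f g h : L2 f -> L2 g -> L2 h ->
  ip (fun x => f x - g x) h = ip f h - ip g h.
Proof. by move=> Lf Lg Lh; rewrite ipDl ?ipNl//; exact: L2_N. Qed.

Lemma ip_suml I (r : seq I) (P : pred I) (F : I -> vfun R) h :
  (forall i, P i -> L2 (F i)) -> L2 h ->
  ip (fun x => \sum_(i <- r | P i) F i x) h = \sum_(i <- r | P i) ip (F i) h.
Proof.
move=> LF Lh; elim: r => [|i r IH].
  by rewrite big_nil -[RHS](ip0l h); congr ip; apply/funext => x; rewrite big_nil.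
rewrite big_cons -IH; case: ifP => Pi.
  rewrite -ipDl//; [|exact: LF|exact: L2_sum].
  by congr ip; apply/funext => x; rewrite big_cons Pi.
by congr ip; apply/funext => x; rewrite big_cons Pi.
Qed.

Lemma ipZr c f h : L2 f -> L2 h -> ip h (fun x => c * f x) = c * ip h f.
Proof. by move=> *; rewrite ipC ipZl// ipC. Qed.

Lemma ipDr f g h : L2 f -> L2 g -> L2 h ->
  ip h (fun x => f x + g x) = ip h f + ip h g.
Proof. by move=> *; rewrite ipC ipDl// !(ipC h). Qed.

Lemma ipBr f g h : L2 f -> L2 g -> L2 h ->
  ip h (fun x => f x - g x) = ip h f - ip h g.
Proof. by move=> *; rewrite ipC ipBl// !(ipC h). Qed.

Lemma ip_sumr I (r : seq I) (P : pred I) (F : I -> vfun R) h :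
  (forall i, P i -> L2 (F i)) -> L2 h ->
  ip h (fun x => \sum_(i <- r | P i) F i x) = \sum_(i <- r | P i) ip h (F i).
Proof.
by move=> LF Lh; rewrite ipC ip_suml//; apply: eq_bigr => i _; rewrite ipC.
Qed.

Lemma ip_ge0 f : 0 <= ip f f.
Proof.
by apply: Rintegral_ge0 => x _; rewrite mulr_ge0// -expr2 sqr_ge0.
Qed.

Lemma ip_mulxi i f g : ip (mulxi i f) g = ip f (mulxi i g).
Proof. by apply: eq_Rintegral => x _; rewrite /mulxi; ring. Qed.

Lemma aeq_refl f : aeq f f. Proof. exact: ae_eq_refl. Qed.

Lemma aeq_sym f g : aeq f g -> aeq g f. Proof. exact: ae_eq_sym. Qed.

Lemma aeq_trans g f h : aeq f g -> aeq g h -> aeq f h.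
Proof. exact: ae_eq_trans. Qed.

Lemma aeq_ip f g h : aeq f g -> L2 f -> L2 g -> L2 h -> ip f h = ip g h.
Proof.
move=> fg Lf Lg Lh; rewrite /ip /Rintegral; congr fine.
apply: ae_eq_integral => //.
- exact: (measurable_int _ (L2_integrable Lf Lh)).
- exact: (measurable_int _ (L2_integrable Lg Lh)).
by apply: filterS fg => x /(_ I) -> _.
Qed.

(** The Maxwellian weight is positive everywhere, so f vanishes wherever f^2 times the weight
    does. *)
Lemma ip_eq0 f : L2 f -> ip f f = 0 -> aeq f (fun=> 0).
Proof.
move=> Lf f0.
have i := L2_integrable Lf Lf.
have e : (\int[mu]_x `|(f x * f x * maxwellian x)%:E| = 0)%E.
  rewrite (eq_integral (fun x => (f x * f x * maxwellian x)%:E)); last first.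
    by move=> x _; rewrite /= ger0_norm// mulr_ge0// -expr2 sqr_ge0.
  by rewrite -(fineK (integrable_fin_num measurableT i)); congr EFin.
have m := measurable_int _ i.
have := (ae_eq_integral_abs mu measurableT m).1 e.
apply: filterS => x /(_ I) /= [] /eqP.
rewrite mulf_eq0 (gt_eqF (maxwellian_gt0 x)) orbF mulf_eq0 orbb => /eqP -> _.
by [].
Qed.

Lemma ip_CauchySchwarz f g : L2 f -> L2 g -> `|ip f g| <= L2norm f * L2norm g.
Proof.
move=> Lf Lg.
suff h : ip f g ^+ 2 <= ip f f * ip g g.
  by rewrite -sqrtrM ?ip_ge0// -sqrtr_sqr ler_wsqrtr.
have [g0|g0] := eqVneq (ip g g) 0.
  have gg := ip_eq0 Lg g0.
  by rewrite g0 mulr0 ipC (aeq_ip gg Lg L2_0 Lf) ip0l expr0n.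
have gp : 0 < ip g g by rewrite lt_def g0 ip_ge0.
have := ip_ge0 (lin (- (ip f g / ip g g)) g f).
rewrite ip_linl//; last exact: L2_lin.
rewrite ![ip _ (lin _ _ _)]ipC !ip_linl// (ipC g f).
have -> : - (ip f g / ip g g) * (- (ip f g / ip g g) * ip g g + ip f g) +
  (- (ip f g / ip g g) * ip f g + ip f f) = ip f f - ip f g ^+ 2 / ip g g.
  by field.
by rewrite subr_ge0 ler_pdivrMr.
Qed.

(** Continuity of the pairing in norm; it turns the L2 series of [collision_matrix] and
    [matrix_inverses] into numerical series. *)
Lemma cvg_ipl (u : nat -> vfun R) f h : (forall n, L2 (u n)) -> L2 f -> L2 h ->
  (fun n => L2norm (fun x => f x - u n x)) @ \oo --> (0 : R) ->
  (fun n => ip (u n) h) @ \oo --> ip f h.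
Proof.
move=> Lu Lf Lh u0.
have c0 : (fun n => L2norm (fun x => f x - u n x) * L2norm h) @ \oo --> (0 : R).
  by rewrite -[X in _ --> X](mul0r (L2norm h)); apply: cvgM => //; exact: cvg_cst.
apply/cvgrPdist_le => e e0; near=> n.
rewrite -ipBl//; apply: le_trans (ip_CauchySchwarz (L2_B Lf (Lu n)) Lh) _.
near: n; move/cvgrPdist_le : c0 => /(_ e e0); apply: filterS => n.
by rewrite sub0r normrN; apply: le_trans; exact: ler_norm.
Unshelve. all: by end_near. Qed.

End L2.

(** * Laguerre polynomials *)

Section Laguerre.
Variable R : realType.
Implicit Types (a : R) (p q : {poly R}).

(** This is n! times the generalised Laguerre polynomial L_n^(a). The recursion is the one that a
    single application of d/dx - 1 to x^(n+1+a) produces, so it matches the Rodrigues formula. *)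
Fixpoint lag n a : {poly R} :=
  if n is m.+1 then (m%:R + a + 1) *: lag m a - 'X * lag m (a + 1) else 1.

Lemma lagS n a :
  lag n.+1 a = (n%:R + a + 1) *: lag n a - 'X * lag n (a + 1).
Proof. by []. Qed.

(** Divided by n!, this is L_n^(a) = L_n^(a+1) - L_(n-1)^(a+1); it is the source of the combinations
    of psi^n and psi^(n-1) after multiplication by xi_i. *)
Lemma lag_shift n a :
  lag n a = lag n (a + 1) - n%:R *: lag n.-1 (a + 1).
Proof.
elim: n a => [|[|n] IH] a; first by rewrite scale0r subr0.
  by rewrite /= !mulr1 !add0r scale1r -!mul_polyC !polyCD; ring.
have e1 : lag n.+1 (a + 1 + 1) = lag n.+1 (a + 1) + n.+1%:R *: lag n (a + 1 + 1).
  by rewrite [in RHS](IH (a + 1)) subrK.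
rewrite (lagS n.+1 a) (lagS n.+1 (a + 1)) e1 (IH a) -?(natr1 n.+1) -?(natr1 n).
rewrite /= -/lag -!mul_polyC !polyCD.
move: (lag n (a + 1)) (lag n (a + 1 + 1)) => A B.
by ring.
Qed.

Lemma deriv_lag n a : (lag n a)^`() = - (n%:R *: lag n.-1 (a + 1)).
Proof.
elim: n a => [|[|n] IH] a; first by rewrite derivC scale0r oppr0.
  by rewrite /= mulr1 derivB derivX derivZ derivC scaler0 sub0r scale1r.
rewrite lagS derivB derivZ derivM derivX mul1r !IH -?(natr1 n.+1) -?(natr1 n).
rewrite /= -/lag -!mul_polyC !polyCD.
move: (lag n (a + 1)) (lag n (a + 1 + 1)) => A B.
by ring.
Qed.

Lemma derivn_lag n a k : (n < k)%N -> (lag n a)^`(k) = 0.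
Proof.
elim: k n a => // k IH [|n] a nk.
  by rewrite derivSn derivC linear0.
by rewrite derivSn deriv_lag derivnN derivnZ IH ?scaler0 ?oppr0.
Qed.

Lemma derivn_lag_diag n a : (lag n a)^`(n) = ((-1) ^+ n * n`!%:R)%:P.
Proof.
elim: n a => [|n IH] a; first by rewrite derivn0 mul1r.
rewrite derivSn deriv_lag derivnN derivnZ IH.
rewrite -mul_polyC -polyCM -polyCN; congr _%:P.
by rewrite factS natrM exprS; ring.
Qed.

Definition rising (z : R) (k : nat) : R := \prod_(j < k) (z + j%:R).

Lemma risingS z k : rising z k.+1 = rising z k * (z + k%:R).
Proof. by rewrite /rising big_ord_recr. Qed.

Lemma risingSl z k : rising z k.+1 = z * rising (z + 1) k.
Proof.
rewrite /rising big_ord_recl addr0; congr (_ * _); apply: eq_bigr => j _.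
by rewrite -natr1 addrAC addrA.
Qed.

(* The moment functional of the weight [x ^ a exp(-x)], normalised at 1 *)
Definition lmom a p : R := \sum_(i < size p) p`_i * rising (a + 1) i.

Lemma lmomE a p N : (size p <= N)%N ->
  lmom a p = \sum_(i < N) p`_i * rising (a + 1) i.
Proof.
move=> pN; rewrite /lmom (big_ord_widen _ (fun i => p`_i * rising (a + 1) i) pN).
rewrite big_mkcond; apply: eq_bigr => i _; case: ltnP => // pi.
by rewrite nth_default// mul0r.
Qed.

Lemma lmomD a p q : lmom a (p + q) = lmom a p + lmom a q.
Proof.
pose N := maxn (size p) (size q).
rewrite !(@lmomE a _ N) ?leq_maxl ?leq_maxr ?(leq_trans (size_polyD _ _))//.
by rewrite -big_split; apply: eq_bigr => i _; rewrite coefD mulrDl.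
Qed.

Lemma lmomZ a c p : lmom a (c *: p) = c * lmom a p.
Proof.
rewrite (@lmomE a _ (size p)) ?size_scale_leq// /lmom mulr_sumr.
by apply: eq_bigr => i _; rewrite coefZ mulrA.
Qed.

Lemma lmomN a p : lmom a (- p) = - lmom a p.
Proof. by rewrite -scaleN1r lmomZ mulN1r. Qed.

Lemma lmomXn a k : lmom a 'X^k = rising (a + 1) k.
Proof.
rewrite (@lmomE a _ k.+1) ?size_polyXn// big_ord_recr/= coefXn eqxx mul1r.
rewrite big1 ?add0r// => i _.
by rewrite coefXn (ltn_eqF (ltn_ord i)) mul0r.
Qed.

Lemma polyXn_ind (P : {poly R} -> Prop) :
  (forall k, P 'X^k) -> (forall c p q, P p -> P q -> P (c *: p + q)) ->
  forall p, P p.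
Proof.
move=> PX PD p; have P0 : P 0.
  by have := PD (-1) _ _ (PX 0) (PX 0); rewrite scaleN1r addNr.
rewrite -[p]coefK poly_def; elim/big_rec: _ => // i q _ Pq.
exact: PD.
Qed.

(** Algebraic form of the vanishing of the integral of (x^(a+1) e^(-x) p)' over the half-line. *)
Lemma lmom_IBP a p : lmom a ((a + 1) *: p + 'X * p^`() - 'X * p) = 0.
Proof.
elim/polyXn_ind: p => [k|c p q Hp Hq].
  case: k => [|k].
    rewrite expr0 derivC !mulr0 addr0 mulr1 lmomD lmomN lmomZ -(expr0 'X).
    by rewrite -['X]expr1 !lmomXn /rising big_ord0 big_ord1 addr0; ring.
  rewrite derivXn mulrnAr -!exprS lmomD lmomN lmomD lmomZ.
  rewrite -scaler_nat lmomZ !lmomXn (risingS _ k.+1).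
  by rewrite -(natr1 k); ring.
have -> : (a + 1) *: (c *: p + q) + 'X * (c *: p + q)^`() - 'X * (c *: p + q) =
  c *: ((a + 1) *: p + 'X * p^`() - 'X * p) +
  ((a + 1) *: q + 'X * q^`() - 'X * q).
  by rewrite derivD derivZ -!mul_polyC; ring.
by rewrite lmomD lmomZ Hp Hq mulr0 addr0.
Qed.

(** The factor a + 1 is the ratio of the total masses Gamma(a+2) and Gamma(a+1), each functional
    being normalised separately. *)
Lemma lmomMX a p : lmom a ('X * p) = (a + 1) * lmom (a + 1) p.
Proof.
elim/polyXn_ind: p => [k|c p q Hp Hq].
  by rewrite -exprS !lmomXn risingSl.
by rewrite mulrDr -scalerAr !lmomD !lmomZ Hp Hq; ring.
Qed.

(** Plays the part of Rodrigues' formula followed by n integrations by parts; orthogonality and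
    norms follow by counting degrees of q. *)
Lemma lmom_lagM n a q : lmom a (lag n a * q) = (-1) ^+ n * lmom a ('X^n * q^`(n)).
Proof.
elim: n a q => [|n IH] a q; first by rewrite /= !expr0 !mul1r.
rewrite /= mulrBl lmomD lmomN -scalerAl lmomZ -mulrA lmomMX !IH.
have /eqP := lmom_IBP a ('X^n * q^`(n)).
have -> : (a + 1) *: ('X^n * q^`(n)) + 'X * ('X^n * q^`(n))^`() -
   'X * ('X^n * q^`(n)) = (n%:R + a + 1) *: ('X^n * q^`(n)) +
   'X^(n.+1) * q^`(n.+1) - 'X * ('X^n * q^`(n)).
  rewrite derivM derivnS; case: n {IH} => [|n].
    by rewrite derivC -!mul_polyC !polyCD exprS; ring.
  rewrite derivXn -scaler_nat -!mul_polyC !polyCD -(natr1 n) !polyCD !exprS /=.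
  ring.
rewrite lmomD lmomN lmomD lmomZ lmomMX subr_eq0 => /eqP h.
have -> : (-1) ^+ n.+1 = - (-1) ^+ n :> R by rewrite exprS mulN1r.
rewrite !(mulrCA _ ((-1) ^+ n)) -mulrBr -h; ring.
Qed.

Lemma lmom_lag_orth n m a : n != m -> lmom a (lag n a * lag m a) = 0.
Proof.
have h i j : (i < j)%N -> lmom a (lag j a * lag i a) = 0.
  move=> ij; rewrite lmom_lagM derivn_lag// mulr0.
  by rewrite /lmom size_poly0 big_ord0 mulr0.
by rewrite neq_ltn => /orP[/h|/h//]; rewrite mulrC.
Qed.

Lemma lmom_lag_diag n a : lmom a (lag n a * lag n a) = n`!%:R * rising (a + 1) n.
Proof.
rewrite lmom_lagM derivn_lag_diag ['X^n * _]mulrC mul_polyC lmomZ lmomXn.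
by rewrite !mulrA -expr2 sqrr_sign mul1r.
Qed.

Definition lagc2 (l n : nat) : R :=
  Num.sqrt pi / (2 ^+ l.+1 * n`!%:R * Gamma (n%:R + l%:R + 3 / 2)).

(** The polynomial with which [Lbar l n] agrees for x > 0, as [LbarE] shows; [lagc2] is the square
    of its normalising constant. *)
Definition Lag (l n : nat) : {poly R} :=
  Num.sqrt (lagc2 l n) *: lag n (l%:R + 1 / 2).

Lemma Gamma_nat_gt0 n l : 0 < Gamma (n%:R + l%:R + 3 / 2 : R).
Proof. by rewrite -natrD Gamma_gt0. Qed.

Lemma lagc2_gt0 l n : 0 < lagc2 l n.
Proof.
rewrite /lagc2 divr_gt0 ?sqrtr_gt0 ?pi_gt0//.
by rewrite !mulr_gt0 ?exprn_gt0// ?ltr0n ?fact_gt0// Gamma_nat_gt0.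
Qed.

(** The Gamma recurrence here, and the factorial in [lagc2_n], turn a change of l or n into the
    numbers under the square roots of the recurrences for psi. *)
Lemma lagc2_l l n : lagc2 l n = (2 * n + (2 * l + 3))%:R * lagc2 l.+1 n.
Proof.
rewrite /lagc2.
have -> : n%:R + l.+1%:R + 3 / 2 = (n + l)%:R + 5 / 2 :> R.
  by rewrite -(natr1 l) natrD; field.
have -> : n%:R + l%:R + 3 / 2 = (n + l)%:R + 3 / 2 :> R by rewrite natrD.
rewrite GammaS !exprS (natrD _ (2 * n)) (natrD _ (2 * l)) !natrM natrD.
have g0 := Gamma_gt0 R (n + l); rewrite natrD in g0 *.
have : (n`!%:R : R) != 0 by rewrite pnatr_eq0 -lt0n fact_gt0.
have : (2 : R) ^+ l != 0 by rewrite expf_neq0// pnatr_eq0.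
have : n%:R + l%:R + 3 / 2 != 0 :> R.
  by rewrite gt_eqF//; have := ler0n R n; have := ler0n R l; lra.
move: (2 ^+ l) (n`!%:R) (Gamma _) g0 => x y z z0 h1 h2 h3.
have h4 : (n%:R + l%:R) * 2 + 3 != 0 :> R.
  by rewrite gt_eqF//; have := ler0n R n; have := ler0n R l; lra.
field.
by rewrite h4 h3 h2 gt_eqF.
Qed.

Lemma lagc2_n l n : n.+1%:R ^+ 2 * lagc2 l n.+1 = (2 * n.+1)%:R * lagc2 l.+1 n.
Proof.
rewrite /lagc2.
have -> : n%:R + l.+1%:R + 3 / 2 = n.+1%:R + l%:R + 3 / 2 :> R.
  by rewrite -(natr1 l) -(natr1 n); field.
rewrite factS !natrM exprS [in RHS]exprS.
have g0 := Gamma_nat_gt0 n.+1 l.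
have : (n`!%:R : R) != 0 by rewrite pnatr_eq0 -lt0n fact_gt0.
have : (2 : R) ^+ l.+1 != 0 by rewrite expf_neq0// pnatr_eq0.
rewrite exprS.
move: (2 ^+ l) (n`!%:R) (Gamma _) g0 => x y z z0 h1 h2.
have h3 : x != 0 by apply: contra_neq h1 => ->; rewrite mulr0.
field.
by rewrite h2 h3 gt_eqF//= addrC natr1 pnatr_eq0.
Qed.

Lemma sqrt_lagc2_l l n : Num.sqrt (lagc2 l n) =
  sqrtn R (2 * n + (2 * l + 3)) * Num.sqrt (lagc2 l.+1 n).
Proof. by rewrite lagc2_l (sqrtrM (lagc2 l.+1 n)) ?ler0n. Qed.

Lemma sqrt_lagc2_n l n : n.+1%:R * Num.sqrt (lagc2 l n.+1) =
  sqrtn R (2 * n.+1) * Num.sqrt (lagc2 l.+1 n).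
Proof.
rewrite -(sqrtrM (lagc2 l.+1 n)) ?ler0n// -lagc2_n.
by rewrite (sqrtrM (lagc2 l n.+1)) ?sqr_ge0// sqrtr_sqr ger0_norm.
Qed.

(** [lag_shift] with the normalising constants inserted: a radial factor of rank l in terms of those
    of rank l + 1. At n = 0 the index [n.-1] is a default value, multiplied by [sqrtn R 0]. *)
Lemma Lag_l l n : Lag l n =
  sqrtn R (2 * n + (2 * l + 3)) *: Lag l.+1 n - sqrtn R (2 * n) *: Lag l.+1 n.-1.
Proof.
have aux (c c1 c2 s1 s2 k : R) (P Q : {poly R}) : c = s1 * c1 ->
    c * k = s2 * c2 -> c *: (P - k *: Q) = s1 *: (c1 *: P) - s2 *: (c2 *: Q).
  by move=> e1 e2; rewrite scalerBr !scalerA -e1 -e2.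
rewrite {1}/Lag lag_shift.
have -> : l%:R + 1 / 2 + 1 = l.+1%:R + 1 / 2 :> R by rewrite -(natr1 l); ring.
apply: aux; first exact: sqrt_lagc2_l.
case: n => [|n]; first by rewrite mulr0 muln0 /sqrtn sqrtr0 mul0r.
by rewrite mulrC sqrt_lagc2_n.
Qed.

Lemma Lag_X l n : 'X * Lag l.+1 n =
  2^-1 *: (sqrtn R (2 * n + (2 * l + 3)) *: Lag l n
           - sqrtn R (2 * (n + 1)) *: Lag l n.+1).
Proof.
have aux (c c1 c2 s1 s2 k : R) (P Q : {poly R}) : c * k = 2^-1 * (s1 * c1) ->
    c = 2^-1 * (s2 * c2) ->
    c *: (k *: P - Q) = 2^-1 *: (s1 *: (c1 *: P) - s2 *: (c2 *: Q)).
  by move=> e1 e2; rewrite !scalerBr !scalerA e1 {1}e2 !mulrA.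
have aux2 (k s x y : R) : k != 0 -> s ^+ 2 = 2 * k -> k * y = s * x ->
    x = 2^-1 * (s * y).
  move=> k0 s2 h; have -> : y = s * x / k by rewrite -h mulrC mulKf.
  by rewrite [s * _]mulrA [s * (s * x)]mulrA -expr2 s2; field.
have sq k : sqrtn R k ^+ 2 = k%:R by rewrite sqr_sqrtr ?ler0n.
rewrite {1}/Lag -scalerAr.
have -> : 'X * lag n (l.+1%:R + 1 / 2) =
   (n%:R + (l%:R + 1 / 2) + 1) *: lag n (l%:R + 1 / 2) - lag n.+1 (l%:R + 1 / 2).
  have -> : l.+1%:R + 1 / 2 = l%:R + 1 / 2 + 1 :> R by rewrite -(natr1 l); ring.
  by rewrite lagS subKr.
apply: aux.
  have aux3 (s x : R) : 2^-1 * (s * (s * x)) = x * (2^-1 * s ^+ 2) by ring.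
  rewrite (sqrt_lagc2_l l n) aux3 sq; congr (_ * _).
  by rewrite (natrD _ (2 * n)) (natrD _ (2 * l)) !natrM; field.
rewrite addn1; apply: (aux2 n.+1%:R); first by rewrite pnatr_eq0.
  by rewrite sq natrM.
exact: sqrt_lagc2_n.
Qed.

Lemma Gamma_rising l n : Gamma (n%:R + l%:R + 3 / 2 : R) =
  rising (l%:R + 1 / 2 + 1) n * Gamma (l%:R + 3 / 2).
Proof.
elim: n => [|n IH]; first by rewrite /rising big_ord0 mul1r add0r.
have -> : n.+1%:R + l%:R + 3 / 2 = (n + l)%:R + 5 / 2 :> R.
  by rewrite -(natr1 n) natrD; field.
by rewrite GammaS natrD IH risingS; field.
Qed.

(** Common squared norm of all [Lag l n] for fixed l; the normalisation of [Lbar] makes it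
    independent of n, so its value at n = 0 serves. *)
Definition lagK (l : nat) : R := lagc2 l 0.

Lemma lmom_Lag l n m : lmom (l%:R + 1 / 2) (Lag l n * Lag l m) =
  (n == m)%:R * lagK l.
Proof.
rewrite /Lag -scalerAl -scalerAr !lmomZ.
have [->|nm] := eqVneq n m; last by rewrite lmom_lag_orth// !mulr0 mul0r.
rewrite -[RHS]/(1 * _) [RHS]mul1r lmom_lag_diag mulrA -expr2 sqr_sqrtr ?ltW ?lagc2_gt0//.
rewrite /lagK /lagc2 Gamma_rising add0r fact0 mulr1.
have : (m`!%:R : R) != 0 by rewrite pnatr_eq0 -lt0n fact_gt0.
have : (2 : R) ^+ l.+1 != 0 by rewrite expf_neq0// pnatr_eq0.
have : Gamma (l%:R + 3 / 2 : R) != 0 by rewrite gt_eqF// Gamma_gt0.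
have : rising (l%:R + 1 / 2 + 1) m != 0.
  by apply/prodf_neq0 => i _; rewrite gt_eqF//; have := ler0n R l; have := ler0n R i; lra.
move: (2 ^+ l.+1) (m`!%:R) (Gamma _) (rising _ _) => x y z t h1 h2 h3 h4.
by field; rewrite h1 h2 h3 h4.
Qed.

Lemma lagK_gt0 l : 0 < lagK l. Proof. exact: lagc2_gt0. Qed.

End Laguerre.

(** * Symmetric trace-free tensors and harmonic polynomials *)

Section Tensors.
Variable R : realType.
Notation XX i := (@mpolyX 3 R (mnm1 i)).

Definition consf l (i : 'I_3) (J : idx l) : idx l.+1 :=
  [ffun k => if unlift ord0 k is Some k' then J k' else i].

Definition tailf l (J : idx l.+1) : idx l := [ffun k => J (lift ord0 k)].

Lemma consf0 l i (J : idx l) : consf i J ord0 = i.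
Proof. by rewrite ffunE unlift_none. Qed.

Lemma consfS l i (J : idx l) k : consf i J (lift ord0 k) = J k.
Proof. by rewrite ffunE liftK. Qed.

Lemma tailf_consf l i (J : idx l) : tailf (consf i J) = J.
Proof. by apply/ffunP => k; rewrite ffunE consfS. Qed.

Lemma consf_tailf l (J : idx l.+1) : consf (J ord0) (tailf J) = J.
Proof.
by apply/ffunP => k; rewrite ffunE; case: unliftP => [k' ->|->]; rewrite ?ffunE.
Qed.

Lemma sum_consf (U : nmodType) l (F : idx l.+1 -> U) :
  \sum_J F J = \sum_i \sum_J F (consf i J).
Proof.
rewrite pair_big/= (reindex (fun p : 'I_3 * idx l => consf p.1 p.2)) //.
exists (fun J : idx l.+1 => (J ord0, tailf J)) => [[i J] _|J _] /=.
  by rewrite consf0 tailf_consf.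
by rewrite consf_tailf.
Qed.

Definition Xmon l (J : idx l) : mpoly 3 R := \prod_(k < l) XX (J k).

Lemma Xmon_consf l i (J : idx l) : Xmon (consf i J) = XX i * Xmon J.
Proof.
rewrite /Xmon big_ord_recl consf0; congr (_ * _).
by apply: eq_bigr => k _; rewrite consfS.
Qed.

(** On symmetric tensors this map is injective, a partial derivative amounts to fixing an index and
    the Laplacian to taking a trace. Symmetric trace-free tensors thus correspond to homogeneous
    harmonic polynomials. *)
Definition tpoly l (C : tensor R l) : mpoly 3 R := \sum_J C J *: Xmon J.

Definition tcons l (C : tensor R l.+1) (i : 'I_3) : tensor R l :=
  fun J => C (consf i J).

Lemma tpolyS l (C : tensor R l.+1) :
  tpoly C = \sum_i XX i * tpoly (tcons C i).
Proof.
rewrite /tpoly sum_consf; apply: eq_bigr => i _.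
by rewrite mulr_sumr; apply: eq_bigr => J _; rewrite Xmon_consf scalerAr.
Qed.

Lemma ffunI0_unique (J K : idx 0) : J = K.
Proof. by apply/ffunP => -[]. Qed.

Lemma tpoly0 (C : tensor R 0) (J : idx 0) : tpoly C = C J *: 1.
Proof.
rewrite /tpoly (bigD1 J)//= big1 => [|K /eqP[]]; last exact: ffunI0_unique.
by rewrite addr0 /Xmon big_ord0.
Qed.

Lemma tpolyD l (C C' : tensor R l) :
  tpoly (fun J => C J + C' J) = tpoly C + tpoly C'.
Proof. by rewrite /tpoly -big_split; apply: eq_bigr => J _; rewrite scalerDl. Qed.

Lemma tpolyZ l c (C : tensor R l) : tpoly (fun J => c * C J) = c *: tpoly C.
Proof. by rewrite /tpoly scaler_sumr; apply: eq_bigr => J _; rewrite scalerA. Qed.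

Lemma tpoly_sum l I (r : seq I) (C : I -> tensor R l) :
  tpoly (fun J => \sum_(i <- r) C i J) = \sum_(i <- r) tpoly (C i).
Proof.
rewrite /tpoly exchange_big/=; apply: eq_bigr => J _; exact: scaler_suml.
Qed.

Lemma eq_tpoly l (C C' : tensor R l) : C =1 C' -> tpoly C = tpoly C'.
Proof. by move=> e; apply: eq_bigr => J _; rewrite e. Qed.

Lemma sym_tcons l (C : tensor R l.+1) i : sym_tensor C -> sym_tensor (tcons C i).
Proof.
move=> sC s J; rewrite /tcons -[RHS](sC (lift_perm ord0 ord0 s)); congr C.
apply/ffunP => k; rewrite [RHS]ffunE; case: (unliftP ord0 k) => [k' ->|->].
  by rewrite lift_perm_lift !consfS ffunE.
by rewrite lift_perm_id !consf0.
Qed.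

Lemma tconsC l (C : tensor R l.+2) i j : sym_tensor C ->
  tcons (tcons C i) j =1 tcons (tcons C j) i.
Proof.
move=> sC J; rewrite /tcons -[RHS](sC (tperm ord0 (lift ord0 ord0))); congr C.
apply/ffunP => k; rewrite [RHS]ffunE; case: (unliftP ord0 k) => [k' ->|->].
  case: (unliftP ord0 k') => [k'' ->|->].
    by rewrite tpermD ?consfS// -?val_eqE//= /bump.
  by rewrite tpermR consf0 consfS consf0.
by rewrite tpermL consf0 consfS consf0.
Qed.

Lemma mderivXU i j : mderiv i (XX j) = (i == j)%:R :> mpoly 3 R.
Proof.
rewrite mderivX mnm1E eq_sym; case: eqVneq => [->|_]; last by rewrite scale0r.
by rewrite scale1r -mpolyX0; congr mpolyX; apply/mnmP => k; rewrite mnmBE mnm0E subnn.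
Qed.

Lemma mderiv_sum i I (r : seq I) (P : pred I) (F : I -> mpoly 3 R) :
  mderiv i (\sum_(k <- r | P k) F k) = \sum_(k <- r | P k) mderiv i (F k).
Proof.
elim: r => [|k r IH]; first by rewrite !big_nil mderiv0.
by rewrite !big_cons; case: ifP => // _; rewrite mderivD IH.
Qed.

Lemma mderiv_tpoly0 i (C : tensor R 0) : mderiv i (tpoly C) = 0.
Proof. by rewrite (tpoly0 _ [ffun=> ord0]) mderivZ -mpolyC1 mderivC scaler0. Qed.

Lemma sum_XX_delta i (F : 'I_3 -> mpoly 3 R) :
  \sum_j (i == j)%:R * F j = F i.
Proof.
rewrite (bigD1 i)//= eqxx mul1r big1 ?addr0// => j ji.
by rewrite eq_sym (negbTE ji) mul0r.
Qed.

Lemma mderiv_tpoly l i (C : tensor R l.+1) : sym_tensor C ->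
  mderiv i (tpoly C) = l.+1%:R *: tpoly (tcons C i).
Proof.
elim: l C => [|l IH] C sC.
  rewrite tpolyS mderiv_sum scale1r -[RHS](sum_XX_delta i (fun j => tpoly (tcons C j))).
  apply: eq_bigr => j _; rewrite mderivM mderivXU.
  by rewrite mderiv_tpoly0 mulr0 addr0.
rewrite tpolyS mderiv_sum.
transitivity (\sum_j ((i == j)%:R * tpoly (tcons C j) +
   l.+1%:R *: (XX j * tpoly (tcons (tcons C i) j)))).
  apply: eq_bigr => j _; rewrite mderivM mderivXU IH; last exact: sym_tcons.
  by rewrite -scalerAr (eq_tpoly (tconsC j i sC)).
rewrite big_split/= sum_XX_delta -scaler_sumr -tpolyS.
by rewrite -[X in X + _]scale1r -scalerDl nat1r.
Qed.

(** Homogeneity of degree d, encoded by Euler's identity because this is the form that integration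
    by parts meets. *)
Definition euler d (p : mpoly 3 R) : Prop := \sum_i XX i * mderiv i p = d%:R *: p.

Definition lap (p : mpoly 3 R) : mpoly 3 R := \sum_i mderiv i (mderiv i p).

Lemma eulerM d d' p p' : euler d p -> euler d' p' -> euler (d + d') (p * p').
Proof.
rewrite /euler => e e'.
transitivity (\sum_i ((XX i * mderiv i p) * p' + p * (XX i * mderiv i p'))).
  by apply: eq_bigr => i _; rewrite mderivM; ring.
rewrite big_split/= -mulr_suml -mulr_sumr e e'.
by rewrite -scalerAl -scalerAr -scalerDl natrD.
Qed.

Lemma euler1 : euler 0 1.
Proof.
rewrite /euler scale0r big1// => i _.
by rewrite -mpolyC1 mderivC mulr0.
Qed.

Lemma eulerXX i : euler 1 (XX i).
Proof.
rewrite /euler scale1r -[RHS](sum_XX_delta i (fun j => XX j)).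
by apply: eq_bigr => j _; rewrite mderivXU eq_sym mulrC.
Qed.

Lemma euler_sum d I (r : seq I) (P : pred I) (F : I -> mpoly 3 R) :
  (forall k, P k -> euler d (F k)) -> euler d (\sum_(k <- r | P k) F k).
Proof.
move=> e; rewrite /euler scaler_sumr.
under eq_bigr do rewrite mderiv_sum mulr_sumr.
rewrite exchange_big/=; apply: eq_bigr => k Pk; exact: e.
Qed.

Lemma eulerZ d c p : euler d p -> euler d (c *: p).
Proof.
rewrite /euler => e.
under eq_bigr do rewrite mderivZ -scalerAr.
by rewrite -scaler_sumr e !scalerA mulrC.
Qed.

Lemma euler_tpoly l (C : tensor R l) : euler l (tpoly C).
Proof.
elim: l C => [|l IH] C.
  by rewrite (tpoly0 _ [ffun=> ord0]); apply: eulerZ; exact: euler1.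
rewrite tpolyS; apply: euler_sum => i _; rewrite -add1n.
by apply: eulerM; [exact: eulerXX|exact: IH].
Qed.

Lemma lapD p q : lap (p + q) = lap p + lap q.
Proof. by rewrite /lap -big_split; apply: eq_bigr => i _; rewrite !mderivD. Qed.

Lemma lapZ c p : lap (c *: p) = c *: lap p.
Proof. by rewrite /lap scaler_sumr; apply: eq_bigr => i _; rewrite !mderivZ. Qed.

Lemma lap_tpolyS l (C : tensor R l.+2) : sym_tensor C ->
  lap (tpoly C) = (l.+2%:R * l.+1%:R) *:
    tpoly (fun J => \sum_i tcons (tcons C i) i J).
Proof.
move=> sC; rewrite tpoly_sum scaler_sumr; apply: eq_bigr => i _.
rewrite mderiv_tpoly// mderivZ mderiv_tpoly ?scalerA//; exact: sym_tcons.
Qed.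

Lemma consf_trace l m j j' (J : idx l) :
  [ffun r => if (r == ord0) || (r == lift ord0 ord0) then m
             else consf j (consf j' J) r] = consf m (consf m J).
Proof.
apply/ffunP => k; rewrite ffunE; case: (unliftP ord0 k) => [k' ->|->].
  rewrite !consfS; case: (unliftP ord0 k') => [k'' ->|->].
    by rewrite !consfS -!val_eqE.
  by rewrite !consf0 eqxx orbT.
by rewrite !consf0 eqxx.
Qed.

Lemma lap_stf l (C : tensor R l) : is_stf C -> lap (tpoly C) = 0.
Proof.
case: l C => [|[|l]] C [sC tC].
- by rewrite /lap big1// => i _; rewrite mderiv_tpoly0 mderiv0.
- by rewrite /lap big1// => i _; rewrite mderiv_tpoly// mderivZ mderiv_tpoly0 scaler0.
rewrite lap_tpolyS// (@eq_tpoly _ _ (fun J => 0 * 0)) ?tpolyZ ?scale0r ?scaler0// => J.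
rewrite mul0r -[RHS](tC ord0 (lift ord0 ord0) isT (consf ord0 (consf ord0 J))).
by apply: eq_bigr => m _; rewrite consf_trace.
Qed.

(** Each partial derivative recovers, up to the factor l + 1, the tensor with one index fixed, which
    allows induction on the rank. *)
Lemma tpoly_eq0 l (S : tensor R l) : sym_tensor S -> tpoly S = 0 ->
  forall J, S J = 0.
Proof.
elim: l S => [|l IH] S sS S0 J.
  move: S0; rewrite (tpoly0 _ J) => /(congr1 (mcoeff mnm0)).
  by rewrite mcoeffZ mcoeff1 eqxx mulr1 mcoeff0.
rewrite -(consf_tailf J) -/(tcons S (J ord0) (tailf J)).
apply: IH; first exact: sym_tcons.
have := mderiv_tpoly (J ord0) sS; rewrite S0 mderiv0 => /esym/eqP.
by rewrite scaler_eq0 pnatr_eq0 => /eqP.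
Qed.

Lemma perm_two l (p q : 'I_l.+2) : p != q ->
  exists s : 'S_(l.+2), s ord0 = p /\ s (lift ord0 ord0) = q.
Proof.
move=> pq; pose s1 := tperm ord0 p.
exists (tperm (lift ord0 ord0) (s1 q) * s1)%g.
rewrite !permM tpermL /s1 tpermK; split=> //.
have h : s1 q != ord0.
  by apply: contraNneq pq => h; rewrite -(tpermK ord0 p q) -/s1 h tpermL.
have h2 : lift ord0 ord0 != ord0 :> 'I_l.+2 by [].
by rewrite (@tpermD _ (lift ord0 ord0) (tperm ord0 p q) ord0)// tpermL.
Qed.

(** The Laplacian shows the trace over the first two slots, which vanishes because [tpoly] is
    injective on symmetric tensors; a permutation then carries these slots to any p and q. *)
Lemma harmonic_tracefree l (T : tensor R l) : sym_tensor T ->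
  lap (tpoly T) = 0 -> tracefree_tensor T.
Proof.
case: l T => [|[|l]] T sT lT.
- by move=> [].
- by move=> p q; rewrite !ord1 eqxx.
move: lT; rewrite lap_tpolyS// => /eqP; rewrite scaler_eq0 mulf_eq0 !pnatr_eq0/=.
move=> /eqP tr0.
have tr J : \sum_i tcons (tcons T i) i J = 0.
  apply: (tpoly_eq0 _ tr0) => s K.
  by apply: eq_bigr => i _; do 2 apply: sym_tcons.
move=> p q pq I; have [s [s0 s1]] := perm_two pq.
rewrite -[RHS](tr (tailf (tailf [ffun k => I (s k)]))).
apply: eq_bigr => m _; rewrite -[LHS](sT s); congr T.
rewrite -(@consf_trace _ _ ([ffun k => I (s k)] ord0) (tailf [ffun k => I (s k)] ord0)).
rewrite !consf_tailf.
by apply/ffunP => k; rewrite !ffunE -s0 -s1 !(inj_eq (@perm_inj _ s)).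
Qed.

Lemma symmetrize l (T : tensor R l) : exists2 S : tensor R l,
  sym_tensor S & tpoly S = tpoly T.
Proof.
exists (fun J => (l`!%:R)^-1 * \sum_(s : 'S_l) T [ffun k => J (s k)]).
  move=> t J; congr (_ * _).
  rewrite [RHS](reindex_inj (mulIg t)); apply: eq_bigr => s _; congr T.
  by apply/ffunP => k; rewrite !ffunE permM.
rewrite tpolyZ tpoly_sum.
rewrite (eq_bigr (fun=> tpoly T)); last first.
  move=> s _; rewrite /tpoly.
  rewrite [RHS](reindex (fun J : idx l => [ffun k => J (s k)])).
    apply: eq_bigr => J _; congr (_ *: _); rewrite /Xmon.
    by rewrite (reindex_inj (@perm_inj _ s)); apply: eq_bigr => k _; rewrite ffunE.
  exists (fun J : idx l => [ffun k => J (s^-1%g k)]) => J _;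
    by apply/ffunP => k; rewrite !ffunE ?permK ?permKV.
rewrite sumr_const card_Sn -(scaler_nat (l`!) (tpoly T)) scalerA mulVf ?scale1r//.
Qed.

Definition tX l (i : 'I_3) (C : tensor R l) : tensor R l.+1 :=
  fun J => (i == J ord0)%:R * C (tailf J).

Lemma tpoly_tX l i (C : tensor R l) : tpoly (tX i C) = XX i * tpoly C.
Proof.
rewrite tpolyS -[RHS](sum_XX_delta i (fun j => XX j * tpoly C)).
apply: eq_bigr => j _; rewrite mulrCA; congr (_ * _).
rewrite (@eq_tpoly _ _ (fun J => (i == j)%:R * C J)).
  by rewrite tpolyZ -mul_mpolyC mpolyC_nat.
by move=> J; rewrite /tcons /tX consf0 tailf_consf.
Qed.

Definition sqnorm : mpoly 3 R := \sum_i XX i * XX i.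

Lemma mderiv_sqnorm i : mderiv i sqnorm = 2 *: XX i.
Proof.
rewrite /sqnorm mderiv_sum.
rewrite -(sum_XX_delta i (fun j => 2 *: XX j)); apply: eq_bigr => j _.
by rewrite mderivM mderivXU scaler_nat; ring.
Qed.

Lemma lapM_XX i p : lap (XX i * p) = 2 *: mderiv i p + XX i * lap p.
Proof.
rewrite /lap mulr_sumr -[X in _ = 2 *: X + _](sum_XX_delta i (fun j => mderiv j p)).
rewrite scaler_sumr -big_split; apply: eq_bigr => j _ /=.
rewrite !(mderivM, mderivD) mderivXU eq_sym; case: (i == j).
  rewrite -mpolyC1 mderivC; rewrite scaler_nat; ring.
by rewrite mderiv0 scaler_nat; ring.
Qed.

Lemma lapM_sqnorm p d : euler d p ->
  lap (sqnorm * p) = (4 * d + 6)%:R *: p + sqnorm * lap p.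
Proof.
move=> e; rewrite /lap mulr_sumr.
transitivity (\sum_i (2 *: p + (4 *: (XX i * mderiv i p) +
    sqnorm * mderiv i (mderiv i p)))).
  apply: eq_bigr => i _.
  rewrite mderivM mderivD !mderivM !mderiv_sqnorm mderivZ mderivXU eqxx.
  by rewrite -[true%:R]/(1 : mpoly 3 R) !scaler_nat; ring.
rewrite !big_split/= -[X in _ + (X + _)]scaler_sumr e sumr_const card_ord addrA; congr (_ + _).
rewrite scalerMnl scalerA -scalerDl; congr (_ *: _).
by rewrite natrD natrM -mulr_natr; ring.
Qed.

(** Splits xi_i H, for H harmonic of degree l, into a harmonic polynomial and |xi|^2 times a
    harmonic one. The constant is forced: the Laplacian of xi_i H is 2 d_i H, and that of |xi|^2 d_i
    H is (4 l + 2) d_i H. *)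
Lemma mulXX_stf l (C : tensor R l) i : is_stf C ->
  exists2 C' : tensor R l.+1, is_stf C' &
    XX i * tpoly C = tpoly C' +
      (2 * l + 1)%:R^-1 *: (sqnorm * mderiv i (tpoly C)).
Proof.
move=> stfC; set H := XX i * tpoly C - (2 * l + 1)%:R^-1 *: (sqnorm * mderiv i (tpoly C)).
(* A tensor representing H need not be symmetric; symmetrising keeps the polynomial, and harmonicity
   then removes the traces. *)
have [T HT] : exists T : tensor R l.+1, tpoly T = H.
  rewrite /H; case: l C stfC {H} => [|l] C [sC _].
    by exists (tX i C); rewrite mderiv_tpoly0 mulr0 scaler0 subr0 tpoly_tX.
  exists (fun J => tX i C J + - (2 * l.+1 + 1)%:R^-1 * l.+1%:R *
      \sum_(j < 3) tX j (tX j (tcons C i)) J).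
  rewrite tpolyD tpolyZ tpoly_tX mderiv_tpoly//; congr (_ + _).
  rewrite -scalerAr scalerA -scaleNr mulNr; congr (_ *: _).
  rewrite tpoly_sum /sqnorm mulr_suml; apply: eq_bigr => j _.
  by rewrite !tpoly_tX mulrA.
have [S sS ST] := symmetrize T.
exists S; last by rewrite ST HT subrK.
split=> //; apply: harmonic_tracefree => //; rewrite ST HT.
have lC := lap_stf stfC.
rewrite /H lapD -scaleN1r !lapZ lapM_XX lC mulr0 addr0.
case: l C stfC {H T HT S sS ST} lC => [|l] C [sC tC] lC.
  by rewrite mderiv_tpoly0 mulr0 scaler0 /lap (eq_bigr (fun=> 0)) ?big1 ?scaler0 ?addr0// => j _; rewrite !mderiv0.
have eD : euler l (mderiv i (tpoly C)).
  by rewrite mderiv_tpoly//; apply: eulerZ; exact: euler_tpoly.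
have lD : lap (mderiv i (tpoly C)) = 0.
  have h : mderiv i (lap (tpoly C)) = 0 by rewrite lC mderiv0.
  rewrite -[RHS]h /lap [in RHS]mderiv_sum; apply: eq_bigr => j _.
  by rewrite (mderiv_comm i j) (mderiv_comm i j).
rewrite (lapM_sqnorm eD) lD mulr0 addr0 !scalerA -scalerDl.
suff -> : 2 + -1 * (2 * l.+1 + 1)%:R^-1 * (4 * l + 6)%:R = 0 :> R by rewrite scale0r.
rewrite !natrD !natrM -(natr1 l); field.
by rewrite gt_eqF//; have := ler0n R l; lra.
Qed.

Lemma mderiv_stf l (C : tensor R l.+1) i : is_stf C -> is_stf (tcons C i).
Proof.
move=> [sC tC]; split; first exact: sym_tcons.
move=> p q pq I.
have := tC (lift ord0 p) (lift ord0 q); rewrite (inj_eq lift_inj) => /(_ pq (consf i I)).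
move=> h; rewrite -[RHS]h; apply: eq_bigr => m _; rewrite /tcons; congr C.
apply/ffunP => k; rewrite [RHS]ffunE; case: (unliftP ord0 k) => [k' ->|->].
  by rewrite !consfS ffunE !(inj_eq lift_inj).
by rewrite !consf0 !(negbTE (neq_lift _ _)).
Qed.

End Tensors.

(** * Orthogonal projection onto symmetric trace-free tensors *)

Section Projection.
Variable R : realType.

Definition tdot (T : finType) (u v : T -> R) : R := \sum_I u I * v I.

Lemma tdotC (T : finType) (u v : T -> R) : tdot u v = tdot v u.
Proof. by apply: eq_bigr => I _; rewrite mulrC. Qed.

Lemma tdotBl (T : finType) (u v w : T -> R) :
  tdot (fun I => u I - v I) w = tdot u w - tdot v w.
Proof. by rewrite /tdot -sumrB; apply: eq_bigr => I _; rewrite mulrBl. Qed.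

Lemma tdotZl (T : finType) c (u w : T -> R) :
  tdot (fun I => c * u I) w = c * tdot u w.
Proof. by rewrite /tdot mulr_sumr; apply: eq_bigr => I _; rewrite mulrA. Qed.

Lemma tdot_suml (T : finType) J (r : seq J) (u : J -> T -> R) w :
  tdot (fun I => \sum_(j <- r) u j I) w = \sum_(j <- r) tdot (u j) w.
Proof.
by rewrite /tdot exchange_big/=; apply: eq_bigr => I _; rewrite mulr_suml.
Qed.

Lemma tdot_eq0 (T : finType) (u : T -> R) : tdot u u = 0 -> forall I, u I = 0.
Proof.
move=> /eqP; rewrite psumr_eq0 => [|I _]; last by rewrite -expr2 sqr_ge0.
by move=> /allP h I; have := h I (mem_index_enum _); rewrite mulf_eq0 orbb => /eqP.
Qed.

Definition tdelta (T : finType) (I : T) : T -> R := fun J => (I == J)%:R.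

Lemma tdot_delta (T : finType) (I : T) u : tdot (tdelta I) u = u I.
Proof.
rewrite /tdot (bigD1 I)//= /tdelta eqxx mul1r big1 ?addr0// => J JI.
by rewrite eq_sym (negbTE JI) mul0r.
Qed.

(* Imposing the orthogonality conditions one at a time *)
Lemma orthogonal_projection (T : finType) (vs : seq {ffun T -> R}) (A : T -> R) :
  exists2 B : T -> R, {in vs, forall v : {ffun T -> R}, tdot v B = 0} &
    forall C : T -> R, {in vs, forall v : {ffun T -> R}, tdot v C = 0} ->
      tdot (fun I => A I - B I) C = 0.
Proof.
elim: vs A => [|v vs IH] A.
  exists A => // C _; rewrite /tdot big1// => I _; by rewrite subrr mul0r.
have [B B1 B2] := IH A; have [w w1 w2] := IH v.
have vw C : {in vs, forall v : {ffun T -> R}, tdot v C = 0} -> tdot v C = tdot w C.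
  by move=> /w2; rewrite tdotBl => /eqP; rewrite subr_eq0 => /eqP.
have [w0|w0] := eqVneq (tdot w w) 0.
  have wz := tdot_eq0 w0.
  have vz C : {in vs, forall v : {ffun T -> R}, tdot v C = 0} -> tdot v C = 0.
    by move=> /vw ->; rewrite /tdot big1// => I _; rewrite wz mul0r.
  exists B.
    by move=> u; rewrite inE => /predU1P[->|]; [exact: vz|exact: B1].
  by move=> C hC; apply: B2 => u uvs; apply: hC; rewrite inE uvs orbT.
exists (fun I => B I - tdot B w / tdot w w * w I).
  have h : {in vs, forall v : {ffun T -> R},
      tdot v (fun I => B I - tdot B w / tdot w w * w I) = 0}.
    move=> u uvs; rewrite tdotC tdotBl tdotZl !(tdotC _ u).
    by rewrite B1// w1// mulr0 subrr.
  move=> u; rewrite inE => /predU1P[->|]; last exact: h.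
  by rewrite vw// tdotC tdotBl tdotZl mulfVK// subrr.
move=> C hC.
have hC' : {in vs, forall v : {ffun T -> R}, tdot v C = 0}.
  by move=> u uvs; apply: hC; rewrite inE uvs orbT.
have wC : tdot w C = 0 by rewrite -vw// hC// inE eqxx.
have -> : (fun I => A I - (B I - tdot B w / tdot w w * w I)) =
    (fun I => (A I - B I) - (- (tdot B w / tdot w w)) * w I).
  by apply/funext => I; ring.
by rewrite tdotBl tdotZl wC mulr0 subr0; exact: B2.
Qed.


Definition ptrace l (p q : 'I_l) (I : idx l) (m : 'I_3) : idx l :=
  [ffun r => if (r == p) || (r == q) then m else I r].

Definition sym_condition l (s : 'S_l) (I : idx l) : {ffun idx l -> R} :=
  [ffun J => tdelta [ffun k => I (s k)] J - tdelta I J].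

Definition trace_condition l (p q : 'I_l) (I : idx l) : {ffun idx l -> R} :=
  [ffun J => \sum_(m < 3) tdelta (ptrace p q I m) J].

(** Being symmetric and trace-free amounts to finitely many linear equations, listed here so that
    [orthogonal_projection] applies. *)
Definition stf_conditions l : seq {ffun idx l -> R} :=
  [seq sym_condition p.1 p.2 | p <- enum {: 'S_l * idx l}] ++
  [seq trace_condition p.1.1 p.1.2 p.2 |
     p <- enum {: 'I_l * 'I_l * idx l} & p.1.1 != p.1.2].

Lemma stf_conditionsP l (A : tensor R l) : is_stf A <->
  {in stf_conditions l, forall v : {ffun _ -> R}, tdot v A = 0}.
Proof.
have e1 (s : 'S_l) I : tdot (sym_condition s I) A = A [ffun k => I (s k)] - A I.
  rewrite -!tdot_delta -tdotBl; apply: eq_bigr => J _; by rewrite ffunE.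
have e2 (p q : 'I_l) I :
    tdot (trace_condition p q I) A = \sum_(m < 3) A (ptrace p q I m).
  transitivity (\sum_(m < 3) tdot (tdelta (ptrace p q I m)) A).
    by rewrite -tdot_suml; apply: eq_bigr => J _; rewrite ffunE.
  by apply: eq_bigr => m _; rewrite tdot_delta.
split=> [[sA tA] v|h].
  rewrite mem_cat => /orP[/mapP[p _ ->]|/mapP[p]].
    by rewrite e1 sA subrr.
  by rewrite mem_filter => /andP[pq _] ->; rewrite e2 tA.
split=> [s I|p q pq I].
  apply/eqP; rewrite -subr_eq0 -e1 h//.
  rewrite mem_cat; apply/orP; left.
  by apply/mapP; exists (s, I) => //; rewrite mem_enum.
rewrite -[LHS]e2 h// mem_cat; apply/orP; right.
by apply/mapP; exists (p, q, I) => //; rewrite mem_filter pq mem_enum.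
Qed.

(** Existence of the projection ensures that [xget] in the definition of [stf] returns it and not
    the default 0. *)
Lemma stfP l (A : tensor R l) : is_stf_part A (stf A).
Proof.
apply: xgetPex; have [B B1 B2] := orthogonal_projection (stf_conditions l) A.
exists B; split; first exact/stf_conditionsP.
by move=> C /stf_conditionsP/B2.
Qed.

Lemma stf_self_adjoint l (A B : tensor R l) : tdot (stf A) B = tdot A (stf B).
Proof.
have [sA hA] := stfP A; have [sB hB] := stfP B.
have := hA _ sB; rewrite -/(tdot _ _) tdotBl => /eqP; rewrite subr_eq0 => /eqP ->.
have := hB _ sA; rewrite -/(tdot _ _) tdotBl => /eqP; rewrite subr_eq0 => /eqP.
by rewrite tdotC => ->; rewrite tdotC.
Qed.

Lemma stf_id l (A : tensor R l) : is_stf A -> forall I, stf A I = A I.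
Proof.
move=> sA I; have [sB h] := stfP A.
have d : is_stf (fun I => A I - stf A I).
  apply/stf_conditionsP => v vs; rewrite tdotC tdotBl !(tdotC _ v).
  by rewrite (stf_conditionsP A).1// (stf_conditionsP (stf A)).1// subrr.
by apply/esym/eqP; rewrite -subr_eq0; apply/eqP; apply: (tdot_eq0 (h _ d) I).
Qed.

(** Row I of the matrix of the projection onto symmetric trace-free tensors. The matrix is symmetric
    and idempotent, which is the content of [stfdeltaC] and [tdot_stfdelta]. *)
Definition stfdelta l (I : idx l) : tensor R l := stf (tdelta I).

Lemma is_stf_stfdelta l (I : idx l) : is_stf (stfdelta I).
Proof. exact: (stfP _).1. Qed.

Lemma stfdeltaC l (I J : idx l) : stfdelta I J = stfdelta J I.
Proof. by rewrite -tdot_delta tdotC stf_self_adjoint tdot_delta. Qed.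

Lemma stfE l (A : tensor R l) I : stf A I = tdot (stfdelta I) A.
Proof. by rewrite stf_self_adjoint tdot_delta. Qed.

Lemma stf_expand l (A : tensor R l) J : is_stf A ->
  A J = \sum_I A I * stfdelta I J.
Proof.
move=> sA; rewrite -(stf_id sA J) stfE tdotC; apply: eq_bigr => I _.
by rewrite stfdeltaC.
Qed.

Lemma tdot_stfdelta l (I J : idx l) :
  tdot (stfdelta I) (stfdelta J) = stfdelta I J.
Proof.
by rewrite -stfE (stf_id (is_stf_stfdelta J)) stfdeltaC.
Qed.

(** If the diagonal vanished, idempotence would make the whole projection zero. The indicator of the
    injective multi-indices with values below l contradicts this: it is symmetric, and trace-free
    because every trace repeats an index. Having three coordinates limits this witness to l <= 3. *)
Lemma stfdelta_neq0 l : (l <= 3)%N ->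
  exists I : idx l, stfdelta I I != 0.
Proof.
move=> l3.
pose C : tensor R l := fun J => (injectiveb J && [forall k, (J k < l)%N])%:R.
have sC : is_stf C.
  split.
    move=> s I; rewrite /C; congr (nat_of_bool _)%:R; congr andb.
      apply/injectiveP/injectiveP => h x y.
        move=> e; have := h (s^-1 x)%g (s^-1 y)%g; rewrite !ffunE !permKV e.
        by move=> /(_ erefl)/perm_inj.
      by rewrite !ffunE => /h/perm_inj.
    apply/forallP/forallP => h k.
      by have := h (s^-1 k)%g; rewrite ffunE permKV.
    by rewrite ffunE.
  move=> p q pq I; rewrite big1// => m _; rewrite /C.
  case: injectiveP => //= h; exfalso; move/negP: pq; apply; apply/eqP/h.
  by rewrite !ffunE !eqxx orbT.
apply: contrapT => /forallNP h.
have z (I J : idx l) : stfdelta I J = 0.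
  have := h I => /negP; rewrite negbK -tdot_stfdelta => /eqP/tdot_eq0; exact.
have := stf_expand [ffun k => widen_ord l3 k] sC.
rewrite big1 => [|I _]; last by rewrite z mulr0.
rewrite /C; case: injectiveP => [_|[]]; last first.
  by move=> x y; rewrite !ffunE => /(congr1 val)/= /val_inj.
case: forallP => [_|[]]; first by move/eqP; rewrite oner_eq0.
by move=> k; rewrite ffunE/=.
Qed.

Lemma stfdelta1 (I J : idx 1) : stfdelta I J = (I == J)%:R.
Proof.
apply: stf_id; split.
  move=> s K; congr (nat_of_bool (_ == _))%:R.
  by apply/ffunP => k; rewrite ffunE !ord1.
by move=> p q; rewrite !ord1 eqxx.
Qed.

End Projection.

(** * Gaussian pairings of radial functions times harmonic polynomials *)

Section Radial.
Variable R : realType.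
Notation XX i := (@mpolyX 3 R (mnm1 i)).

(** Writing the first polynomial as a sum of XX i times polynomials of lower rank and integrating by
    parts leaves two terms. One contains a multiple of the Laplacian of [tpoly C] and vanishes; the
    other is the same pairing one rank lower. *)
Lemma gexp_tpoly l (C C' : tensor R l) : is_stf C -> is_stf C' ->
  gexp (tpoly C * tpoly C') = l`!%:R * tdot C C' * gexp (1 : mpoly 3 R).
Proof.
elim: l C C' => [|l IH] C C' sC sC'.
  pose J : idx 0 := [ffun=> ord0].
  rewrite !(tpoly0 _ J) -scalerAl -scalerAr !gexpZ mulr1 /tdot (bigD1 J)//= big1.
    by rewrite addr0 fact0 mul1r mulrA.
  by move=> K /eqP[]; exact: ffunI0_unique.
rewrite [tpoly C]tpolyS mulr_suml gexp_sum.
transitivity (gexp ((\sum_i mderiv i (tpoly (tcons C i))) * tpoly C') +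
   \sum_i gexp (tpoly (tcons C i) * mderiv i (tpoly C'))).
  rewrite mulr_suml gexp_sum -big_split; apply: eq_bigr => i _.
  by rewrite -mulrA gexp_IBP mderivM gexpD.
have -> : \sum_i mderiv i (tpoly (tcons C i)) = 0.
  case: l C C' sC sC' {IH} => [|l] C C' sC sC'.
    by rewrite big1// => i _; rewrite mderiv_tpoly0.
  have := lap_stf sC; rewrite /lap.
  rewrite (eq_bigr (fun i => l.+2%:R *: mderiv i (tpoly (tcons C i)))); last first.
    by move=> i _; rewrite mderiv_tpoly ?mderivZ//; exact: sC.1.
  by rewrite -scaler_sumr => /eqP; rewrite scaler_eq0 pnatr_eq0 => /eqP.
rewrite mul0r gexp0 add0r.
transitivity (\sum_i l.+1%:R * (l`!%:R * tdot (tcons C i) (tcons C' i) *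
    gexp (1 : mpoly 3 R))).
  apply: eq_bigr => i _; rewrite mderiv_tpoly; last exact: sC'.1.
  by rewrite -scalerAr gexpZ IH//; exact: mderiv_stf.
rewrite -mulr_sumr -mulr_suml -mulr_sumr.
have -> : tdot C C' = \sum_i tdot (tcons C i) (tcons C' i).
  by rewrite /tdot sum_consf.
by rewrite factS natrM; ring.
Qed.

(** Green's identity gives d' gexp (h h') and d gexp (h h') the same symmetric expression, the
    pairing of the gradients. *)
Lemma gexp_harmonic_orth d d' (h h' : mpoly 3 R) : euler d h -> euler d' h' ->
  lap h = 0 -> lap h' = 0 -> d != d' -> gexp (h * h') = 0.
Proof.
move=> e e' L L' dd'.
have green c (p q : mpoly 3 R) : euler c q -> lap q = 0 ->
    c%:R * gexp (p * q) = \sum_i gexp (mderiv i p * mderiv i q).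
  move=> eq Lq; rewrite -gexpZ scalerAr -eq mulr_sumr gexp_sum.
  transitivity (\sum_i gexp (mderiv i p * mderiv i q) + gexp (p * lap q)).
    rewrite /lap mulr_sumr gexp_sum -big_split; apply: eq_bigr => i _.
    by rewrite mulrCA gexp_IBP mderivM gexpD.
  by rewrite Lq mulr0 gexp0 addr0.
have h1 := green _ h _ e' L'.
have h2 := green _ h' _ e L.
have : (d%:R - d'%:R) * gexp (h * h') = 0.
  rewrite mulrBl h1 [h * h']mulrC h2 -sumrB big1// => i _.
  by rewrite [X in _ - gexp X]mulrC subrr.
by move/eqP; rewrite mulf_eq0 subr_eq0 eqr_nat (negbTE dd') => /eqP.
Qed.

Definition halfsq : mpoly 3 R := 2^-1 *: sqnorm R.

Definition radial (q : {poly R}) : mpoly 3 R := horner_alg halfsq q.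

Lemma radialM p q : radial (p * q) = radial p * radial q.
Proof. exact: rmorphM. Qed.

Lemma radialD p q : radial (p + q) = radial p + radial q.
Proof. exact: rmorphD. Qed.

Lemma radialB p q : radial (p - q) = radial p - radial q.
Proof. exact: rmorphB. Qed.

Lemma radialZ c q : radial (c *: q) = c *: radial q.
Proof. by rewrite /radial -mul_polyC rmorphM /= horner_algC mulr_algl. Qed.

Lemma radial0 : radial 0 = 0. Proof. exact: rmorph0. Qed.

Lemma radial1 : radial 1 = 1. Proof. exact: rmorph1. Qed.

Lemma radialX : radial 'X = halfsq. Proof. exact: horner_algX. Qed.

Lemma radialC c : radial c%:P = c *: 1. Proof. exact: horner_algC. Qed.

Lemma mderiv_halfsq i : mderiv i halfsq = XX i.
Proof. by rewrite mderivZ mderiv_sqnorm scalerA mulVf ?scale1r// pnatr_eq0. Qed.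

Lemma mderiv_radial i q : mderiv i (radial q) = XX i * radial q^`().
Proof.
elim/poly_ind: q => [|q c IH].
  by rewrite deriv0 radial0 mulr0 mderiv0.
rewrite derivMXaddC !radialD !radialM radialX radialC.
rewrite mderivD mderivM mderiv_halfsq mderivZ -mpolyC1 mderivC IH scaler0.
ring.
Qed.

(** With x = |xi|^2/2 the radial measure r^(d+2) e^(-r^2/2) dr is a multiple of x^((d+1)/2) e^(-x)
    dx, whence the exponent. In place of polar coordinates, one factor |xi|^2 is removed by
    integration by parts: this yields 3 + 2 k + d from the dimension, the power of |xi|^2 and
    Euler's identity. *)
Lemma gexp_radial d (p : mpoly 3 R) q : euler d p ->
  gexp (radial q * p) = lmom (d%:R / 2 + 1 / 2) q * gexp p.
Proof.
move=> e; elim/polyXn_ind: q => [k|c p1 p2 H1 H2]; last first.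
  by rewrite radialD radialZ mulrDl -scalerAl gexpD gexpZ H1 H2 lmomD lmomZ; ring.
rewrite lmomXn; elim: k => [|k IH].
  by rewrite expr0 radial1 mul1r /rising big_ord0 mul1r.
rewrite exprS radialM radialX /halfsq -!scalerAl gexpZ /sqnorm !mulr_suml gexp_sum.
have -> : \sum_(i < 3) gexp (XX i * XX i * radial 'X^k * p) =
    (3 + 2 * k%:R + d%:R) * gexp (radial 'X^k * p).
  transitivity (gexp (\sum_(i < 3) (radial 'X^k * p +
      (XX i * XX i * radial 'X^k^`()) * p + radial 'X^k * (XX i * mderiv i p)))).
    rewrite gexp_sum; apply: eq_bigr => i _; rewrite -!mulrA gexp_IBP; congr gexp.
    rewrite !mderivM mderivXU eqxx mderiv_radial -[true%:R]/(1 : mpoly 3 R); ring.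
  rewrite !big_split/= -[X in gexp (_ + X)]mulr_sumr e sumr_const card_ord -!mulr_suml.
  have -> : \sum_i XX i * XX i = 2 *: radial 'X.
    by rewrite radialX scalerA divff ?scale1r// pnatr_eq0.
  have -> : 2 *: radial 'X * radial 'X^k^`() = (2 * k%:R) *: radial 'X^k.
    rewrite -scalerAl -radialM derivXn -scalerA; congr (_ *: _).
    case: k {IH} => [|k]; first by rewrite mulr0n mulr0 scale0r radial0.
    by rewrite mulrnAr -exprS -scaler_nat radialZ.
  rewrite -(scaler_nat 3 (radial 'X^k * p)) -scalerAr -scalerAl !gexpD !gexpZ; ring.
by rewrite IH risingS; field.
Qed.

Definition Hpoly l (I : idx l) : mpoly 3 R := tpoly (stfdelta R I).

Definition Psi l n (I : idx l) : mpoly 3 R :=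
  radial (Lag R l n) * Hpoly I.

Lemma tpoly_Hpoly l (C : tensor R l) : is_stf C ->
  tpoly C = \sum_I C I *: Hpoly I.
Proof.
move=> sC; rewrite (@eq_tpoly _ _ _ (fun J => \sum_I C I * stfdelta R I J)).
  by rewrite tpoly_sum; apply: eq_bigr => I _; rewrite tpolyZ.
by move=> J; exact: stf_expand.
Qed.

Lemma gexp_Psi_diag l n n' (I J : idx l) :
  gexp (Psi n I * Psi n' J) =
  (n == n')%:R * (lagK R l * (l`!%:R * stfdelta R I J * gexp (1 : mpoly 3 R))).
Proof.
have -> : Psi n I * Psi n' J = radial (Lag R l n * Lag R l n') * (Hpoly I * Hpoly J).
  by rewrite radialM /Psi; ring.
rewrite (@gexp_radial (l + l)); last by apply: eulerM; exact: euler_tpoly.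
have -> : (l + l)%:R / 2 = l%:R :> R by rewrite natrD; field.
rewrite lmom_Lag gexp_tpoly; try exact: is_stf_stfdelta.
by rewrite tdot_stfdelta; ring.
Qed.

Lemma gexp_Psi_orth l l' n n' (I : idx l) (J : idx l') :
  l != l' -> gexp (Psi n I * Psi n' J) = 0.
Proof.
move=> ll'.
have -> : Psi n I * Psi n' J = radial (Lag R l n * Lag R l' n') * (Hpoly I * Hpoly J).
  by rewrite radialM /Psi; ring.
rewrite (@gexp_radial (l + l')); last by apply: eulerM; exact: euler_tpoly.
rewrite (gexp_harmonic_orth (euler_tpoly _) (euler_tpoly _)) ?mulr0//.
  exact/lap_stf/is_stf_stfdelta.
exact/lap_stf/is_stf_stfdelta.
Qed.

(** Rank l + 1 comes from the harmonic part of xi_i H through [Lag_l], rank l - 1 from |xi|^2 d_i H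
    through [Lag_X]. The tensors are fixed before n, which later allows the dependence of a pairing
    on n to be factored out. For l = 0 the rank [l.-1] is 0 again, hence the clause on C2. *)
Lemma mulXX_Psi l i (I : idx l) :
  exists (C1 : tensor R l.+1) (C2 : tensor R l.-1),
  (l = 0%N -> forall J, C2 J = 0) /\ forall n,
  XX i * Psi n I =
    \sum_J C1 J *: (sqrtn R (2 * n + (2 * l + 3)) *: Psi n J -
                    sqrtn R (2 * n) *: Psi n.-1 J) +
    \sum_J C2 J *: (sqrtn R (2 * n + (2 * l + 1)) *: Psi n J -
                    sqrtn R (2 * (n + 1)) *: Psi n.+1 J).
Proof.
have [C1 sC1 e1] := mulXX_stf i (is_stf_stfdelta R I).
have first n : radial (Lag R l n) * tpoly C1 =
    \sum_J C1 J *: (sqrtn R (2 * n + (2 * l + 3)) *: Psi n J -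
                    sqrtn R (2 * n) *: Psi n.-1 J).
  rewrite tpoly_Hpoly// mulr_sumr; apply: eq_bigr => J _.
  rewrite -scalerAr {1}Lag_l radialB (radialZ (sqrtn R (2 * n + (2 * l + 3)))).
  by rewrite (radialZ (sqrtn R (2 * n))) mulrBl -!scalerAl.
have step n : XX i * Psi n I = radial (Lag R l n) * tpoly C1 +
    (2 * l + 1)%:R^-1 *: (radial (Lag R l n) * sqnorm R * mderiv i (Hpoly I)).
  by rewrite /Psi mulrCA [XX i * _]e1 mulrDr -scalerAr mulrA.
have sqn : sqnorm R = 2 *: radial 'X.
  by rewrite radialX scalerA divff ?scale1r// pnatr_eq0.
case: l I C1 sC1 e1 first step => [|l] I C1 sC1 e1 first step.
  exists C1, (fun=> 0); split=> // n; rewrite step first /Hpoly mderiv_tpoly0.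
  by rewrite mulr0 scaler0; congr (_ + _); rewrite big1// => J _; rewrite scale0r.
have sI := is_stf_stfdelta R I.
exists C1, (fun J => (2 * l.+1 + 1)%:R^-1 * l.+1%:R * tcons (stfdelta R I) i J); split=> // n.
rewrite step first; congr (_ + _).
rewrite /Hpoly mderiv_tpoly; last exact: sI.1.
rewrite (tpoly_Hpoly (mderiv_stf i sI)) -!scalerAr scalerA mulr_sumr scaler_sumr.
apply: eq_bigr => J _.
rewrite -scalerAr scalerA; congr (_ *: _).
rewrite sqn -scalerAr [radial _ * _]mulrC -radialM Lag_X radialZ scalerA.
rewrite divff ?scale1r ?pnatr_eq0// radialB.
rewrite (radialZ (sqrtn R (2 * n + (2 * l + 3)))) (radialZ (sqrtn R (2 * (n + 1)))).
rewrite mulrBl -!scalerAl.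
by have -> : (2 * l + 3 = 2 * l.+1 + 1)%N by lia.
Qed.

End Radial.

(** * The basis functions psi *)

Section Rodrigues.
Variable R : realType.
Implicit Types (q : {poly R}) (b a : R).

Definition rodr (g : R -> R) : R -> R := fun y => derive1 g y - g y.

(** Derivatives are local and the half-line is open, so agreement on x > 0 survives the
    iteration. *)
Lemma iter_rodr_eq n (f g : R -> R) : (forall x, 0 < x -> f x = g x) ->
  forall x, 0 < x -> iter n rodr f x = iter n rodr g x.
Proof.
elim: n f g => [|n IH] f g fg; first exact: fg.
move=> x x0; rewrite !iterSr; apply: IH x0 => {}x x0; rewrite /rodr fg//.
congr (_ - _); rewrite !derive1E; apply: near_eq_derive.
near=> y; apply: fg; near: y; exact: lt_nbhsr.
Unshelve. all: by end_near. Qed.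

(** Polynomial factor left when d/dy - 1 acts on y^b q(y), the power dropping to b - 1. *)
Definition rodrp b q : {poly R} := b *: q + 'X * q^`() - 'X * q.

Lemma rodr_powR b q x : 0 < x ->
  rodr (fun y => y `^ b * q.[y]) x = x `^ (b - 1) * (rodrp b q).[x].
Proof.
move=> x0; rewrite /rodr derive1E.
have h := is_deriveM (is_derive1_powR b x0) (is_derive_poly q x).
have -> : 'D_1 (fun y => y `^ b * q.[y]) x =
    x `^ b * q^`().[x] + q.[x] * (b * x `^ (b - 1)).
  by rewrite (_ : (fun y => _) = (powR (R:=R))^~ b * (fun y => q.[y])) // derive_val.
have -> : x `^ b = x `^ (b - 1) * x.
  have := @powRD _ x (b - 1) 1; rewrite subrK powRr1 ?ltW// => ->//.
  by rewrite (gt_eqF x0) implybT.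
rewrite /rodrp !hornerE /=.
by rewrite -[X in _ + X - _]/(q.[x] * b * x `^ (b - 1)); ring.
Qed.

Fixpoint itrodrp n b q : {poly R} :=
  if n is m.+1 then itrodrp m (b - 1) (rodrp b q) else q.

Lemma iter_rodr n b q x : 0 < x ->
  iter n rodr (fun y => y `^ b * q.[y]) x = x `^ (b - n%:R) * (itrodrp n b q).[x].
Proof.
elim: n b q => [|n IH] b q x0; first by rewrite subr0.
rewrite iterSr (iter_rodr_eq n (fun y y0 => rodr_powR b q y0) x0) IH//=.
by congr (_ `^ _ * _); rewrite -(natr1 n); ring.
Qed.

Lemma itrodrp_lin n b c p q :
  itrodrp n b (c *: p - q) = c *: itrodrp n b p - itrodrp n b q.
Proof.
elim: n b p q => //= n IH b p q; rewrite -IH; congr itrodrp.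
by rewrite /rodrp derivB derivZ -!mul_polyC; ring.
Qed.

Lemma itrodrp_X n b q : itrodrp n b ('X * q) = 'X * itrodrp n (b + 1) q.
Proof.
elim: n b q => //= n IH b q.
have -> : b + 1 - 1 = b - 1 + 1 by ring.
rewrite -IH; congr itrodrp.
by rewrite /rodrp derivM derivX -!mul_polyC polyCD; ring.
Qed.

(** The first application leaves the factor n + 1 + a - X, and linearity of the remaining n
    applications reproduces the recursion of [lag]. *)
Lemma itrodrp_lag n a : itrodrp n (n%:R + a) 1 = lag n a.
Proof.
elim: n a => //= n IH a.
have -> : n.+1%:R + a - 1 = n%:R + a by rewrite -(natr1 n); ring.
have -> : rodrp (n.+1%:R + a) 1 = (n%:R + a + 1) *: 1 - 'X * 1.
  rewrite /rodrp derivC mulr0 addr0; congr (_ *: _ - _).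
  by rewrite -(natr1 n); ring.
rewrite itrodrp_lin itrodrp_X IH -addrA IH; congr (_ *: _ - _).
Qed.

Lemma LbarE l n (x : R) : 0 < x -> Lbar l n x = (Lag R l n).[x].
Proof.
move=> x0; rewrite /Lbar -/(lagc2 R l n) -/rodr.
have e y : 0 < y -> y `^ (n%:R + l%:R + 1 / 2) =
    y `^ (n%:R + (l%:R + 1 / 2)) * (1 : {poly R}).[y].
  by rewrite hornerC mulr1 addrA.
rewrite (iter_rodr_eq n e x0) iter_rodr// itrodrp_lag /Lag hornerZ -mulrA.
congr (_ * _); rewrite mulrA -powRD; last by rewrite (gt_eqF x0) implybT.
have -> : - (l%:R + 1 / 2) + (n%:R + (l%:R + 1 / 2) - n%:R) = 0 :> R by ring.
by rewrite powRr0 !mul1r.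
Qed.

End Rodrigues.

Section PsiFacts.
Variable R : realType.
Notation XX i := (@mpolyX 3 R (mnm1 i)).

Lemma aeqD (f f' g g' : vfun R) : aeq f f' -> aeq g g' ->
  aeq (fun x => f x + g x) (fun x => f' x + g' x).
Proof. by apply: filterS2 => x h1 h2 _; rewrite h1// h2. Qed.

Lemma aeqZ c (f f' : vfun R) : aeq f f' -> aeq (fun x => c * f x) (fun x => c * f' x).
Proof. by apply: filterS => x h1 _; rewrite h1. Qed.

Lemma aeqN (f f' : vfun R) : aeq f f' -> aeq (fun x => - f x) (fun x => - f' x).
Proof. by apply: filterS => x h1 _; rewrite h1. Qed.

Lemma aeqB (f f' g g' : vfun R) : aeq f f' -> aeq g g' ->
  aeq (fun x => f x - g x) (fun x => f' x - g' x).
Proof. by move=> h1 h2; apply: aeqD => //; exact: aeqN. Qed.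

Lemma aeq_sum I (r : seq I) (P : pred I) (F G : I -> vfun R) :
  (forall i, P i -> aeq (F i) (G i)) ->
  aeq (fun x => \sum_(i <- r | P i) F i x) (fun x => \sum_(i <- r | P i) G i x).
Proof.
move=> h; elim: r => [|i r IH].
  by apply: aeW => x _; rewrite !big_nil.
have [Pi|Pi] := boolP (P i).
  have := aeqD (h i Pi) IH; apply: filterS => x e _.
  by rewrite !big_cons Pi e.
by move: IH; apply: filterS => x e _; rewrite !big_cons (negbTE Pi) e.
Qed.

Lemma polyvfunD p q : polyvfun (p + q) = (fun x => polyvfun p x + polyvfun q x) :> vfun R.
Proof. by apply/funext => x; rewrite /polyvfun mevalD. Qed.

Lemma polyvfunM p q : polyvfun (p * q) = (fun x => polyvfun p x * polyvfun q x) :> vfun R.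
Proof. by apply/funext => x; rewrite /polyvfun mevalM. Qed.

Lemma polyvfunZ c p : polyvfun (c *: p) = (fun x => c * polyvfun p x) :> vfun R.
Proof. by apply/funext => x; rewrite /polyvfun mevalZ. Qed.

Lemma polyvfun_sum I (r : seq I) (P : pred I) (F : I -> mpoly 3 R) :
  polyvfun (\sum_(i <- r | P i) F i) = (fun x => \sum_(i <- r | P i) polyvfun (F i) x).
Proof.
apply/funext => x; rewrite /polyvfun.
elim: r => [|i r IH]; first by rewrite !big_nil meval0.
by rewrite !big_cons; case: ifP => // _; rewrite mevalD IH.
Qed.

Lemma polyvfunXX i : polyvfun (XX i) = vcoord i :> vfun R.
Proof. by apply/funext => x; rewrite /polyvfun mevalXU. Qed.

Lemma ip_polyvfun p q : ip (polyvfun p) (polyvfun q : vfun R) = gexp (p * q).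
Proof. by rewrite /ip /gexp polyvfunM. Qed.

Lemma polyvfun_radial (q : {poly R}) x : polyvfun (radial q) x = q.[norm2 x / 2].
Proof.
elim/poly_ind: q => [|q c IH].
  by rewrite radial0 horner0 /polyvfun meval0.
rewrite radialD radialM radialX radialC polyvfunD polyvfunM polyvfunZ /= IH.
rewrite polyvfunZ hornerMXaddC /= [polyvfun 1 x]meval1 mulr1; congr (_ * _ + _).
rewrite polyvfun_sum mulrC; congr (_ / _).
by apply: eq_bigr => i _; rewrite polyvfunM polyvfunXX expr2.
Qed.

Lemma polyvfun_Hpoly l (I : idx l) (x : velocity R) :
  polyvfun (Hpoly R I) x = stf (@xi_tensor R l x) I.
Proof.
rewrite stfE /Hpoly /tpoly polyvfun_sum; apply: eq_bigr => J _.
rewrite polyvfunZ; congr (_ * _); rewrite /Xmon /xi_tensor.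
elim/big_rec2: _ => [|k p1 p2 _ e]; first by rewrite /polyvfun meval1.
by rewrite polyvfunM e polyvfunXX.
Qed.

(** A null set containing the origin, the one velocity at which the Rodrigues formula fails; a
    coordinate plane is taken because its measure is a product. *)
Lemma lebesgue3_snd0 : (@lebesgue3 R).-negligible [set x : velocity R | x.2 = 0].
Proof.
exists (setT `*` [set (0 : R)]); split => //.
- exact: measurableX.
- have := @product_measure1E _ _ _ _ _ (@lebesgue2 R) (@lebesgue_measure R) setT [set (0 : R)].
  have e0 : @lebesgue_measure R [set (0 : R)] = 0%E by exact: lebesgue_measure_set1.
  rewrite /lebesgue3 => -> //; by rewrite [X in (_ * X)%E]e0 mule0.
Qed.

Lemma psi_aeq l n (I : idx l) :
  aeq (@psi R l n I) (polyvfun (Psi R n I)).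
Proof.
apply: negligibleS lebesgue3_snd0 => x /= h; apply: contrapT => x0; apply: h => _.
rewrite /psi /Psi polyvfunM polyvfun_Hpoly polyvfun_radial LbarE//.
rewrite divr_gt0// /norm2 !big_ord_recr big_ord0/= ltr_wpDl//.
  by rewrite !addr_ge0// sqr_ge0.
by rewrite /vcoord/= exprn_even_gt0//=; apply/eqP.
Qed.

Section Pairings.
Hypothesis Lpsi : forall l n (I : idx l), L2 (@psi R l n I).

Lemma ip_psi l n l' n' (I : idx l) (J : idx l') :
  ip (@psi R l n I) (@psi R l' n' J) = gexp (Psi R n I * Psi R n' J).
Proof.
rewrite (aeq_ip (psi_aeq n I))//; last exact: L2_polyvfun.
rewrite ipC (aeq_ip (psi_aeq n' J))//; try exact: L2_polyvfun.
by rewrite ip_polyvfun mulrC.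
Qed.

(** Gram matrix of the psi^n_I at fixed n, the same for all n. From rank 2 on it is not diagonal in
    I, since the components of a trace-free tensor are linearly dependent. *)
Definition psiM l (I J : idx l) : R :=
  lagK R l * (l`!%:R * stfdelta R I J * gexp (1 : mpoly 3 R)).

Lemma ip_psi_same l n n' (I J : idx l) :
  ip (@psi R l n I) (@psi R l n' J) = (n == n')%:R * psiM I J.
Proof. by rewrite ip_psi gexp_Psi_diag. Qed.

Lemma ip_psi_rank l l' n n' (I : idx l) (J : idx l') :
  l != l' -> ip (@psi R l n I) (@psi R l' n' J) = 0.
Proof. by move=> ll'; rewrite ip_psi gexp_Psi_orth. Qed.

Lemma psiM_neq0 l : (l <= 3)%N -> exists I : idx l, psiM I I != 0.
Proof.
move=> /(stfdelta_neq0 R)[I hI]; exists I.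
apply: mulf_neq0; first by rewrite gt_eqF// lagK_gt0.
apply: mulf_neq0; last by rewrite gt_eqF// gexp1_gt0.
by apply: mulf_neq0 => //; rewrite pnatr_eq0 -lt0n fact_gt0.
Qed.

Lemma psiM1 (I J : idx 1) : (psiM I J == 0) = (I != J).
Proof.
rewrite /psiM stfdelta1 (_ : 1`! = 1%N)// mul1r mulf_eq0 (gt_eqF (lagK_gt0 R 1))/= mulf_eq0.
by rewrite (gt_eqF (gexp1_gt0 R)) orbF pnatr_eq0 eqb0.
Qed.

Lemma mulxi_psi l i (I : idx l) :
  exists (C1 : tensor R l.+1) (C2 : tensor R l.-1),
  (l = 0%N -> forall J, C2 J = 0) /\ forall n,
  aeq (mulxi i (@psi R l n I)) (fun x =>
    \sum_J C1 J * (sqrtn R (2 * n + (2 * l + 3)) * @psi R _ n J x -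
                   sqrtn R (2 * n) * @psi R _ n.-1 J x) +
    \sum_J C2 J * (sqrtn R (2 * n + (2 * l + 1)) * @psi R _ n J x -
                   sqrtn R (2 * (n + 1)) * @psi R _ n.+1 J x)).
Proof.
have [C1 [C2 [C20 e]]] := mulXX_Psi R i I; exists C1, C2; split=> // n.
have aes l' (c1 c2 : R) n1 n2 (C : tensor R l') :
  aeq (fun x => \sum_J C J * (c1 * @psi R _ n1 J x - c2 * @psi R _ n2 J x))
      (polyvfun (\sum_J C J *: (c1 *: Psi R n1 J - c2 *: Psi R n2 J))).
  rewrite polyvfun_sum; apply: aeq_sum => J _.
  rewrite polyvfunZ; apply: aeqZ; rewrite -scaleNr polyvfunD !polyvfunZ.
  have h := aeqB (aeqZ c1 (psi_aeq n1 J)) (aeqZ c2 (psi_aeq n2 J)).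
  by apply: aeq_trans h _; apply: aeW => x _; rewrite mulNr.
have h1 : aeq (mulxi i (@psi R l n I)) (polyvfun (XX i * Psi R n I)).
  rewrite polyvfunM polyvfunXX; apply: filterS (psi_aeq n I) => x h _.
  by rewrite /mulxi h.
apply: aeq_trans h1 _; apply: aeq_sym; rewrite e polyvfunD.
exact: aeqD.
Qed.

End Pairings.
End PsiFacts.

(** * Spans and the spaces V *)

Section Spans.
Variable R : realType.
Implicit Types (G : set (vfun R)) (f g h : vfun R).

Lemma fspan_gen G g : G g -> fspan G g.
Proof.
move=> Gg; exists 1%N, (fun=> 1), (fun=> g); split=> //.
by apply/funext => x; rewrite big_ord1 mul1r.
Qed.

Lemma fspan0 G : fspan G (fun=> 0).
Proof.
exists 0%N, (fun=> 0), (fun=> fun=> 0); split; first by move=> [].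
by apply/funext => x; rewrite big_ord0.
Qed.

Lemma fspan_lin G c f g : fspan G f -> fspan G g -> fspan G (lin c f g).
Proof.
move=> [n [cf [gf [Gf ->]]]] [m [cg [gg [Gg ->]]]].
exists (n + m)%N, (fun i => match fintype.split i with inl j => c * cf j | inr j => cg j end),
  (fun i => match fintype.split i with inl j => gf j | inr j => gg j end); split.
  by move=> i; case: fintype.split.
apply/funext => x; rewrite /lin big_split_ord/= mulr_sumr; congr (_ + _).
  by apply: eq_bigr => j _; rewrite -[lshift m j]/(unsplit (inl j)) unsplitK mulrA.
by apply: eq_bigr => j _; rewrite -[rshift n j]/(unsplit (inr j)) unsplitK.
Qed.

Lemma fspan_sub G (E : vfun R -> Prop) : E (fun=> 0) ->
  (forall c f g, E f -> E g -> E (lin c f g)) -> (forall g, G g -> E g) ->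
  forall f, fspan G f -> E f.
Proof.
move=> E0 El EG f [n [c [g [Gg ->]]]].
elim: n c g Gg => [|n IH] c g Gg.
  by rewrite (_ : (fun x => _) = fun=> 0)//; apply/funext => x; rewrite big_ord0.
rewrite (_ : (fun x => _) = lin (c ord0) (g ord0)
   (fun x => \sum_(i < n) c (lift ord0 i) * g (lift ord0 i) x)).
  by apply: El; [exact: EG|exact: (IH (fun i => c (lift ord0 i)) (fun i => g (lift ord0 i)))].
by apply/funext => x; rewrite big_ord_recl.
Qed.

Lemma L2_fspan G : G `<=` @L2 R -> fspan G `<=` @L2 R.
Proof.
move=> GL; apply: fspan_sub => //; first exact: L2_0.
by move=> c f g; exact: L2_lin.
Qed.

Lemma fspan_ip G f : G `<=` @L2 R -> L2 f -> (forall g, G g -> ip f g = 0) ->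
  forall g, fspan G g -> ip f g = 0.
Proof.
move=> GL Lf fG g Gg.
suff [] : L2 g /\ ip f g = 0 by [].
apply: (fspan_sub (E := fun g => L2 g /\ ip f g = 0)) Gg.
- by split; [exact: L2_0|exact: ip0r].
- move=> c u v [Lu u0] [Lv v0]; split; first exact: L2_lin.
  by rewrite ipC ip_linl// !(ipC _ f) u0 v0 mulr0 addr0.
- by move=> u Gu; split; [exact: GL|exact: fG].
Qed.

Lemma fspan_cspan G : G `<=` @L2 R -> fspan G `<=` cspan G.
Proof.
move=> GL g Gg; split; first exact: (L2_fspan GL Gg).
move=> e e0; exists g => //.
rewrite (_ : (fun x => _) = fun=> 0) ?/L2norm ?ip0l ?sqrtr0//.
by apply/funext => x; rewrite subrr.
Qed.

Lemma cspan_ip G f : G `<=` @L2 R -> L2 f -> (forall g, G g -> ip f g = 0) ->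
  forall g, cspan G g -> ip f g = 0.
Proof.
move=> GL Lf fG g [Lg gG].
apply/eqP; rewrite -normr_le0; apply/ler_addgt0Pr => e e0; rewrite add0r.
have n0 : 0 < L2norm f + 1 by rewrite ltr_wpDl// sqrtr_ge0.
have [s sG sg] := gG _ (divr_gt0 e0 n0).
have Ls : L2 s by exact: (L2_fspan GL sG).
have -> : ip f g = ip f (fun x => g x - s x).
  by rewrite ipBr// (fspan_ip GL Lf fG sG) subr0.
apply: le_trans (ip_CauchySchwarz Lf (L2_B Lg Ls)) _.
apply: (@le_trans _ _ ((L2norm f + 1) * (e / (L2norm f + 1)))).
  by apply: ler_pM; rewrite ?sqrtr_ge0 ?lerDl// ltW.
by rewrite mulrC mulfVK// gt_eqF.
Qed.

Lemma L2norm_triangle f g : L2 f -> L2 g ->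
  L2norm (fun x => f x + g x) <= L2norm f + L2norm g.
Proof.
move=> Lf Lg.
have s0 : 0 <= L2norm f + L2norm g by rewrite addr_ge0 ?sqrtr_ge0.
rewrite -(ger0_norm s0) -sqrtr_sqr ler_wsqrtr//.
have Lfg := L2_D Lf Lg.
rewrite ipDl// !ipDr// (ipC g f) sqrrD !sqr_sqrtr ?ip_ge0//.
have := ip_CauchySchwarz Lf Lg; have := ler_norm (ip f g); lra.
Qed.

Lemma L2normZ c f : L2 f -> L2norm (fun x => c * f x) = `|c| * L2norm f.
Proof.
move=> Lf; rewrite /L2norm ipZl ?ipZr//; last exact: L2_Z.
by rewrite mulrA -expr2 sqrtrM ?sqr_ge0// sqrtr_sqr.
Qed.

Lemma cspan0 G : G `<=` @L2 R -> cspan G (fun=> 0).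
Proof. by move=> GL; apply: fspan_cspan => //; exact: fspan0. Qed.

Lemma cspan_lin G c f g : G `<=` @L2 R ->
  cspan G f -> cspan G g -> cspan G (lin c f g).
Proof.
move=> GL [Lf fG] [Lg gG]; split; first exact: L2_lin.
move=> e e0; have c0 : 0 < `|c| + 1 by rewrite ltr_wpDl.
have [s sG sf] := fG (e / 2 / (`|c| + 1)) (divr_gt0 (divr_gt0 e0 (ltr0n _ 2)) c0).
have [t tG tg] := gG (e / 2) (divr_gt0 e0 (ltr0n _ 2)).
have Ls := L2_fspan GL sG; have Lt := L2_fspan GL tG.
exists (lin c s t); first exact: fspan_lin.
have -> : (fun x => lin c f g x - lin c s t x) =
    (fun x => c * (f x - s x) + (g x - t x)).
  by apply/funext => x; rewrite /lin; ring.
apply: le_lt_trans (L2norm_triangle (L2_Z c (L2_B Lf Ls)) (L2_B Lg Lt)) _.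
rewrite L2normZ; last exact: L2_B.
have : `|c| * L2norm (fun x => f x - s x) <= e / 2.
  apply: (@le_trans _ _ ((`|c| + 1) * (e / 2 / (`|c| + 1)))).
    by apply: ler_pM; rewrite ?sqrtr_ge0 ?lerDl// ltW.
  by rewrite mulrC mulfVK// gt_eqF.
by move: tg; lra.
Qed.

(** Dropping the G1 part of an approximation only brings it closer to f, by Pythagoras, since both f
    and the G2 part are orthogonal to it. *)
Lemma cspan_orth G1 G2 f : G1 `<=` @L2 R -> G2 `<=` @L2 R ->
  (forall g1 g2, G1 g1 -> G2 g2 -> ip g1 g2 = 0) ->
  cspan (G1 `|` G2) f -> (forall g, G1 g -> ip f g = 0) -> cspan G2 f.
Proof.
move=> GL1 GL2 G12 [Lf fG] f1; split=> // e e0.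
have [s [n [c [g [Gg es]]]] sf] := fG e e0.
have : exists s1 s2, [/\ fspan G1 s1, fspan G2 s2 & s = (fun x => s1 x + s2 x)].
  apply: (fspan_sub (G := G1 `|` G2) (E := fun s => exists s1 s2,
    [/\ fspan G1 s1, fspan G2 s2 & s = (fun x => s1 x + s2 x)])); last by exists n, c, g.
  - exists (fun=> 0), (fun=> 0); split; try exact: fspan0.
    by apply/funext => x; rewrite addr0.
  - move=> k u v [u1 [u2 [hu1 hu2 ->]]] [v1 [v2 [hv1 hv2 ->]]].
    exists (lin k u1 v1), (lin k u2 v2); split; try exact: fspan_lin.
    by apply/funext => x; rewrite /lin; ring.
  - move=> u [Gu|Gu].
      exists u, (fun=> 0); split; [exact: fspan_gen|exact: fspan0|].
      by apply/funext => x; rewrite addr0.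
    exists (fun=> 0), u; split; [exact: fspan0|exact: fspan_gen|].
    by apply/funext => x; rewrite add0r.
move=> [s1 [s2 [h1 h2 es2]]]; exists s2 => //.
have L1 := L2_fspan GL1 h1; have L2' := L2_fspan GL2 h2.
apply: le_lt_trans sf; rewrite ler_wsqrtr//.
have -> : (fun x => f x - s x) = (fun x => (f x - s2 x) - s1 x).
  by apply/funext => x; rewrite es2; ring.
have Ld := L2_B Lf L2'.
have h12 : ip s2 s1 = 0.
  apply: (fspan_ip GL1 L2' _ h1) => u Gu; rewrite ipC.
  by apply: (fspan_ip GL2 _ _ h2) => [|v Gv]; [exact: GL1|exact: G12].
have o : ip (fun x => f x - s2 x) s1 = 0.
  by rewrite ipBl// (fspan_ip GL1 Lf f1 h1) h12 subrr.
rewrite (ipBl Ld L1 (L2_B Ld L1)) (ipBr Ld L1 Ld) (ipBr Ld L1 L1) (ipC s1).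
by rewrite o subr0 sub0r opprK lerDl ip_ge0.
Qed.

End Spans.

(** * The collision operator and its kernel *)

Section Operators.
Variables (R : realType) (dom : set (vfun R)) (L : vfun R -> vfun R)
  (a : nat -> nat -> nat -> R) (b : nat -> nat -> nat -> nat -> R)
  (D : set (vfun R)).
Hypotheses (hL : collision_operator dom L) (hD : formal_domain b dom L D).
Implicit Types (f g h : vfun R).

Lemma D_L2 f : D f -> L2 f.
Proof. by case: (fd_subspace hD) => h _ _ _; exact: h. Qed.

Lemma D_0 : D (fun=> 0).
Proof. by case: (fd_subspace hD). Qed.

Lemma D_lin c f g : D f -> D g -> D (lin c f g).
Proof. by case: (fd_subspace hD) => _ _ h _; exact: h. Qed.

Lemma D_aeq f g : D f -> L2 g -> aeq f g -> D g.
Proof. by case: (fd_subspace hD) => _ _ _ h; exact: h. Qed.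

Lemma D_dom f : D f -> dom f. Proof. exact: (fd_dom hD). Qed.

Lemma D_L f : D f -> D (L f). Proof. exact: (fd_L hD). Qed.

Lemma D_mulxi i f : D f -> D (mulxi i f). Proof. exact: (fd_mulxi hD). Qed.

Lemma D_psi l n (I : idx l) : D (@psi R l n I).
Proof. exact: (fd_psi hD). Qed.

Lemma D_Z c f : D f -> D (fun x => c * f x).
Proof. exact: lin_closedZ D_0 (@D_lin) _ _. Qed.

Lemma D_D f g : D f -> D g -> D (fun x => f x + g x).
Proof. exact: lin_closedD (@D_lin) _ _. Qed.

Lemma D_N f : D f -> D (fun x => - f x).
Proof. exact: lin_closedN D_0 (@D_lin) _. Qed.

Lemma D_B f g : D f -> D g -> D (fun x => f x - g x).
Proof. exact: lin_closedB D_0 (@D_lin) _ _. Qed.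

Lemma D_sum I (r : seq I) (P : pred I) (F : I -> vfun R) :
  (forall i, P i -> D (F i)) -> D (fun x => \sum_(i <- r | P i) F i x).
Proof. exact: lin_closed_sum D_0 (@D_lin) _ _ _ _. Qed.

Lemma L2psi l n (I : idx l) : L2 (@psi R l n I).
Proof. exact/D_L2/D_psi. Qed.

Lemma L_sym f g : D f -> D g -> ip (L f) g = ip f (L g).
Proof.
move=> Df Dg.
have := (co_selfadjoint hL (D_L2 Dg) (D_L2 (D_L Dg))).2.
by apply; [split; [exact: D_dom|exact: aeq_refl]|exact: D_dom].
Qed.

Lemma L_lin c f g h : D f -> D g -> D h ->
  ip (L (lin c f g)) h = c * ip (L f) h + ip (L g) h.
Proof.
move=> Df Dg Dh; rewrite L_sym//; last exact: D_lin.
by rewrite ip_linl ?L_sym//; apply: D_L2 => //; exact: D_L.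
Qed.

(** Equality case of a semidefinite form: evaluating it at f + t L f gives 2 t |L f|^2 + O(t^2) <=
    0, which is impossible for small t > 0 unless L f is null. *)
Lemma L_null f : D f -> ip (L f) f = 0 -> aeq (L f) (fun=> 0).
Proof.
move=> Df f0; have DLf := D_L Df.
apply: ip_eq0; first exact: D_L2.
set g := L f; have Dg : D g by [].
have q t : 2 * t * ip g g + t ^+ 2 * ip (L g) g <= 0.
  have := co_negative hL (D_dom (D_lin t Dg Df)).
  rewrite L_lin//; last exact: D_lin.
  rewrite !(ipC _ (lin t g f)) !ip_linl; try exact: D_L2; try exact/D_L2/D_L.
  have e1 : ip f (L g) = ip g g by rewrite -L_sym.
  have e2 : ip f (L f) = 0 by rewrite ipC.
  by rewrite e1 e2 (ipC g (L g)) -/g; lra.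
have g0 := ip_ge0 g; have Lg0 := co_negative hL (D_dom Dg).
apply/eqP; rewrite eq_le g0 andbT leNgt; apply/negP => gp.
(* A value of t small enough for the quadratic term to be at most half the linear one; the added 1
   keeps the denominator positive. *)
pose k := ip g g / (- ip (L g) g + 1).
have k0 : 0 < - ip (L g) g + 1 by lra.
have kp : 0 < k by rewrite divr_gt0.
have := q k.
have -> : 2 * k * ip g g + k ^+ 2 * ip (L g) g =
    k * (2 * ip g g + k * ip (L g) g) by ring.
rewrite pmulr_rle0//.
have : k * (- ip (L g) g) <= ip g g.
  by rewrite /k mulrAC ler_pdivrMr// ler_wpM2l// lerDl.
lra.
Qed.

Let idx0 : idx 0 := [ffun=> ord0].

Let Hpoly0 (I : idx 0) : Hpoly R I = 1.
Proof.
rewrite /Hpoly (tpoly0 _ I) (_ : stfdelta R I I = 1) ?scale1r//.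
rewrite /stfdelta stf_id /tdelta ?eqxx//.
by split=> [s J|[]]//; congr (nat_of_bool (_ == _))%:R; exact: ffunI0_unique.
Qed.

Lemma psi0_aeq n I : aeq (@psi R 0 n I) (fun x => (Lag R 0 n).[norm2 x / 2]).
Proof.
apply: aeq_trans (psi_aeq R n I) _; apply: aeW => x _.
by rewrite /Psi Hpoly0 mulr1 polyvfun_radial.
Qed.

Lemma psi10_aeq (I : idx 1) :
  aeq (@psi R 1 0 I) (fun x => Num.sqrt (lagc2 R 1 0) * vcoord (I ord0) x).
Proof.
apply: aeq_trans (psi_aeq R 0 I) _; apply: aeW => x _.
rewrite /Psi polyvfunM polyvfun_radial polyvfun_Hpoly hornerZ hornerC mulr1.
congr (_ * _); rewrite stfE /tdot (bigD1 I)//= stfdelta1 eqxx mul1r big1.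
  by rewrite addr0 /xi_tensor big_ord1.
by move=> J JI; rewrite stfdelta1 eq_sym (negbTE JI) mul0r.
Qed.

Lemma L_psi0_aeq v : D v -> (exists (c0 c2 : R) (c1 : 'I_3 -> R),
   aeq v (fun x => c0 + (\sum_(i < 3) c1 i * vcoord i x) + c2 * norm2 x)) ->
  aeq (L v) (fun=> 0).
Proof.
by move=> Dv h; case: ((co_kernel hL v).2 _) => //; split=> //; exact: D_L2.
Qed.

Let c_ n := Num.sqrt (lagc2 R 0 n).

Let c_gt0 n : 0 < c_ n. Proof. by rewrite sqrtr_gt0 lagc2_gt0. Qed.

Let Lag00 (x : R) : (Lag R 0 0).[x] = c_ 0.
Proof. by rewrite hornerZ hornerC mulr1. Qed.

Let Lag01 (x : R) : (Lag R 0 1).[x] = c_ 1 * (3 / 2 - x).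
Proof. by rewrite /Lag /= !hornerE/=; congr (_ * _); field. Qed.

Definition V0gens : set (vfun R) := [set f | exists I, f = @psi R 0 0 I]
  `|` [set f | exists I, f = @psi R 0 1 I] `|` [set f | exists I, f = @psi R 1 0 I].

Lemma V0E : @V0 R = fspan V0gens. Proof. by []. Qed.

Lemma V0gens_D g : V0gens g -> D g.
Proof. by move=> [[[I ->]|[I ->]]|[I ->]]; exact: D_psi. Qed.

Lemma V0gens_L2 : V0gens `<=` @L2 R. Proof. by move=> g /V0gens_D/D_L2. Qed.

Lemma V0_D f : V0 f -> D f.
Proof.
apply: fspan_sub => [|c u v|g]; [exact: D_0|exact: D_lin|exact: V0gens_D].
Qed.

Lemma L_V0 f g : V0 f -> D g -> ip (L f) g = 0.
Proof.
move=> Vf Dg; suff [] : D f /\ ip (L f) g = 0 by [].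
apply: (fspan_sub (E := fun f => D f /\ ip (L f) g = 0)) Vf.
- split; first exact: D_0.
  by rewrite L_sym ?ip0l//; exact: D_0.
- by move=> c u v [Du u0] [Dv v0]; split; [exact: D_lin|rewrite L_lin// u0 v0 mulr0 addr0].
- move=> u Gu; have Du := V0gens_D Gu; split=> //.
  suff : aeq (L u) (fun=> 0).
    move=> u0; rewrite (aeq_ip u0) ?ip0l//; try exact: L2_0; try exact: D_L2.
    exact/D_L2/D_L.
  apply: L_psi0_aeq => //; case: Gu => [[[I ->]|[I ->]]|[I ->]].
  + exists (c_ 0), 0, (fun=> 0); apply: aeq_trans (psi0_aeq _ _) _.
    apply: aeW => x _; rewrite Lag00 mul0r addr0 big1 ?addr0// => i _.
    by rewrite mul0r.
  + exists (c_ 1 * (3 / 2)), (- c_ 1 / 2), (fun=> 0).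
    apply: aeq_trans (psi0_aeq _ _) _; apply: aeW => x _; rewrite Lag01 big1.
      by field.
    by move=> i _; rewrite mul0r.
  + exists 0, 0, (fun i => (i == I ord0)%:R * Num.sqrt (lagc2 R 1 0)).
    apply: aeq_trans (psi10_aeq _) _; apply: aeW => x _.
    rewrite (bigD1 (I ord0))//= eqxx big1 => [|i ii]; first by rewrite add0r mul0r !addr0 mul1r.
    by rewrite (negbTE ii) !mul0r.
Qed.

(** The collision invariants are re-expanded in the generators of [V0], each of them being a nonzero
    multiple of a coordinate or an affine function of |xi|^2. *)
Lemma kernel_V0 f : D f -> aeq (L f) (fun=> 0) -> exists2 v, V0 v & aeq f v.
Proof.
move=> Df Lf0.
have [_ [c0 [c2 [c1 e]]]] := (co_kernel hL f).1 (conj (D_dom Df) Lf0).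
(* In rank 0, psi^1 is c_1 (3/2 - |xi|^2/2): the coefficient of |xi|^2 fixes k2, after which the
   constant term fixes k0. *)
pose k2 := - (2 * c2) / c_ 1.
pose k0 := (c0 - k2 * c_ 1 * (3 / 2)) / c_ 0.
pose k1 i := c1 i / Num.sqrt (lagc2 R 1 0).
have g0 : 0 < Num.sqrt (lagc2 R 1 0) by rewrite sqrtr_gt0 lagc2_gt0.
exists (lin k0 (@psi R 0 0 idx0) (lin k2 (@psi R 0 1 idx0)
   (lin (k1 ord0) (@psi R 1 0 [ffun=> ord0])
   (lin (k1 (lift ord0 ord0)) (@psi R 1 0 [ffun=> lift ord0 ord0])
   (lin (k1 (lift ord0 (lift ord0 ord0)))
     (@psi R 1 0 [ffun=> lift ord0 (lift ord0 ord0)]) (fun=> 0)))))).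
  have st k g v : V0gens g -> fspan V0gens v -> fspan V0gens (lin k g v).
    by move=> Gg; apply: fspan_lin; exact: fspan_gen.
  have g0' : V0gens (@psi R 0 0 idx0) by left; left; exists idx0.
  have g1 : V0gens (@psi R 0 1 idx0) by left; right; exists idx0.
  have g2 i : V0gens (@psi R 1 0 [ffun=> i]) by right; exists [ffun=> i].
  rewrite V0E; exact (st _ _ _ g0' (st _ _ _ g1 (st _ _ _ (g2 _) (st _ _ _ (g2 _)
    (st _ _ _ (g2 _) (fspan0 V0gens)))))).
apply: aeq_trans e _; apply: aeq_sym.
have h0 := aeqZ k0 (psi0_aeq 0 idx0); have h1 := aeqZ k2 (psi0_aeq 1 idx0).
have p1 i := aeqZ (k1 i) (psi10_aeq [ffun=> i]).
have := aeqD h0 (aeqD h1 (aeqD (p1 ord0) (aeqD (p1 (lift ord0 ord0))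
  (aeqD (p1 (lift ord0 (lift ord0 ord0))) (aeq_refl (fun=> 0)))))).
move=> H; apply: aeq_trans H _; apply: aeW => x _.
rewrite Lag00 Lag01 !ffunE !big_ord_recl big_ord0 /k0 /k1 /k2.
move: (c_gt0 0) (c_gt0 1) g0; move: (c_ 0) (c_ 1) (Num.sqrt _) => z0 z1 z2.
move: (norm2 x) (vcoord _ x) (vcoord _ x) (vcoord _ x) => y y1 y2 y3.
move: (c1 _) (c1 _) (c1 _) => w1 w2 w3 z0p z1p z2p.
by field; rewrite !gt_eqF.
Qed.

Lemma ippsi l n n' (I J : idx l) :
  ip (@psi R l n I) (@psi R l n' J) = (n == n')%:R * psiM R I J.
Proof. exact: ip_psi_same L2psi _ _ _ _ _. Qed.

Lemma ippsi0 l l' n n' (I : idx l) (J : idx l') :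
  l != l' -> ip (@psi R l n I) (@psi R l' n' J) = 0.
Proof. exact: ip_psi_rank L2psi _ _ _ _ _ _. Qed.

Lemma ippsi_neq l n n' (I J : idx l) :
  n != n' -> ip (@psi R l n I) (@psi R l n' J) = 0.
Proof. by move=> nn'; rewrite ippsi (negbTE nn') mul0r. Qed.

(** * Generators of S^(2) and S^(3), orthogonality of the V spaces and projections *)

Definition S2gens : set (vfun R) :=
  [set f | exists n I, (1 <= n)%N /\ f = psihat1 b n I]
     `|` [set f | exists n I, f = psihat2 b n I]
     `|` [set f | exists n I, (2 <= n)%N /\ f = @psi R 0 n I]
     `|` [set f | exists l n I, (3 <= l)%N /\ f = @psi R l n I].

(** The generators of S^(3) are separated by rank. Those of rank at most 3 carry the d coefficients
    and are handled through preimages under L; those of rank at least 4 are handled by their rank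
    alone. *)
Definition S3low : set (vfun R) :=
  [set f | exists n I, (3 <= n)%N /\
            f = (fun x => @psi R 0 n I x - d02 b n * @psi R 0 2 I x)]
     `|` [set f | exists n I, (4 <= n)%N /\
            f = (fun x => psihat1 b n I x - d12 b n * psihat1 b 2 I x
                                          - d13 b n * psihat1 b 3 I x)]
     `|` [set f | exists n I, (3 <= n)%N /\
            f = (fun x => psihat2 b n I x - d21 b n * psihat2 b 1 I x
                                          - d22 b n * psihat2 b 2 I x)]
     `|` [set f | exists n I, (1 <= n)%N /\
            f = (fun x => @psi R 3 n I x - d30 b n * @psi R 3 0 I x)].

Definition S3high : set (vfun R) :=
  [set f | exists l n I, (4 <= l)%N /\ f = @psi R l n I].

Lemma S2E : S2 b = cspan S2gens. Proof. by []. Qed.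

Lemma D_psihat1 n I : D (psihat1 b n I).
Proof. by apply: D_B; [|apply: D_Z]; exact: D_psi. Qed.

Lemma D_psihat2 n I : D (psihat2 b n I).
Proof. by apply: D_B; [|apply: D_Z]; exact: D_psi. Qed.

Lemma S2gens_D g : S2gens g -> D g.
Proof.
by move=> [[[[n [I [_ ->]]]|[n [I ->]]]|[n [I [_ ->]]]]|[l [n [I [_ ->]]]]];
  [exact: D_psihat1|exact: D_psihat2|exact: D_psi|exact: D_psi].
Qed.

Lemma S3low_D g : S3low g -> D g.
Proof.
move=> [[[[n [I [_ ->]]]|[n [I [_ ->]]]]|[n [I [_ ->]]]]|[n [I [_ ->]]]].
- by apply: D_B; [|apply: D_Z]; exact: D_psi.
- by do 2 (apply: D_B; last by apply: D_Z; exact: D_psihat1); exact: D_psihat1.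
- by do 2 (apply: D_B; last by apply: D_Z; exact: D_psihat2); exact: D_psihat2.
- by apply: D_B; [|apply: D_Z]; exact: D_psi.
Qed.

Lemma S3high_D g : S3high g -> D g.
Proof. by move=> [l [n [I [_ ->]]]]; exact: D_psi. Qed.

Lemma S2gens_L2 : S2gens `<=` @L2 R. Proof. by move=> g /S2gens_D/D_L2. Qed.

Lemma S3low_L2 : S3low `<=` @L2 R. Proof. by move=> g /S3low_D/D_L2. Qed.

Lemma S3high_L2 : S3high `<=` @L2 R. Proof. by move=> g /S3high_D/D_L2. Qed.

Lemma S3gens_L2 : S3low `|` S3high `<=` @L2 R.
Proof. by move=> g [/S3low_L2|/S3high_L2]. Qed.

Lemma linB c f g : lin (- c) f g = fun x => g x - c * f x.
Proof. by apply/funext => x; rewrite /lin; ring. Qed.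

Lemma S3gens_S2gens g : (S3low `|` S3high) g -> fspan S2gens g.
Proof.
have i1 n I : (1 <= n)%N -> fspan S2gens (psihat1 b n I).
  by move=> n1; apply: fspan_gen; left; left; left; exists n, I.
have i2 n I : fspan S2gens (psihat2 b n I).
  by apply: fspan_gen; left; left; right; exists n, I.
have i0 n I : (2 <= n)%N -> fspan S2gens (@psi R 0 n I).
  by move=> n2; apply: fspan_gen; left; right; exists n, I.
have i3 l n I : (3 <= l)%N -> fspan S2gens (@psi R l n I).
  by move=> l3; apply: fspan_gen; right; exists l, n, I.
move=> [[[[[n [I [h ->]]]|[n [I [h ->]]]]|[n [I [h ->]]]]|[n [I [h ->]]]]|[l [n [I [h ->]]]]].
- by rewrite -linB; apply: fspan_lin; apply: i0 => //; lia.
- rewrite -[X in fspan _ X]/(fun x => (fun x => psihat1 b n I x - d12 b n * psihat1 b 2 I x) x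
     - d13 b n * psihat1 b 3 I x).
  rewrite -linB; apply: fspan_lin; first exact: i1.
  by rewrite -linB; apply: fspan_lin; apply: i1; lia.
- rewrite -[X in fspan _ X]/(fun x => (fun x => psihat2 b n I x - d21 b n * psihat2 b 1 I x) x
     - d22 b n * psihat2 b 2 I x).
  rewrite -linB; apply: fspan_lin; first exact: i2.
  by rewrite -linB; apply: fspan_lin; exact: i2.
- by rewrite -linB; apply: fspan_lin; exact: i3.
- by apply: i3; lia.
Qed.

Lemma S3_S2 f : L2 f -> (forall g, S2 b g -> ip f g = 0) ->
  forall g, S3 b g -> ip f g = 0.
Proof.
move=> Lf h g; apply: cspan_ip => //; first exact: S3gens_L2.
move=> u /S3gens_S2gens su; apply: h; rewrite S2E.
exact: (fspan_cspan S2gens_L2 su).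
Qed.

Lemma V0gens_S2gens v s : V0gens v -> S2gens s -> ip v s = 0.
Proof.
move=> Gv Gs; have Lv := V0gens_L2 Gv.
case: Gs => [[[[n [I [h ->]]]|[n [I ->]]]|[n [I [h ->]]]]|[l [n [I [h ->]]]]].
- rewrite /psihat1 ipBr ?ipZr//; try exact: L2psi; last exact/D_L2/D_Z/D_psi.
  case: Gv => [[[J ->]|[J ->]]|[J ->]]; try by rewrite !ippsi0// mulr0 subrr.
  have n0 : 0%N != n by lia.
  by rewrite !ippsi_neq// mulr0 subrr.
- rewrite /psihat2 ipBr ?ipZr//; try exact: L2psi; last exact/D_L2/D_Z/D_psi.
  by case: Gv => [[[J ->]|[J ->]]|[J ->]]; rewrite !ippsi0// ?mulr0 ?subrr//.
- case: Gv => [[[J ->]|[J ->]]|[J ->]]; last by rewrite ippsi0.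
    by rewrite ippsi_neq//; lia.
  by rewrite ippsi_neq//; lia.
- by case: Gv => [[[J ->]|[J ->]]|[J ->]]; rewrite ippsi0//; lia.
Qed.

Lemma V0_L2 (v : vfun R) : V0 v -> L2 v. Proof. by move=> /V0_D/D_L2. Qed.

Lemma V0_S2 (v s : vfun R) : V0 v -> S2 b s -> ip v s = 0.
Proof.
move=> Vv; apply: cspan_ip; [exact: S2gens_L2|exact: V0_L2|] => g Gg.
rewrite ipC; apply: fspan_ip (Vv); [exact: V0gens_L2|exact: S2gens_L2|] => u Gu.
by rewrite ipC; exact: V0gens_S2gens.
Qed.

Lemma S2_L2 s : S2 b s -> L2 s. Proof. by case. Qed.

Lemma S3_L2 s : S3 b s -> L2 s. Proof. by case. Qed.

Lemma V0_S3 (v s : vfun R) : V0 v -> S3 b s -> ip v s = 0.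
Proof. by move=> Vv; apply: S3_S2; [exact: V0_L2|move=> g; exact: V0_S2]. Qed.

Lemma V_L2 k f : V b k f -> L2 f.
Proof. by case: k => /= [/V0_L2|[[]]|[/S2_L2]|/S3_L2]. Qed.

Lemma orth_lin (E : set (vfun R)) c f g : E `<=` @L2 R ->
  orth E f -> orth E g -> orth E (lin c f g).
Proof.
move=> EL [Lf f0] [Lg g0]; split; first exact: L2_lin.
by move=> h Eh; rewrite ip_linl ?f0 ?g0 ?mulr0 ?addr0//; exact: EL.
Qed.

Lemma V_lin k c f g : V b k f -> V b k g -> V b k (lin c f g).
Proof.
case: k => /= [|[f1 f2] [g1 g2]|[f1 f2] [g1 g2]|].
- exact: fspan_lin.
- split; apply: orth_lin => //; [exact: V0_L2|exact: S2_L2].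
- split; last by apply: orth_lin => //; exact: S3_L2.
  by apply: cspan_lin => //; exact: S2gens_L2.
- by apply: cspan_lin; exact: S3gens_L2.
Qed.

Lemma V_0 k : V b k (fun=> 0).
Proof.
have o E : orth E (fun=> 0 : R) by split; [exact: L2_0|move=> g _; exact: ip0l].
case: k => /=; [exact: fspan0|split; exact: o|split; [|exact: o]|].
  by apply: cspan0; exact: S2gens_L2.
by apply: cspan0; exact: S3gens_L2.
Qed.

Lemma V_orth k k' f g : k <> k' -> V b k f -> V b k' g -> ip f g = 0.
Proof.
have o01 u v : V b B0 u -> V b B1 v -> ip u v = 0.
  by move=> Vu [[_ h] _]; rewrite ipC h.
have o02 u v : V b B0 u -> V b B2 v -> ip u v = 0.
  by move=> Vu [Sv _]; exact: V0_S2.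
have o0r u v : V b B0 u -> V b Br v -> ip u v = 0 by exact: V0_S3.
have o12 u v : V b B1 u -> V b B2 v -> ip u v = 0.
  by move=> [_ [_ h]] [Sv _]; exact: h.
have o1r u v : V b B1 u -> V b Br v -> ip u v = 0.
  by move=> [_ [Lu h]]; apply: S3_S2.
have o2r u v : V b B2 u -> V b Br v -> ip u v = 0.
  by move=> [_ [_ h]] Sv; exact: h.
case: k; case: k' => // _ Vf Vg; first [by auto | by rewrite ipC; auto].
Qed.

Lemma V_D k f g : V b k f -> V b k g -> V b k (fun x => f x + g x).
Proof. exact: lin_closedD (@V_lin k) _ _. Qed.

Lemma V_N k f : V b k f -> V b k (fun x => - f x).
Proof. exact: lin_closedN (V_0 k) (@V_lin k) _. Qed.

Lemma V_B k f g : V b k f -> V b k g -> V b k (fun x => f x - g x).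
Proof. exact: lin_closedB (V_0 k) (@V_lin k) _ _. Qed.

Lemma V_sum k I (r : seq I) (P : pred I) (F : I -> vfun R) :
  (forall i, P i -> V b k (F i)) -> V b k (fun x => \sum_(i <- r | P i) F i x).
Proof. exact: lin_closed_sum (V_0 k) (@V_lin k) _ _ _ _. Qed.

Lemma aeq_V k f g : V b k f -> V b k g ->
  (forall h, V b k h -> ip f h = ip g h) -> aeq f g.
Proof.
move=> Vf Vg e; have Lf := V_L2 Vf; have Lg := V_L2 Vg.
have Vd := V_B Vf Vg.
have := @ip_eq0 _ (fun x => f x - g x) (V_L2 Vd).
rewrite ipBl ?e// ?subrr; [|exact: V_L2 Vd..].
by move=> /(_ erefl); apply: filterS => x /(_ I)/eqP; rewrite subr_eq0 => /eqP.
Qed.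

Lemma decomp f : D f -> exists g : block -> vfun R,
  [/\ forall k, V b k (g k) /\ D (g k),
      aeq f (fun x => g B0 x + g B1 x + g B2 x + g Br x) &
      forall k h, V b k h -> ip f h = ip (g k) h].
Proof.
move=> Df; have [g [gVD fg]] := fd_decomposition hD Df.
have gL k' : L2 (g k') by exact: V_L2 (gVD k').1.
have Lg : L2 (fun x => g B0 x + g B1 x + g B2 x + g Br x).
  by do 3 (apply: L2_D => //).
exists g; split=> // k h Vh; have Lh := V_L2 Vh.
rewrite (aeq_ip fg)//; last exact: D_L2.
rewrite !ipDl//; try (by do 2 (apply: L2_D => //)); try exact: L2_D.
have z k' : k' <> k -> ip (g k') h = 0.
  by move=> kk; apply: V_orth kk (gVD k').1 Vh.
case: (k) z => z.
- by rewrite (z B1)// (z B2)// (z Br)// !addr0.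
- by rewrite (z B0)// (z B2)// (z Br)// !addr0 add0r.
- by rewrite (z B0)// (z B1)// (z Br)// addr0 !add0r.
- by rewrite (z B0)// (z B1)// (z B2)// !add0r.
Qed.

(** On D the decomposition supplies a projection, so [xget] picks a genuine one. Its choice may
    differ from the component lying in D on a null set, and stability of D under almost everywhere
    equality brings it back into D. *)
Lemma orthproj_spec k f : D f -> [/\ V b k (orthproj (V b k) f),
  D (orthproj (V b k) f) &
  forall h, V b k h -> ip (orthproj (V b k) f) h = ip f h].
Proof.
move=> Df; have [g [gVD fg gk]] := decomp Df.
have ex : is_orthproj (V b k) f (g k).
  split; first exact: (gVD k).1.
  move=> h Vh; rewrite ipBl ?(gk k)// ?subrr//; [exact: D_L2|exact: V_L2 (gVD k).1|].
  exact: V_L2 Vh.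
have [Vp hp] := @xgetPex _ (fun=> 0) [set g | is_orthproj (V b k) f g] (ex_intro _ _ ex).
rewrite -/(orthproj (V b k) f) in Vp hp.
have e h : V b k h -> ip (orthproj (V b k) f) h = ip f h.
  move=> Vh; have := hp h Vh; rewrite ipBl//; [|exact: D_L2|exact: V_L2 Vp|exact: V_L2 Vh].
  by move/eqP; rewrite subr_eq0 => /eqP.
split=> //.
apply: (D_aeq (gVD k).2); first exact: V_L2 Vp.
by apply: (@aeq_V k) (gVD k).1 Vp _ => h Vh; rewrite e// (gk k).
Qed.

Lemma V_orthproj k f : D f -> V b k (orthproj (V b k) f).
Proof. by case/(orthproj_spec k). Qed.

Lemma D_orthproj k f : D f -> D (orthproj (V b k) f).
Proof. by case/(orthproj_spec k). Qed.

Lemma ip_orthproj k f h : D f -> V b k h -> ip (orthproj (V b k) f) h = ip f h.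
Proof. by move=> /(orthproj_spec k)[_ _ e] /e. Qed.

Lemma orthproj_aeq k f g : D f -> D g -> aeq f g ->
  aeq (orthproj (V b k) f) (orthproj (V b k) g).
Proof.
move=> Df Dg fg; apply: (@aeq_V k); try exact: V_orthproj.
move=> h Vh; rewrite !ip_orthproj//; apply: aeq_ip fg _ _ _.
- exact: D_L2.
- exact: D_L2.
- exact: V_L2 Vh.
Qed.

Lemma orthproj_0 k : aeq (orthproj (V b k) (fun=> 0)) (fun=> 0).
Proof.
apply: (@aeq_V k); [exact/V_orthproj/D_0|exact: V_0|] => h Vh.
by rewrite ip_orthproj//; exact: D_0.
Qed.

Lemma orthproj_lin k c f g : D f -> D g ->
  aeq (orthproj (V b k) (lin c f g))
      (lin c (orthproj (V b k) f) (orthproj (V b k) g)).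
Proof.
move=> Df Dg; have Dl := D_lin c Df Dg.
apply: (@aeq_V k); [exact: V_orthproj|apply: V_lin; exact: V_orthproj|] => h Vh.
have Lh := V_L2 Vh.
by rewrite ip_orthproj// !ip_linl ?ip_orthproj//; try exact: D_L2;
  apply: D_L2; exact: D_orthproj.
Qed.

Lemma ip_decomp f g : D f -> D g -> (forall v, V0 v -> ip f v = 0) ->
  ip f g = ip f (orthproj (V b B1) g) + ip f (orthproj (V b B2) g)
           + ip f (orthproj (V b Br) g).
Proof.
move=> Df Dg f0; have [gk [gVD gE gkE]] := decomp Dg.
have gL k : L2 (gk k) by exact: V_L2 (gVD k).1.
have Lf := D_L2 Df.
have e k : ip f (orthproj (V b k) g) = ip f (gk k).
  rewrite !(ipC f); apply: aeq_ip => //; last exact/D_L2/D_orthproj.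
  apply: (@aeq_V k) (V_orthproj k Dg) (gVD k).1 _ => h Vh.
  by rewrite ip_orthproj// (gkE k).
rewrite !e ipC (aeq_ip gE)//; last 2 first.
- exact: D_L2.
- by do 3 (apply: L2_D => //).
rewrite !ipDl//; try (by do 2 (apply: L2_D => //)); try exact: L2_D.
by rewrite !(ipC _ f) (f0 (gk B0))// ?add0r//; exact: (gVD B0).1.
Qed.

(* The generators of [V0] are linearly independent. *)
Lemma V0_aeq_eq (v w : vfun R) : V0 v -> V0 w -> aeq v w -> v = w.
Proof.
move=> Vv Vw vw.
pose I0 : idx 0 := [ffun=> ord0].
have Vu : V0 (fun x => v x - w x) by exact: (@V_B B0).
suff u0 : (fun x => v x - w x) = fun=> 0.
  by apply/funext => x; apply/eqP; rewrite -subr_eq0 -[_ - _]/((fun x => v x - w x) x) u0.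
have uE : aeq (fun x => v x - w x) (fun=> 0).
  by apply: filterS vw => x /(_ I) -> _; rewrite subrr.
move: Vu uE; move: (fun x => v x - w x) => u Vu uE.
have Lu := V0_L2 Vu.
have uz h : L2 h -> ip u h = 0 by move=> Lh; rewrite (aeq_ip uE)// ?ip0l//; exact: L2_0.
have [k0 [k1 [k2 e]]] : exists k0 k1 (k2 : idx 1 -> R),
   u = lin k0 (@psi R 0 0 I0) (lin k1 (@psi R 0 1 I0)
         (fun x => \sum_I k2 I * @psi R 1 0 I x)).
  apply: (fspan_sub (G := V0gens) (E := fun u => exists k0 k1
     (k2 : idx 1 -> R), u = lin k0 (@psi R 0 0 I0)
     (lin k1 (@psi R 0 1 I0) (fun x => \sum_I k2 I * @psi R 1 0 I x)))) Vu.
  - exists 0, 0, (fun=> 0); apply/funext => x; rewrite /lin !mul0r !add0r.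
    by rewrite big1// => I _; rewrite mul0r.
  - move=> c f g [f0 [f1 [f2 ->]]] [g0 [g1 [g2 ->]]].
    exists (c * f0 + g0), (c * f1 + g1), (fun I => c * f2 I + g2 I).
    apply/funext => x; rewrite /lin.
    have -> : \sum_I (c * f2 I + g2 I) * @psi R 1 0 I x =
       c * (\sum_I f2 I * @psi R 1 0 I x) + \sum_I g2 I * @psi R 1 0 I x.
      by rewrite mulr_sumr -big_split/=; apply: eq_bigr => I _; ring.
    by ring.
  - move=> g [[[I ->]|[I ->]]|[I ->]].
    + exists 1, 0, (fun=> 0); apply/funext => x; rewrite /lin big1 => [|J _].
        by rewrite (ffunI0_unique I I0); ring.
      by rewrite mul0r.
    + exists 0, 1, (fun=> 0); apply/funext => x; rewrite /lin big1 => [|J _].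
        by rewrite (ffunI0_unique I I0); ring.
      by rewrite mul0r.
    + exists 0, 0, (fun J => (J == I)%:R); apply/funext => x.
      rewrite /lin (bigD1 I)//= eqxx big1 => [|J JI]; first by rewrite mul1r !mul0r !add0r addr0.
      by rewrite (negbTE JI) mul0r.
have Ls : L2 (fun x => \sum_I k2 I * @psi R 1 0 I x).
  by apply: L2_sum => I _; apply: L2_Z; exact: L2psi.
have ipu l n (I : idx l) : 0 = k0 * ip (@psi R 0 0 I0) (@psi R l n I) +
   (k1 * ip (@psi R 0 1 I0) (@psi R l n I) +
    \sum_J k2 J * ip (@psi R 1 0 J) (@psi R l n I)).
  have := uz _ (L2psi n I); rewrite e !ip_linl//; try exact: L2psi; last first.
    by apply: L2_lin => //; exact: L2psi.
  rewrite ip_suml; [|by move=> J _; apply: L2_Z; exact: L2psi|exact: L2psi].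
  move=> u0; apply: etrans (esym u0) _; congr (_ + (_ + _)); apply: eq_bigr => J _.
  by rewrite ipZl//; exact: L2psi.
have [K KK] := psiM_neq0 R (leq0n 3).
have M0 : psiM R I0 I0 != 0 by rewrite (ffunI0_unique I0 K).
have k00 : k0 = 0.
  have := ipu 0 0 I0; rewrite ippsi mul1r ippsi_neq// mulr0 add0r big1.
    by rewrite addr0 => /esym/eqP; rewrite mulf_eq0 (negbTE M0) orbF => /eqP.
  by move=> J _; rewrite ippsi0// mulr0.
have k10 : k1 = 0.
  have := ipu 0 1 I0; rewrite ippsi_neq// mulr0 add0r ippsi mul1r big1.
    by rewrite addr0 => /esym/eqP; rewrite mulf_eq0 (negbTE M0) orbF => /eqP.
  by move=> J _; rewrite ippsi0// mulr0.
have k20 J : k2 J = 0.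
  have := ipu 1 0 J; rewrite !ippsi0// !mulr0 !add0r (bigD1 J)//= big1.
    rewrite addr0 ippsi mul1r => /esym/eqP; rewrite mulf_eq0 psiM1 eqxx orbF.
    by move/eqP.
  move=> K' KJ; rewrite ippsi mul1r; have := psiM1 R K' J; rewrite KJ => /eqP ->.
  by rewrite mulr0.
rewrite e k00 k10; apply/funext => x; rewrite /lin !mul0r !add0r big1// => J _.
by rewrite k20 mul0r.
Qed.

(** * Inverse images under the collision operator *)

Definition psigens : set (vfun R) :=
  [set f | exists l n I, f = @psi R l n I].

Definition psiorth f := forall l n (I : idx l), ip f (psi n I) = 0.

Lemma psigens_L2 : psigens `<=` @L2 R.
Proof. by move=> _ [l [n [I ->]]]; exact: L2psi. Qed.

Lemma fspan_sum (G : set (vfun R)) I (r : seq I) (P : pred I) (c : I -> R)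
    (g : I -> vfun R) : (forall i, P i -> fspan G (g i)) ->
  fspan G (fun x => \sum_(i <- r | P i) c i * g i x).
Proof.
move=> Gg; apply: lin_closed_sum => [|k f h|i Pi]; [exact: fspan0|exact: fspan_lin|].
exact: (lin_closedZ (fspan0 G) (@fspan_lin _ G) _ (Gg i Pi)).
Qed.

Hypotheses (ha : collision_matrix L a) (hb : matrix_inverses a b D).

Lemma cvgn_unique (u : nat -> R) (x y : R) :
  u @ \oo --> x -> u @ \oo --> y -> x = y.
Proof. by move=> ux uy; rewrite -(cvg_lim _ ux)// -(cvg_lim _ uy). Qed.

Lemma cvg_Lpsi l n (I : idx l) h : L2 h ->
  (fun N => \sum_(k < N) a l k n * ip (psi k I) h) @ \oo --> ip (L (psi n I)) h.
Proof.
move=> Lh.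
have c := cvg_ipl _ (D_L2 (D_L (D_psi n I))) Lh (ha.2 l n I).
rewrite (_ : (fun N => _) = fun N => ip (fun x => \sum_(k < N) a l k n * @psi R l k I x) h).
  by apply: c => N; apply: L2_sum => i _; apply: L2_Z; exact: L2psi.
apply/funext => N; rewrite ip_suml//.
  by apply: eq_bigr => k _; rewrite ipZl//; exact: L2psi.
by move=> i _; apply: L2_Z; exact: L2psi.
Qed.

(** L psi^n is a limit of combinations of psi of the same rank, so by symmetry of L the orthogonal
    complement of the family is invariant. *)
Lemma psiorth_L f : D f -> psiorth f -> psiorth (L f).
Proof.
move=> Df f0 l n I; rewrite L_sym//; last exact: D_psi.
have := @cvg_Lpsi l n I _ (D_L2 Df).
rewrite (_ : (fun N => _) = fun=> 0) => [c|].
  by rewrite ipC; exact: cvg_unique c (cvg_cst _).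
by apply/funext => N; rewrite big1// => k _; rewrite ipC f0 mulr0.
Qed.

(* The family psi is not assumed complete: the residual [L f - t] is
   orthogonal to all psi and L preserves this property. *)
Lemma L_eq_of_psi f t : D f -> D t -> cspan psigens f -> cspan psigens t ->
  (forall l n (I : idx l), ip (L f) (psi n I) = ip t (psi n I)) ->
  aeq (L f) t.
Proof.
move=> Df Dt sf st e.
have Lk := D_B (D_L Df) Dt.
have k0 : psiorth (fun x => L f x - t x).
  move=> l n I; rewrite ipBl ?e ?subrr//; [exact/D_L2/D_L|exact: D_L2|exact: L2psi].
have kz s : cspan psigens s -> ip (fun x => L f x - t x) s = 0.
  apply: cspan_ip; [exact: psigens_L2|exact: D_L2|].
  by move=> _ [l [n [I ->]]].
(* With k = L f - t, <k, k> = <L k, f> - <k, t>, and both terms vanish because f and t are limits of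
   combinations of psi. *)
have := ip_eq0 (D_L2 Lk).
rewrite ipBr ?(kz t)//; [|exact/D_L2/D_L|exact: D_L2..].
rewrite -L_sym// ipC.
have -> : ip f (L (fun x => L f x - t x)) = 0.
  rewrite ipC; apply: cspan_ip sf; [exact: psigens_L2|exact/D_L2/D_L|].
  by move=> _ [l [n [I ->]]]; exact: psiorth_L.
rewrite subrr => /(_ erefl); apply: filterS => x /(_ I)/eqP.
by rewrite subr_eq0 => /eqP.
Qed.

(* The column n' of the inverse matrix, i.e. the inverse image under L of
   psi^{n'}, up to terms psi^m with m < n0. *)
Definition Linv l n0 n' (I : idx l) : vfun R :=
  xget (fun=> 0) [set f | D f /\ (fun N => L2norm (fun x => f x
    - \sum_(n0 <= n < N) b n0 l n n' * @psi R l n I x)) @ \oo --> (0 : R)].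

Section Column.
Variables (l n0 n' : nat) (I : idx l).
Hypotheses (u : inverse_used l n0) (n0n' : (n0 <= n')%N).

Let s N : vfun R := fun x => \sum_(n0 <= n < N) b n0 l n n' * @psi R l n I x.

Let Linv_spec : D (Linv n0 n' I) /\
  (fun N => L2norm (fun x => Linv n0 n' I x - s N x)) @ \oo --> (0 : R).
Proof.
have [_ /(_ n' I n0n')[f Df fs]] := hb u.
exact: (@xgetPex _ (fun=> 0) [set f | D f /\ (fun N => L2norm (fun x => f x
    - \sum_(n0 <= n < N) b n0 l n n' * @psi R l n I x)) @ \oo --> (0 : R)]
    (ex_intro _ f (conj Df fs))).
Qed.

Lemma D_Linv : D (Linv n0 n' I). Proof. by have [] := Linv_spec. Qed.

Let Ls N : L2 (s N).
Proof. by apply: L2_sum => i _; apply: L2_Z; exact: L2psi. Qed.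

Lemma Linv_cspan : cspan psigens (Linv n0 n' I).
Proof.
split=> [|e e0]; first exact/D_L2/D_Linv.
have [_ /cvgrPdist_lt/(_ e e0)[N _ /(_ N (leqnn N))]] := Linv_spec.
rewrite sub0r normrN => h; exists (s N).
  by apply: fspan_sum => i _; apply: fspan_gen; exists l, i, I.
by apply: le_lt_trans h; exact: ler_norm.
Qed.

Lemma cvg_Linv h : L2 h ->
  (fun N => \sum_(n0 <= n < N) b n0 l n n' * ip (psi n I) h) @ \oo -->
  ip (Linv n0 n' I) h.
Proof.
move=> Lh; have c := cvg_ipl Ls (D_L2 D_Linv) Lh Linv_spec.2.
rewrite (_ : (fun N => _) = fun N => ip (s N) h)//.
apply/funext => N; rewrite /s ip_suml//.
  by apply: eq_bigr => k _; rewrite ipZl//; exact: L2psi.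
by move=> i _; apply: L2_Z; exact: L2psi.
Qed.

(** Orthogonality in n makes the partial sums constant from N = m + 1 on. *)
Lemma ip_Linv m J : ip (Linv n0 n' I) (psi m J) =
  (n0 <= m)%:R * b n0 l m n' * psiM R I J.
Proof.
apply: (cvgn_unique (cvg_Linv (L2psi m J))); apply: cvg_near_cst.
exists m.+1 => // N /= mN.
under eq_bigr do rewrite ippsi.
have [n0m|mn0] := leqP n0 m; last first.
  rewrite mul0r mul0r big_nat_cond big1// => i /andP[/andP[h _] _].
  by rewrite (_ : (i == m) = false) ?mul0r ?mulr0//; lia.
rewrite mul1r (bigD1_seq m) ?iota_uniq ?mem_index_iota ?n0m//= eqxx mul1r.
by rewrite big1 ?addr0// => i /negPf im; rewrite im mul0r mulr0.
Qed.

Lemma ip_Linv0 l' m (J : idx l') : l != l' ->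
  ip (Linv n0 n' I) (psi m J) = 0.
Proof.
move=> ll; apply: (cvgn_unique (cvg_Linv (L2psi m J))); apply: cvg_near_cst.
exists 0%N => // N _; rewrite big1// => i _.
by rewrite ippsi0// mulr0.
Qed.

Lemma cvg_ip_L_Linv m J :
  (fun N => (\sum_(n0 <= k < N) a l m k * b n0 l k n') * psiM R I J) @ \oo -->
  ip (L (Linv n0 n' I)) (psi m J).
Proof.
rewrite L_sym//; [|exact: D_Linv|exact: D_psi].
rewrite ipC; have c := @cvg_Lpsi _ m J _ (D_L2 D_Linv).
apply: cvg_trans c; apply: near_eq_cvg; exists n0 => // N /= nN.
rewrite -(big_mkord xpredT (fun k => a l k m * ip (psi k J) (Linv n0 n' I))).
rewrite (big_cat_nat (leq0n n0) nN)/= big_nat_cond big1 ?add0r.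
  rewrite mulr_suml; apply: eq_big_nat => k /andP[h _].
  by rewrite ipC ip_Linv h mul1r ha.1 mulrA.
by move=> k /andP[/andP[_ h] _]; rewrite ipC ip_Linv leqNgt h !mul0r mulr0.
Qed.

(** The inverse matrix controls only the rows m >= n0; the lower rows are the subject of
    [Linv_shape]. *)
Lemma ip_L_Linv m J : (n0 <= m)%N ->
  ip (L (Linv n0 n' I)) (psi m J) = (m == n')%:R * psiM R I J.
Proof.
move=> n0m; apply: (cvgn_unique (@cvg_ip_L_Linv m J)).
apply: cvgM; last exact: cvg_cst.
by have [/(_ m n' n0m n0n')[]] := hb u.
Qed.

Lemma ip_L_Linv0 l' m (J : idx l') : l != l' ->
  ip (L (Linv n0 n' I)) (psi m J) = 0.
Proof.
move=> ll; rewrite L_sym//; [|exact: D_Linv|exact: D_psi].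
rewrite ipC; apply: (cvgn_unique (@cvg_Lpsi _ m J _ (D_L2 D_Linv))).
apply: cvg_near_cst; exists 0%N => // N _; rewrite big1// => k _.
by rewrite ipC ip_Linv0// mulr0.
Qed.

End Column.

(** L maps column n' of the inverse started at n0 to psi^(n'), up to one further term in psi^(m0).
    Taking m0 = n0 forces c = 0, so the definition covers both the complete inverse and the case
    where the row m0 = n0 - 1 has been removed. One constant c serves all tensor indices. *)
Definition Linv_shape l n0 m0 := forall n', (n0 <= n')%N -> exists c : R,
  (c != 0 -> (m0 < n0)%N) /\ forall I : idx l,
    aeq (L (Linv n0 n' I)) (lin c (psi m0 I) (psi n' I)).

(** No value is prescribed for row m of the product, but its series converges: multiplied by the
    nonzero number [psiM R K K] it tends to a pairing. Dividing by that number gives a c independent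
    of I and J. *)
Lemma ip_L_Linv_low l n0 n' m : inverse_used l n0 -> (l <= 3)%N -> (n0 <= n')%N ->
  exists c : R, forall I J : idx l,
    ip (L (Linv n0 n' I)) (psi m J) = c * psiM R I J.
Proof.
move=> u l3 n0n'; have [K K0] := psiM_neq0 R l3.
pose c := ip (L (Linv n0 n' K)) (psi m K) / psiM R K K.
have cc : (fun N => \sum_(n0 <= k < N) a l m k * b n0 l k n') @ \oo --> c.
  have h := cvgM (@cvg_ip_L_Linv l n0 n' K u n0n' m K) (cvg_cst (psiM R K K)^-1).
  rewrite (_ : (fun N => _) = fun N : nat => (\sum_(n0 <= k < N) a l m k * b n0 l k n')
      * psiM R K K * (psiM R K K)^-1); first exact: h.
  by apply/funext => N; rewrite mulfK.
exists c => I J; apply: (cvgn_unique (@cvg_ip_L_Linv l n0 n' I u n0n' m J)).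
by apply: cvgM => //; exact: cvg_cst.
Qed.

(** Rows from n0 on come from the inverse matrix, and lower rows in [V0] give 0 because L kills
    them; at most the row m0 is left over. *)
Lemma Linv_shapeP l n0 m0 : inverse_used l n0 -> (l <= 3)%N ->
  (forall m (J : idx l), (m < n0)%N -> m != m0 -> V0 (@psi R l m J)) ->
  Linv_shape l n0 m0.
Proof.
move=> u l3 low n' n0n'.
have [c [c0 e]] : exists c : R, (c != 0 -> (m0 < n0)%N) /\
    forall (I J : idx l), (m0 < n0)%N ->
    ip (L (Linv n0 n' I)) (psi m0 J) = c * psiM R I J.
  have [c e] := ip_L_Linv_low m0 u l3 n0n'.
  have [h|h] := boolP (m0 < n0)%N; first by exists c; split.
  by exists 0; split; [rewrite eqxx|].
exists c; split=> // I.
have DI := D_Linv I u n0n'.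
apply: L_eq_of_psi => //.
- by apply: D_lin; exact: D_psi.
- exact: Linv_cspan.
- apply: fspan_cspan; first exact: psigens_L2.
  by apply: fspan_lin; apply: fspan_gen; exists l; [exists m0|exists n']; exists I.
move=> l' m J; rewrite ip_linl; [|exact: L2psi..].
have [ll|ll] := eqVneq l l'; last by rewrite ip_L_Linv0// !ippsi0// mulr0 addr0.
case: _ / ll J => J; rewrite !ippsi.
have [n0m|mn0] := leqP n0 m.
  rewrite ip_L_Linv// (eq_sym m).
  have [->|cn0] := eqVneq c 0; first by rewrite mul0r add0r.
  rewrite (_ : (m0 == m) = false) ?mul0r ?mulr0 ?add0r//.
  by have := c0 cn0; lia.
rewrite (_ : (n' == m) = false) ?mul0r ?addr0; last by lia.
have [mm|mm] := eqVneq m0 m.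
  by rewrite mul1r -mm e// mm.
rewrite mul0r mulr0 L_sym//; last exact: D_psi.
rewrite ipC L_V0//; apply: low => //; by rewrite eq_sym.
Qed.

(** Inherited from the symmetry of L: for columns f_n and f_m, <L f_n, f_m> is b_(nm) times a fixed
    nonzero number, since an extra term psi^(m0) has m0 < n0 and hence pairs to 0 with f_m. *)
Lemma inverse_sym l n0 m0 : inverse_used l n0 -> (l <= 3)%N -> Linv_shape l n0 m0 ->
  forall n m, (n0 <= n)%N -> (n0 <= m)%N -> b n0 l n m = b n0 l m n.
Proof.
move=> u l3 sh n m hn hm; have [K K0] := psiM_neq0 R l3.
have e i j : (n0 <= i)%N -> (n0 <= j)%N ->
    ip (L (Linv n0 i K)) (Linv n0 j K) = b n0 l i j * psiM R K K.
  move=> hi hj; have [c [c0 h]] := sh i hi.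
  have Dj := D_Linv K u hj; have Di := D_Linv K u hi.
  rewrite (aeq_ip (h K)); [|exact/D_L2/D_L|apply: L2_lin; exact: L2psi|exact: D_L2].
  rewrite ip_linl; [|exact: L2psi|exact: L2psi|exact: D_L2].
  rewrite !(ipC _ (Linv n0 j K)) !ip_Linv// hi mul1r.
  have [->|/c0 h0] := eqVneq c 0; first by rewrite mul0r add0r.
  by rewrite (leqNgt n0) h0 !mul0r mulr0 add0r.
have := e n m hn hm; rewrite L_sym; [|exact: D_Linv..].
by rewrite ipC e// => /(mulIf K0).
Qed.

Lemma V0psi00 I : V0 (@psi R 0 0 I).
Proof. by apply: fspan_gen; left; left; exists I. Qed.

Lemma V0psi01 I : V0 (@psi R 0 1 I).
Proof. by apply: fspan_gen; left; right; exists I. Qed.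

Lemma V0psi10 I : V0 (@psi R 1 0 I).
Proof. by apply: fspan_gen; right; exists I. Qed.

Lemma shape11 : Linv_shape 1 1 1.
Proof. by apply: Linv_shapeP => // -[|m]// J _ _; exact: V0psi10. Qed.

Lemma shape20 : Linv_shape 2 0 0.
Proof. by apply: Linv_shapeP. Qed.

Lemma shape02 : Linv_shape 0 2 2.
Proof.
by apply: Linv_shapeP => // -[|[|m]]// J _ _; [exact: V0psi00|exact: V0psi01].
Qed.

Lemma shape30 : Linv_shape 3 0 0.
Proof. by apply: Linv_shapeP. Qed.

Lemma shape12 : Linv_shape 1 2 1.
Proof. by apply: Linv_shapeP => // -[|[|m]]// J _ _; exact: V0psi10. Qed.

Lemma shape21 : Linv_shape 2 1 0.
Proof. by apply: Linv_shapeP => // -[|m]. Qed.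

Lemma L_Linv_full l n0 n' (I : idx l) : Linv_shape l n0 n0 ->
  (n0 <= n')%N -> aeq (L (Linv n0 n' I)) (psi n' I).
Proof.
move=> sh /sh[c [c0 /(_ I)]].
have -> : c = 0 by apply/eqP/negPn/negP => /c0; rewrite ltnn.
by congr aeq; apply/funext => x; rewrite /lin mul0r add0r.
Qed.

(* The coefficient of [psi m0] is found by pairing with the column [m0] of the
   inverse matrix starting at [m0]. *)
Lemma L_Linv_low l m0 n' (I : idx l) : inverse_used l m0 ->
  inverse_used l m0.+1 -> (l <= 3)%N ->
  Linv_shape l m0 m0 -> Linv_shape l m0.+1 m0 -> b m0 l m0 m0 != 0 -> (m0 < n')%N ->
  aeq (L (Linv m0.+1 n' I))
      (fun x => psi n' I x - b m0 l m0 n' / b m0 l m0 m0 * psi m0 I x).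
Proof.
move=> u0 u1 l3 sh0 sh1 b0 mn; have [c [_ h]] := sh1 _ mn.
have [K K0] := psiM_neq0 R l3.
have D0 := D_Linv K u0 (leqnn m0); have D1 := D_Linv K u1 mn.
(* Symmetry of L between the column n' of the shorter inverse and the column m0 of the longer one:
   the other side is the coefficient of psi^(m0) in the shorter column, which is 0. *)
have e : c * b m0 l m0 m0 + b m0 l n' m0 = 0.
  apply: (mulIf K0); rewrite mul0r mulrDl.
  have := L_sym D1 D0.
  rewrite (aeq_ip (h K)); [|exact/D_L2/D_L|apply: L2_lin; exact: L2psi|exact: D_L2].
  rewrite ip_linl; [|exact: L2psi|exact: L2psi|exact: D_L2].
  rewrite (ipC (psi m0 K)) (ipC (psi n' K)).
  rewrite (ip_Linv K u0 (leqnn m0) m0 K) (ip_Linv K u0 (leqnn m0) n' K).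
  rewrite leqnn (ltnW mn) !mul1r.
  rewrite mulrA => ->.
  rewrite ipC (aeq_ip (L_Linv_full K sh0 (leqnn m0))); [|exact/D_L2/D_L|exact: L2psi|exact: D_L2].
  by rewrite ipC ip_Linv// ltnn !mul0r.
have -> : b m0 l m0 n' = b m0 l n' m0.
  by apply: (inverse_sym u0 l3 sh0) => //; exact: ltnW.
have -> : b m0 l n' m0 = - c * b m0 l m0 m0.
  by apply/eqP; rewrite mulNr -addr_eq0 addrC e.
by have := h I; congr aeq; apply/funext => x; rewrite /lin mulfK// addrC mulNr opprK.
Qed.

(** * Weighted sources and the coefficients gamma and d *)

Hypotheses (hgamma : gamma_converge b) (hden : denominators_nonzero b).

(** These are the factors multiplying the entries of b in [term_0] to [term_3]. As functions of k
    they describe the coefficients of the phi functions and of their products with xi_i. *)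
Definition w0 k : R :=
  (sqrtn R (2 * k + 3) * beta1 b k - sqrtn R (2 * k) * beta1 b k.-1) / beta1 b 1.
Definition wt1 k : R := beta1 b k / beta1 b 1.
Definition ws1 k : R :=
  (sqrtn R (2 * k + 5) * beta2 b k - sqrtn R (2 * k) * beta2 b k.-1) / beta2 b 0.
Definition wt2 k : R := beta2 b k / beta2 b 0.
Definition ws2 k : R :=
  (sqrtn R (2 * k + 5) * beta1 b k - sqrtn R (2 * (k + 1)) * beta1 b k.+1) / beta1 b 1.
Definition w3 k : R :=
  (sqrtn R (2 * k + 7) * beta2 b k - sqrtn R (2 * (k + 1)) * beta2 b k.+1) / beta2 b 0.

(* The right-hand sides h for which [u = L^-1 h] turns out to have no
   component in V^(r). *)
Record weighted h : Prop := {
  weighted0 : forall I : idx 0, exists c, forall k, (2 <= k)%N ->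
    ip h (psi k I) = c * w0 k ;
  weighted1 : forall I : idx 1, exists c d, forall k, (2 <= k)%N ->
    ip h (psi k I) = c * wt1 k + d * ws1 k ;
  weighted2 : forall I : idx 2, exists c d, forall k, (1 <= k)%N ->
    ip h (psi k I) = c * wt2 k + d * ws2 k ;
  weighted3 : forall I : idx 3, exists c, forall k,
    ip h (psi k I) = c * w3 k ;
  weighted4 : forall l k (I : idx l), (4 <= l)%N ->
    ip h (psi k I) = 0 }.

Lemma weighted_lin c f g : D f -> D g -> weighted f -> weighted g ->
  weighted (lin c f g).
Proof.
move=> /D_L2 Lf /D_L2 Lg [f0 f1 f2 f3 f4] [g0 g1 g2 g3 g4].
have e l k (I : idx l) :
    ip (lin c f g) (psi k I) = c * ip f (psi k I) + ip g (psi k I).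
  by rewrite ip_linl//; exact: L2psi.
split=> [I|I|I|I|l k I l4].
- have [[u uE] [v vE]] := (f0 I, g0 I); exists (c * u + v) => k hk.
  by rewrite e uE// vE//; ring.
- have [[u [u' uE]] [v [v' vE]]] := (f1 I, g1 I).
  exists (c * u + v), (c * u' + v') => k hk.
  by rewrite e uE// vE//; ring.
- have [[u [u' uE]] [v [v' vE]]] := (f2 I, g2 I).
  exists (c * u + v), (c * u' + v') => k hk.
  by rewrite e uE// vE//; ring.
- have [[u uE] [v vE]] := (f3 I, g3 I); exists (c * u + v) => k.
  by rewrite e uE// vE//; ring.
- by rewrite e f4// g4// mulr0 addr0.
Qed.

Lemma weighted_aeq f g : L2 f -> L2 g -> aeq f g -> weighted f -> weighted g.
Proof.
move=> Lf Lg fg [f0 f1 f2 f3 f4].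
have e l k (I : idx l) : ip g (psi k I) = ip f (psi k I).
  by apply/esym; apply: aeq_ip => //; exact: L2psi.
split=> [I|I|I|I|l k I l4].
- by have [c h] := f0 I; exists c => k hk; rewrite e h.
- by have [c [d h]] := f1 I; exists c, d => k hk; rewrite e h.
- by have [c [d h]] := f2 I; exists c, d => k hk; rewrite e h.
- by have [c h] := f3 I; exists c => k; rewrite e h.
- by rewrite e f4.
Qed.

Lemma weighted_0 : weighted (fun=> 0).
Proof.
split=> [I|I|I|I|l k I _]; last by rewrite ip0l.
- by exists 0 => k _; rewrite ip0l mul0r.
- by exists 0, 0 => k _; rewrite ip0l !mul0r addr0.
- by exists 0, 0 => k _; rewrite ip0l !mul0r addr0.
- by exists 0 => k; rewrite ip0l mul0r.
Qed.

(** Pairing with a column of the inverse sums the weights against its entries; symmetry of b makes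
    the sum run along row n, as it does in the gamma coefficients. *)
Lemma ip_Linv_weighted l n0 m0 n I h (x y : nat -> R) (c d : R) :
  inverse_used l n0 -> (l <= 3)%N -> Linv_shape l n0 m0 -> (n0 <= n)%N -> L2 h ->
  (forall k, (n0 <= k)%N -> ip h (@psi R l k I) = c * x k + d * y k) ->
  cvg_from n0 (fun k => b n0 l n k * x k) -> cvg_from n0 (fun k => b n0 l n k * y k) ->
  ip h (Linv n0 n I) = c * sum_from n0 (fun k => b n0 l n k * x k)
    + d * sum_from n0 (fun k => b n0 l n k * y k).
Proof.
move=> u l3 sh hn Lh hE cx cy; rewrite ipC.
apply: (cvgn_unique (@cvg_Linv l n0 n I u hn h Lh)).
have s := inverse_sym u l3 sh.
rewrite (_ : (fun N => _) = fun N : nat =>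
  c * (\sum_(n0 <= k < N) b n0 l n k * x k) + d * (\sum_(n0 <= k < N) b n0 l n k * y k)).
  by apply: cvgD; apply: cvgM => //; exact: cvg_cst.
apply/funext => N; rewrite !mulr_sumr -big_split/=; apply: eq_big_nat => k /andP[hk _].
by rewrite s// ipC hE//; ring.
Qed.

Lemma L_lin_aeq c f g f' g' : D f -> D g -> aeq (L f) f' -> aeq (L g) g' ->
  aeq (L (lin c f g)) (lin c f' g').
Proof.
move=> Df Dg ff gg; apply: aeq_trans (co_linear hL c (D_dom Df) (D_dom Dg)) _.
exact: aeqD (aeqZ c ff) gg.
Qed.

Lemma V0_ip f v : L2 f -> (forall u, V0gens u -> ip f u = 0) -> V0 v -> ip f v = 0.
Proof. by move=> Lf f0; apply: fspan_ip f0 _; [exact: V0gens_L2|]. Qed.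

(** Every start n0 in use lies above the indices of the functions of the same rank in [V0]. *)
Lemma Linv_V0 l n0 n (I : idx l) v : inverse_used l n0 ->
  (n0 <= n)%N -> V0 v -> ip (Linv n0 n I) v = 0.
Proof.
move=> u hn; have DI := D_Linv I u hn.
apply: V0_ip; first exact: D_L2.
move=> w [[[J ->]|[J ->]]|[J ->]].
- have [l0|l0] := eqVneq l 0%N; last by rewrite ip_Linv0.
  move: I DI; rewrite l0 => I DI; rewrite l0 in u; rewrite ip_Linv//.
  by clear DI hn; case: (n0) u => [|[|[|k]]]// _; rewrite !mul0r.
- have [l0|l0] := eqVneq l 0%N; last by rewrite ip_Linv0.
  move: I DI; rewrite l0 => I DI; rewrite l0 in u; rewrite ip_Linv//.
  by clear DI hn; case: (n0) u => [|[|[|k]]]// _; rewrite !mul0r.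
- have [l1|l1] := eqVneq l 1%N; last by rewrite ip_Linv0.
  move: I DI; rewrite l1 => I DI; rewrite l1 in u; rewrite ip_Linv//.
  by clear DI hn; case: (n0) u => [|[|[|k]]]// _; rewrite !mul0r.
Qed.

Lemma ip_elim1 h f2 f (c g2 g : R) : L2 h -> L2 f2 -> L2 f -> g2 != 0 ->
  ip h f2 = c * g2 -> ip h f = c * g -> ip h (lin (- (g / g2)) f2 f) = 0.
Proof.
by move=> Lh L2f Lf g0 e2 e; rewrite ipC ip_linl// !(ipC _ h) e2 e; field.
Qed.

(* Cramer's rule *)
Lemma ip_elim2 h f2 f3 f (c d t2 t3 t s2 s3 s : R) :
  L2 h -> L2 f2 -> L2 f3 -> L2 f -> s3 * t2 - s2 * t3 != 0 ->
  ip h f2 = c * t2 + d * s2 -> ip h f3 = c * t3 + d * s3 ->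
  ip h f = c * t + d * s ->
  ip h (lin (- ((s * t2 - t * s2) / (s3 * t2 - s2 * t3))) f3
       (lin (- ((t * s3 - s * t3) / (s3 * t2 - s2 * t3))) f2 f)) = 0.
Proof.
move=> Lh L2f L3 Lf g0 e2 e3 e; rewrite ipC ip_linl//; last exact: L2_lin.
by rewrite ip_linl// !(ipC _ h) e2 e3 e; field.
Qed.

Lemma beta1_neq0 : beta1 b 1 != 0. Proof. by case: hden. Qed.
Lemma beta2_neq0 : beta2 b 0 != 0. Proof. by case: hden. Qed.

(** With row 1 dropped, column n is a preimage of psihat^n instead of psi^n, so sums against b^(2)_1
    are pairings with L^-1 psihat^n. [L_psihat2] is the same with row 0 dropped. *)
Lemma L_psihat1 n I : (2 <= n)%N -> aeq (L (Linv 2 n I)) (psihat1 b n I).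
Proof.
by move=> hn; apply: (L_Linv_low I _ _ _ shape11 shape12 beta1_neq0 hn).
Qed.

Lemma L_psihat2 n I : (1 <= n)%N -> aeq (L (Linv 1 n I)) (psihat2 b n I).
Proof.
by move=> hn; apply: (L_Linv_low I _ _ _ shape20 shape21 beta2_neq0 hn).
Qed.

(** The d coefficients solve the one or two linear equations that cancel the gamma families of a
    given rank. Combining columns of the inverse with these coefficients gives t, at once a preimage
    of g and orthogonal to the source h. *)
Lemma weighted_S3low h g : D h -> weighted h -> S3low g ->
  exists t, [/\ D t, aeq (L t) g, ip h t = 0 & forall v, V0 v -> ip t v = 0].
Proof.
move=> Dh [h0 h1 h2 h3 _]; have Lh := D_L2 Dh.
have lin0 c f k v : D f -> D k -> (forall v, V0 v -> ip f v = 0) ->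
    (forall v, V0 v -> ip k v = 0) -> V0 v -> ip (lin c f k) v = 0.
  move=> Df Dk f0 k0 Vv; rewrite ip_linl ?f0 ?k0 ?mulr0 ?addr0//; try exact: D_L2.
  exact: V0_L2.
have [c0 c1 c2 c3] := hgamma; have [_ _ g0 g3 [e1 e2]] := hden.
(* Ranks 0 and 3 have a single weight; the second sequence in [ip_Linv_weighted] is then taken to be
   0. *)
have z n0 l n : cvg_from n0 (fun k => b n0 l n k * 0).
  rewrite /cvg_from (_ : (fun N => _) = fun=> 0); first exact: is_cvg_cst.
  by apply/funext => N; rewrite big1// => k _; rewrite mulr0.
move=> [[[[n [I [hn ->]]]|[n [I [hn ->]]]]|[n [I [hn ->]]]]|[n [I [hn ->]]]].
- have D1 m : (2 <= m)%N -> D (Linv 2 m I) by exact: D_Linv.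
  have [c hc] := h0 I.
  have e m : (2 <= m)%N -> ip h (Linv 2 m I) = c * gamma_0 b m.
    move=> hm; have := @ip_Linv_weighted 0 2 2 m I h w0 (fun=> 0) c 0 isT isT shape02 hm Lh.
    move=> ->; [by rewrite mul0r addr0|by move=> k hk; rewrite mulr0 addr0 hc| |exact: z].
    exact: c0.
  exists (lin (- d02 b n) (Linv 2 2 I) (Linv 2 n I)); split.
  + by apply: D_lin; apply: D1 => //; lia.
  + rewrite -linB; apply: L_lin_aeq; try (by apply: D1; lia).
      exact: L_Linv_full shape02 _.
    by apply: L_Linv_full shape02 _; lia.
  + have n2 : (2 <= n)%N by lia.
    by apply: ip_elim1 (e 2%N isT) (e n n2) => //; exact/D_L2/D1.
  + move=> v; apply: (lin0) => [||v'|v']; [exact: D1|by apply: D1; lia|exact: Linv_V0|].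
    by apply: Linv_V0 => //; lia.
- have D1 m : (2 <= m)%N -> D (Linv 2 m I) by exact: D_Linv.
  have [c [d hc]] := h1 I.
  have e m : (2 <= m)%N -> ip h (Linv 2 m I) = c * gamma_t1 b m + d * gamma_s1 b m.
    move=> hm; have := @ip_Linv_weighted 1 2 1 m I h wt1 ws1 c d isT isT shape12 hm Lh.
    by apply; [exact: hc|exact: (c1 m hm).1|exact: (c1 m hm).2].
  exists (lin (- d13 b n) (Linv 2 3 I) (lin (- d12 b n) (Linv 2 2 I) (Linv 2 n I))).
  have n2 : (2 <= n)%N by lia.
  split.
  + by do 2 (apply: D_lin; first exact: D1); exact: D1.
  + rewrite -[X in aeq _ X]/(fun x => (fun x => psihat1 b n I x - d12 b n * psihat1 b 2 I x) x
     - d13 b n * psihat1 b 3 I x) -linB -linB.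
    apply: L_lin_aeq; [exact: D1|apply: D_lin; exact: D1|exact: L_psihat1|].
    by apply: L_lin_aeq; [exact: D1|exact: D1|exact: L_psihat1|exact: L_psihat1].
  + have L1 m : (2 <= m)%N -> L2 (Linv 2 m I) by move/D1/D_L2.
    by apply: ip_elim2 (e 2%N isT) (e 3%N isT) (e n n2) => //; exact: L1.
  + move=> v; apply: (lin0) => [||v'|v']; [exact: D1|by apply: D_lin; exact: D1|exact: Linv_V0|].
    by apply: lin0 => [||v''|v'']; [exact: D1|exact: D1|exact: Linv_V0|exact: Linv_V0].
- have D1 m : (1 <= m)%N -> D (Linv 1 m I) by exact: D_Linv.
  have [c [d hc]] := h2 I.
  (* The factor 5/2 undoes the prefactor 2/5 of [gamma_s2]; in rank 3 below, 7/3 does the same for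
     [gamma_3]. *)
  have e m : (1 <= m)%N ->
      ip h (Linv 1 m I) = c * gamma_t2 b m + d * (5 / 2) * gamma_s2 b m.
    move=> hm; have := @ip_Linv_weighted 2 1 0 m I h wt2 ws2 c d isT isT shape21 hm Lh.
    move=> ->; [|exact: hc|exact: (c2 m hm).1|exact: (c2 m hm).2].
    congr (_ + _); rewrite /gamma_s2 mulrA; congr (_ * _); by field.
  exists (lin (- d22 b n) (Linv 1 2 I) (lin (- d21 b n) (Linv 1 1 I) (Linv 1 n I))).
  have n2 : (1 <= n)%N by lia.
  split.
  + by do 2 (apply: D_lin; first exact: D1); exact: D1.
  + rewrite -[X in aeq _ X]/(fun x => (fun x => psihat2 b n I x - d21 b n * psihat2 b 1 I x) x
     - d22 b n * psihat2 b 2 I x) -linB -linB.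
    apply: L_lin_aeq; [exact: D1|apply: D_lin; exact: D1|exact: L_psihat2|].
    by apply: L_lin_aeq; [exact: D1|exact: D1|exact: L_psihat2|exact: L_psihat2].
  + have L1 m : (1 <= m)%N -> L2 (Linv 1 m I) by move/D1/D_L2.
    by apply: ip_elim2 (e 1%N isT) (e 2%N isT) (e n n2) => //; exact: L1.
  + move=> v; apply: (lin0) => [||v'|v']; [exact: D1|by apply: D_lin; exact: D1|exact: Linv_V0|].
    by apply: lin0 => [||v''|v'']; [exact: D1|exact: D1|exact: Linv_V0|exact: Linv_V0].
- have D1 m : D (Linv 0 m I) by exact: D_Linv.
  have [c hc] := h3 I.
  have e m : ip h (Linv 0 m I) = c * (7 / 3) * gamma_3 b m.
    have := @ip_Linv_weighted 3 0 0 m I h w3 (fun=> 0) c 0 isT isT shape30 (leq0n m) Lh.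
    move=> ->; [|by move=> k hk; rewrite mulr0 addr0 hc|exact: c3|exact: z].
    rewrite mul0r addr0 /gamma_3 mulrA; congr (_ * _); by field.
  exists (lin (- d30 b n) (Linv 0 0 I) (Linv 0 n I)); split.
  + by apply: D_lin; exact: D1.
  + by rewrite -linB; apply: L_lin_aeq => //; exact: L_Linv_full shape30 _.
  + by apply: ip_elim1 (e 0%N) (e n) => //; exact/D_L2/D1.
  + by move=> v; apply: (lin0) => [||v'|v']; [exact: D1|exact: D1|exact: Linv_V0|exact: Linv_V0].
Qed.

(** * The functions phi and their products with the velocity components *)

Lemma ip_mulxi_psi l i (I : idx l) :
  exists (C1 : tensor R l.+1) (C2 : tensor R l.-1),
  (l = 0%N -> forall J, C2 J = 0) /\ forall f n, D f ->
  ip (mulxi i f) (psi n I) =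
    \sum_J C1 J * (sqrtn R (2 * n + (2 * l + 3)) * ip f (psi n J) -
                   sqrtn R (2 * n) * ip f (psi n.-1 J)) +
    \sum_J C2 J * (sqrtn R (2 * n + (2 * l + 1)) * ip f (psi n J) -
                   sqrtn R (2 * (n + 1)) * ip f (psi n.+1 J)).
Proof.
have [C1 [C2 [C20 e]]] := mulxi_psi R i I; exists C1, C2; split=> // f n Df.
have Lf := D_L2 Df.
have Lt l' (C : tensor R l') (x y : R) m m' J :
    L2 (fun z => C J * (x * @psi R l' m J z - y * @psi R l' m' J z)).
  by apply/L2_Z/L2_B; apply: L2_Z; exact: L2psi.
have es l' (C : tensor R l') (x y : R) m m' :
    ip f (fun z => \sum_J C J * (x * @psi R l' m J z - y * @psi R l' m' J z)) =
    \sum_J C J * (x * ip f (psi m J) - y * ip f (psi m' J)).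
  rewrite ip_sumr//; apply: eq_bigr => J _.
  have Lz (k : R) k' : L2 (fun z => k * @psi R l' k' J z) by apply: L2_Z; exact: L2psi.
  rewrite ipZr ?ipBr ?ipZr//; try exact: L2psi; exact: L2_B.
rewrite ip_mulxi ipC (aeq_ip (e n))//; last 2 first.
- exact/D_L2/D_mulxi/D_psi.
- by apply: L2_D; apply: L2_sum.
by rewrite ipDl//; [rewrite !(ipC _ f) !es|apply: L2_sum..].
Qed.

(** f has rank r only, and from index k0 on its coefficients are [be k] times a tensor independent
    of k. In rank r nothing is claimed below k0. *)
Definition profile r k0 (be : nat -> R) f := forall l, exists M : tensor R l,
  (l != r -> forall J, M J = 0) /\
  forall k J, ((k0 <= k)%N || (l != r)) -> ip f (psi k J) = be k * M J.

(** Only ranks r - 1 and r + 1 can appear. The value at [n.-1] enters through rank l + 1 = r alone,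
    whence the side condition on [n.-1]. *)
Lemma ip_mulxi_profile r k0 be f i l (I : idx l) :
  D f -> profile r k0 be f -> exists c d,
  [/\ l.+1 != r -> c = 0, (l == 0%N) || (l.-1 != r) -> d = 0 &
   forall n, (k0 <= n)%N -> ((k0 <= n.-1)%N || (l.+1 != r)) ->
   ip (mulxi i f) (psi n I) =
     c * (sqrtn R (2 * n + (2 * l + 3)) * be n - sqrtn R (2 * n) * be n.-1) +
     d * (sqrtn R (2 * n + (2 * l + 1)) * be n - sqrtn R (2 * (n + 1)) * be n.+1)].
Proof.
move=> Df pf; have [C1 [C2 [C20 e]]] := ip_mulxi_psi i I.
have [[M1 [M10 h1]] [M2 [M20 h2]]] := (pf l.+1, pf l.-1).
exists (\sum_J C1 J * M1 J), (\sum_J C2 J * M2 J); split.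
- by move=> lr; rewrite big1// => J _; rewrite M10// mulr0.
- move=> /orP[/eqP l0|lr]; rewrite big1// => J _; first by rewrite C20// mul0r.
  by rewrite M20// mulr0.
move=> n kn kn1; rewrite e//; congr (_ + _).
  rewrite mulr_suml; apply: eq_bigr => J _.
  by rewrite !h1// ?kn//; ring.
rewrite mulr_suml; apply: eq_bigr => J _.
by rewrite !h2 ?kn// ?(leq_trans kn)//; ring.
Qed.

Definition phi1 (I : idx 1) : vfun R := Linv 1 1 I.
Definition phi2 (I : idx 2) : vfun R := Linv 0 0 I.

Lemma D_phi1 I : D (phi1 I). Proof. exact: D_Linv. Qed.
Lemma D_phi2 I : D (phi2 I). Proof. exact: D_Linv. Qed.

Lemma L_phi1 I : aeq (L (phi1 I)) (psi 1 I).
Proof. exact: L_Linv_full shape11 _. Qed.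

Lemma L_phi2 I : aeq (L (phi2 I)) (psi 0 I).
Proof. exact: L_Linv_full shape20 _. Qed.

Lemma profile_phi1 I : profile 1 1 (beta1 b) (phi1 I).
Proof.
move=> l; have [->|l1] := eqVneq l 1%N.
  exists (psiM R I); split=> // k J; rewrite orbF => hk.
  rewrite /phi1 ip_Linv// hk mul1r; congr (_ * _).
  by apply: (inverse_sym _ _ shape11).
by exists (fun=> 0); split=> // k J _; rewrite mulr0 ip_Linv0// eq_sym.
Qed.

Lemma profile_phi2 I : profile 2 0 (beta2 b) (phi2 I).
Proof.
move=> l; have [->|l1] := eqVneq l 2%N.
  exists (psiM R I); split=> // k J _.
  rewrite /phi2 ip_Linv// mul1r; congr (_ * _).
  by apply: (inverse_sym _ _ shape20).
by exists (fun=> 0); split=> // k J _; rewrite mulr0 ip_Linv0// eq_sym.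
Qed.


Lemma weighted_phi1 I : weighted (phi1 I).
Proof.
have n1 := beta1_neq0.
have p := profile_phi1 I.
split=> [J|J|J|J|l k J l4].
- have [M [M0 h]] := p 0%N; exists 0 => k _.
  by rewrite h ?orbT// M0// mulr0 mul0r.
- have [M [M0 h]] := p 1%N; exists (beta1 b 1 * M J), 0 => k hk.
  by rewrite h /wt1 ?(ltnW hk)//; field.
- have [M [M0 h]] := p 2%N; exists 0, 0 => k _.
  by rewrite h ?orbT// M0// mulr0 !mul0r addr0.
- have [M [M0 h]] := p 3%N; exists 0 => k.
  by rewrite h ?orbT// M0// mulr0 mul0r.
- have [M [M0 h]] := p l; have l1 : l != 1%N by lia.
  by rewrite h ?l1 ?orbT// M0// mulr0.
Qed.

Lemma weighted_phi2 I : weighted (phi2 I).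
Proof.
have n2 := beta2_neq0.
have p := profile_phi2 I.
split=> [J|J|J|J|l k J l4].
- have [M [M0 h]] := p 0%N; exists 0 => k _.
  by rewrite h ?orbT// M0// mulr0 mul0r.
- have [M [M0 h]] := p 1%N; exists 0, 0 => k hk.
  by rewrite h ?orbT// M0// mulr0 !mul0r addr0.
- have [M [M0 h]] := p 2%N; exists (beta2 b 0 * M J), 0 => k _.
  by rewrite h// /wt2; field.
- have [M [M0 h]] := p 3%N; exists 0 => k.
  by rewrite h ?orbT// M0// mulr0 mul0r.
- have [M [M0 h]] := p l; have l1 : l != 2%N by lia.
  by rewrite h ?l1 ?orbT// M0// mulr0.
Qed.

(** Rank 0 produces the weight [w0] and rank 2 the weight [ws2]. In rank 0 the recurrence reaches
    back to k - 1, which must be at least 1, and this agrees with the range k >= 2. *)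
Lemma weighted_mulxi_phi1 i I : weighted (mulxi i (phi1 I)).
Proof.
have n1 := beta1_neq0.
have p l J := @ip_mulxi_profile _ _ _ _ i l J (D_phi1 I) (profile_phi1 I).
split=> [J|J|J|J|l k J l4].
- have [c [d [_ d0 e]]] := p _ J; exists (c * beta1 b 1) => k hk.
  rewrite e ?d0//; [|by lia|by apply/orP; left; lia].
  by rewrite /w0; field.
- have [c [d [c0 d0 e]]] := p _ J; exists 0, 0 => k hk.
  by rewrite e ?orbT ?(ltnW hk)// c0// d0// !mul0r.
- have [c [d [c0 _ e]]] := p _ J; exists 0, (d * beta1 b 1) => k hk.
  by rewrite e ?orbT// c0// /ws2; field.
- have [c [d [c0 d0 e]]] := p _ J; exists 0 => k.
  (* The profile of [phi1] starts at 1, whereas rank 3 requires k = 0 too; the vanishing is read off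
     directly, the neighbouring ranks being 2 and 4. *)
  have [C1 [C2 [_ h]]] := ip_mulxi_psi i J; rewrite h; last exact: D_phi1.
  rewrite mul0r !big1 ?addr0// => K _; by rewrite /phi1 !ip_Linv0// !mulr0 subrr mulr0.
- have [C1 [C2 [_ h]]] := ip_mulxi_psi i J; rewrite h; last exact: D_phi1.
  rewrite !big1 ?addr0// => K _;
    by rewrite /phi1 !ip_Linv0//; [rewrite !mulr0 subrr mulr0|lia..].
Qed.

(** Rank 1 produces the weight [ws1] and rank 3 the weight [w3]. *)
Lemma weighted_mulxi_phi2 i I : weighted (mulxi i (phi2 I)).
Proof.
have n2 := beta2_neq0.
have p l J := @ip_mulxi_profile _ _ _ _ i l J (D_phi2 I) (profile_phi2 I).
split=> [J|J|J|J|l k J l4].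
- have [c [d [c0 d0 e]]] := p _ J; exists 0 => k hk.
  by rewrite e// c0// d0// !mul0r addr0.
- have [c [d [_ d0 e]]] := p _ J; exists 0, (c * beta2 b 0) => k hk.
  by rewrite e// d0// /ws1; field.
- have [c [d [c0 d0 e]]] := p _ J; exists 0, 0 => k hk.
  by rewrite e// c0// d0// !mul0r.
- have [c [d [c0 _ e]]] := p _ J; exists (d * beta2 b 0) => k.
  by rewrite e// c0// /w3; field.
- have [c [d [c0 d0 e]]] := p _ J; rewrite e// c0 ?d0 ?mul0r ?addr0//; last by lia.
  by apply/orP; right; lia.
Qed.

(* Contains the products of the xi_i with V^(0), and is contained in
   V^(0) + L(span of the phi's). *)
Definition xiV0gens : set (vfun R) := V0gens
  `|` [set f | exists I, f = @psi R 1 1 I] `|` [set f | exists I, f = @psi R 2 0 I].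

Lemma xiV0gens_D g : xiV0gens g -> D g.
Proof. by move=> [[/V0gens_D//|[I ->]]|[I ->]]; exact: D_psi. Qed.

Lemma xiV0_D g : fspan xiV0gens g -> D g.
Proof.
apply: fspan_sub => [|c u v|h]; [exact: D_0|exact: D_lin|exact: xiV0gens_D].
Qed.

(** The indices of these generators lie below every range occurring in [weighted], so all the
    pairings concerned are 0. *)
Lemma weighted_xiV0 g : fspan xiV0gens g -> weighted g.
Proof.
move=> sg; suff [] : D g /\ weighted g by [].
apply: (fspan_sub (E := fun g => D g /\ weighted g)) sg.
- by split; [exact: D_0|exact: weighted_0].
- move=> c u v [Du wu] [Dv wv]; split; first exact: D_lin.
  exact: weighted_lin.
move=> u Gu; split; first exact: xiV0gens_D.
have q l' k' (K : idx l') l k (I : idx l) : ~~ ((l' == l) && (k' == k)) ->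
    ip (@psi R l' k' K) (@psi R l k I) = 0.
  have [ll|ll] := eqVneq l' l; last by move=> _; rewrite ippsi0.
  by case: _ / ll I => I /= kk; rewrite ippsi_neq.
have z l k (I : idx l) :
   [|| (l == 0%N) && (2 <= k)%N, (l == 1%N) && (2 <= k)%N,
       (l == 2%N) && (1 <= k)%N | (3 <= l)%N] -> ip u (psi k I) = 0.
  by case: Gu => [[[[[J ->]|[J ->]]|[J ->]]|[J ->]]|[J ->]] h; apply: q; lia.
split=> [J|J|J|J|l k J l4].
- by exists 0 => k hk; rewrite z ?hk ?mul0r.
- by exists 0, 0 => k hk; rewrite z ?hk ?mul0r ?addr0.
- by exists 0, 0 => k hk; rewrite z ?hk ?mul0r ?addr0.
- by exists 0 => k; rewrite z ?mul0r.
- by rewrite z//; lia.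
Qed.

Lemma mulxi_V0 i (w : vfun R) : V0 w -> exists2 s, fspan xiV0gens s & aeq (mulxi i w) s.
Proof.
have g00 I : fspan xiV0gens (@psi R 0 0 I).
  by apply: fspan_gen; do 2 left; left; left; exists I.
have g01 I : fspan xiV0gens (@psi R 0 1 I).
  by apply: fspan_gen; do 2 left; left; right; exists I.
have g10 I : fspan xiV0gens (@psi R 1 0 I).
  by apply: fspan_gen; do 2 left; right; exists I.
have g11 I : fspan xiV0gens (@psi R 1 1 I).
  by apply: fspan_gen; left; right; exists I.
have g20 I : fspan xiV0gens (@psi R 2 0 I).
  by apply: fspan_gen; right; exists I.
have lc l (C : tensor R l) (x y : R) m m' :
    (forall J, fspan xiV0gens (@psi R l m J)) -> (forall J, fspan xiV0gens (@psi R l m' J)) ->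
    fspan xiV0gens (fun z => \sum_J C J * (x * @psi R l m J z - y * @psi R l m' J z)).
  move=> h h'; apply: fspan_sum => J _.
  rewrite -linB; apply: fspan_lin => //.
  have := fspan_lin x (h J) (fspan0 xiV0gens); congr (fspan _); apply/funext => z.
  by rewrite /lin addr0.
have addl u v : fspan xiV0gens u -> fspan xiV0gens v -> fspan xiV0gens (fun z => u z + v z).
  move=> su sv; have := fspan_lin 1 su sv; congr (fspan _); apply/funext => z.
  by rewrite /lin mul1r.
apply: (fspan_sub (G := V0gens)
    (E := fun w => exists2 s, fspan xiV0gens s & aeq (mulxi i w) s)).
- exists (fun=> 0); first exact: fspan0.
  by apply: aeW => x _; rewrite /mulxi mulr0.
- move=> c u v [s ss us] [t st vt]; exists (lin c s t); first exact: fspan_lin.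
  have := aeqD (aeqZ c us) vt; apply: aeq_trans; apply: aeW => x _.
  by rewrite /mulxi /lin; ring.
move=> g [[[I ->]|[I ->]]|[I ->]];
  have [C1 [C2 [C20 e]]] := mulxi_psi R i I; eexists; try exact: e; apply: addl.
- by apply: lc.
- rewrite (_ : (fun z => _) = fun=> 0); first exact: fspan0.
  by apply/funext => z; rewrite big1// => J _; rewrite C20// mul0r.
- by apply: lc.
- rewrite (_ : (fun z => _) = fun=> 0); first exact: fspan0.
  by apply/funext => z; rewrite big1// => J _; rewrite C20// mul0r.
- by apply: lc.
- by apply: lc.
Qed.

Definition Phigens : set (vfun R) :=
  [set f | exists I, f = phi1 I] `|` [set f | exists I, f = phi2 I].

Lemma Phigens_D g : Phigens g -> D g.
Proof. by move=> [[I ->]|[I ->]]; [exact: D_phi1|exact: D_phi2]. Qed.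

Lemma Phi_D f : fspan Phigens f -> D f.
Proof.
apply: fspan_sub => [|c u v|h]; [exact: D_0|exact: D_lin|exact: Phigens_D].
Qed.

Lemma weighted_Phi f : fspan Phigens f ->
  weighted f /\ forall i, weighted (mulxi i f).
Proof.
move=> sf; suff [] : D f /\ (weighted f /\ forall i, weighted (mulxi i f)) by [].
apply: (fspan_sub (E := fun f => D f /\ (weighted f /\ forall i, weighted (mulxi i f)))) sf.
- split; first exact: D_0; split=> [|i]; first exact: weighted_0.
  rewrite (_ : mulxi i _ = fun=> 0); first exact: weighted_0.
  by apply/funext => x; rewrite /mulxi mulr0.
- move=> c u v [Du [wu xu]] [Dv [wv xv]]; split; first exact: D_lin.
  split=> [|i]; first exact: weighted_lin.
  have -> : mulxi i (lin c u v) = lin c (mulxi i u) (mulxi i v).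
    by apply/funext => x; rewrite /mulxi /lin; ring.
  by apply: weighted_lin => //; exact: D_mulxi.
move=> u Gu; split; first exact: Phigens_D.
case: Gu => [[I ->]|[I ->]]; split=> *;
  [exact: weighted_phi1|exact: weighted_mulxi_phi1|exact: weighted_phi2|exact: weighted_mulxi_phi2].
Qed.

Lemma xiV0_L s : fspan xiV0gens s -> exists v f,
  [/\ V0 v, fspan Phigens f & aeq s (fun x => v x + L f x)].
Proof.
apply: (fspan_sub (E := fun s => exists v f,
  [/\ V0 v, fspan Phigens f & aeq s (fun x => v x + L f x)])).
- exists (fun=> 0), (fun=> 0); split; [exact: (V_0 B0)|exact: fspan0|].
  have Lz : aeq (L (fun=> 0)) (fun=> 0).
    by apply: L_null; rewrite ?ip0r//; exact: D_0.
  by apply: aeq_sym; apply: filterS Lz => x h _; rewrite h// addr0.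
- move=> c u t [v [f [Vv sf e]]] [v' [f' [Vv' sf' e']]].
  exists (lin c v v'), (lin c f f'); split; [exact: (@V_lin B0)|exact: fspan_lin|].
  have Df := Phi_D sf; have Df' := Phi_D sf'.
  apply: aeq_trans (aeqD (aeqZ c e) e') _.
  have := co_linear hL c (D_dom Df) (D_dom Df'); apply: filterS => x h _.
  by rewrite h// /lin; ring.
move=> g [[Gg|[I ->]]|[I ->]].
- exists g, (fun=> 0); split; [exact: fspan_gen|exact: fspan0|].
  have Lz : aeq (L (fun=> 0)) (fun=> 0).
    by apply: L_null; rewrite ?ip0r//; exact: D_0.
  by apply: filterS Lz => x h _; rewrite h// addr0.
- exists (fun=> 0), (phi1 I); split; [exact: (V_0 B0)|by apply: fspan_gen; left; exists I|].
  by apply: filterS (L_phi1 I) => x h _; rewrite h// add0r.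
- exists (fun=> 0), (phi2 I); split; [exact: (V_0 B0)|by apply: fspan_gen; right; exists I|].
  by apply: filterS (L_phi2 I) => x h _; rewrite h// add0r.
Qed.

Lemma cspan_gen (G : set (vfun R)) g : G `<=` @L2 R -> G g -> cspan G g.
Proof. by move=> GL Gg; apply: fspan_cspan => //; exact: fspan_gen. Qed.

Lemma S3low_S3 g : S3low g -> V b Br g.
Proof. by move=> h; apply: cspan_gen; [exact: S3gens_L2|left]. Qed.

Lemma S3high_S3 g : S3high g -> V b Br g.
Proof. by move=> h; apply: cspan_gen; [exact: S3gens_L2|right]. Qed.

Definition lowpsi : set (vfun R) :=
  [set f | exists l n I, (l <= 3)%N /\ f = @psi R l n I].

Lemma lowpsi_L2 : lowpsi `<=` @L2 R.
Proof. by move=> _ [l [n [I [_ ->]]]]; exact: L2psi. Qed.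

Lemma S3low_lowpsi g : S3low g -> fspan lowpsi g.
Proof.
have i l n (I : idx l) : (l <= 3)%N -> fspan lowpsi (@psi R l n I).
  by move=> l3; apply: fspan_gen; exists l, n, I.
have i1 n I : fspan lowpsi (psihat1 b n I).
  by rewrite /psihat1 -linB; apply: fspan_lin; exact: i.
have i2 n I : fspan lowpsi (psihat2 b n I).
  by rewrite /psihat2 -linB; apply: fspan_lin; exact: i.
move=> [[[[n [I [_ ->]]]|[n [I [_ ->]]]]|[n [I [_ ->]]]]|[n [I [_ ->]]]].
- by rewrite -linB; apply: fspan_lin; exact: i.
- rewrite -[X in fspan _ X]/(fun x => (fun x => psihat1 b n I x - d12 b n * psihat1 b 2 I x) x
     - d13 b n * psihat1 b 3 I x) -linB -linB.
  by do 2 (apply: fspan_lin; first exact: i1); exact: i1.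
- rewrite -[X in fspan _ X]/(fun x => (fun x => psihat2 b n I x - d21 b n * psihat2 b 1 I x) x
     - d22 b n * psihat2 b 2 I x) -linB -linB.
  by do 2 (apply: fspan_lin; first exact: i2); exact: i2.
- by rewrite -linB; apply: fspan_lin; exact: i.
Qed.

Lemma lowpsi_S3high g h : lowpsi g -> S3high h -> ip g h = 0.
Proof.
by move=> [l [n [I [l3 ->]]]] [l' [n' [I' [l4 ->]]]]; rewrite ippsi0//; lia.
Qed.

Lemma lowpsi_cspan_S3high g f : lowpsi g -> cspan S3high f -> ip g f = 0.
Proof.
move=> lg; apply: cspan_ip; [exact: S3high_L2|exact: lowpsi_L2|].
by move=> h; exact: lowpsi_S3high.
Qed.

(** Low and high generators differ in rank and are orthogonal, so [cspan_orth] discards the low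
    ones. *)
Lemma S3_high f : V b Br f -> (forall g, S3low g -> ip f g = 0) -> cspan S3high f.
Proof.
move=> Vf; apply: cspan_orth Vf; [exact: S3low_L2|exact: S3high_L2|].
move=> g h /S3low_lowpsi sg Sh; rewrite ipC.
apply: fspan_ip sg; [exact: lowpsi_L2|exact: S3high_L2|].
by move=> k lk; rewrite ipC; exact: lowpsi_S3high.
Qed.

Lemma S3high_ip f h : weighted h -> L2 h -> cspan S3high f -> ip h f = 0.
Proof.
move=> wh Lh; apply: cspan_ip => //; first exact: S3high_L2.
by move=> _ [l [n [I [l4 ->]]]]; exact: (weighted4 wh).
Qed.

(** * Uniqueness for block systems and vanishing of the V^(r) component *)

Definition usum (u : block -> vfun R) : vfun R := fun x => u B1 x + u B2 x + u Br x.

Definition vblocks (u : block -> vfun R) := forall k, k <> B0 -> V b k (u k) /\ D (u k).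

Lemma D_usum u : vblocks u -> D (usum u).
Proof.
by move=> hu; apply: D_D; [apply: D_D|]; apply: (hu _ _).2.
Qed.

Lemma ip_usum u g : vblocks u -> L2 g ->
  ip (usum u) g = ip (u B1) g + ip (u B2) g + ip (u Br) g.
Proof.
move=> hu Lg; have [L1 L2u Lr] : [/\ L2 (u B1), L2 (u B2) & L2 (u Br)].
  by split; apply: D_L2; apply: (hu _ _).2.
by rewrite !ipDl//; exact: L2_D.
Qed.

Lemma ip_usum_V k u g : k <> B0 -> vblocks u -> V b k g -> ip (usum u) g = ip (u k) g.
Proof.
move=> k0 hu Vg; rewrite ip_usum//; last exact: V_L2 Vg.
have z l : l <> B0 -> l <> k -> ip (u l) g = 0.
  by move=> l0 lk; exact: V_orth lk (hu l l0).1 Vg.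
case: k k0 Vg z => // _ Vg z.
- by rewrite (z B2)// (z Br)// !addr0.
- by rewrite (z B1)// (z Br)// addr0 add0r.
- by rewrite (z B1)// (z B2)// !add0r.
Qed.

Lemma usum_V0 u v : vblocks u -> V0 v -> ip (usum u) v = 0.
Proof.
move=> hu Vv; rewrite ip_usum//; last exact: V0_L2.
have z l : l <> B0 -> ip (u l) v = 0.
  by move=> l0; exact: (@V_orth l B0 _ _ l0 (hu l l0).1 Vv).
by rewrite !z// !addr0.
Qed.

(** [L_null] gives L f = 0, so f agrees with an element of [V0], to which it is orthogonal. *)
Lemma L_null_V0 f : D f -> (forall v, V0 v -> ip f v = 0) -> ip (L f) f = 0 ->
  aeq f (fun=> 0).
Proof.
move=> Df f0 Lf0; have [v Vv fv] := kernel_V0 Df (L_null Df Lf0).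
apply: ip_eq0; first exact: D_L2.
rewrite (aeq_ip fv); [|exact: D_L2|exact: V0_L2|exact: D_L2].
by rewrite ipC f0.
Qed.

(* Since h is weighted, u^(r) only involves tensors of rank at least 4, which
   L does not couple to u^(1) and u^(2). *)
Lemma Br_eq0 u h : vblocks u -> D h -> weighted h ->
  (forall g, D g -> (forall v, V0 v -> ip g v = 0) -> ip (L (usum u)) g = ip h g) ->
  aeq (u Br) (fun=> 0).
Proof.
move=> hu Dh wh hLU; have [Vr Dr] := hu Br ltac:(by []).
have DU := D_usum hu; have Lr := D_L2 Dr.
have rV0 v : V0 v -> ip (u Br) v = 0.
  by move=> Vv; rewrite ipC; exact: V0_S3.
(* A low generator g equals L t with t orthogonal to [V0] and to h, so <u_r, g> = <L U, t> = <h, t>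
   = 0 with U = [usum u]. *)
have rhigh : cspan S3high (u Br).
  apply: S3_high => // g Sg.
  have [t [Dt Lt ht tV0]] := weighted_S3low Dh wh Sg.
  rewrite -(@ip_usum_V Br u g)//; last exact: S3low_S3.
  rewrite ipC -(aeq_ip Lt); [|exact/D_L2/D_L|exact: S3low_L2|exact: D_L2].
  by rewrite ipC -L_sym// hLU.
have Kdec := decomp (D_L Dr).
have [gk [gVD _ gE]] := Kdec.
have [Vkr Dkr] := gVD Br; have Lkr := D_L2 Dkr.
have Klow g : lowpsi g -> ip (L (u Br)) g = 0.
  move=> [l [n [I [l3 ->]]]]; rewrite L_sym//; last exact: D_psi.
  rewrite ipC; apply: (cvgn_unique (@cvg_Lpsi l n I _ Lr)).
  rewrite (_ : (fun N => _) = fun=> 0); first exact: cvg_cst.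
  apply/funext => N; rewrite big1// => k _; rewrite (lowpsi_cspan_S3high _ rhigh) ?mulr0//.
  by exists l, k, I.
have krhigh : cspan S3high (gk Br).
  apply: S3_high => // g Sg; rewrite -(gE Br); last exact: S3low_S3.
  apply: fspan_ip (S3low_lowpsi Sg) => //; [exact: lowpsi_L2|exact/D_L2/D_L].
(* The part of L u_r outside V^(r). Both n and L n are orthogonal to every psi, while u_r and
   [gk Br] are limits of combinations of psi; hence <n, n> = <L n, u_r> - <n, gk Br> = 0. *)
pose n : vfun R := fun x => L (u Br) x - gk Br x.
have Dn : D n by apply: D_B => //; exact: D_L.
have ipn g : L2 g -> ip n g = ip (L (u Br)) g - ip (gk Br) g.
  by move=> Lg; rewrite ipBl//; exact/D_L2/D_L.
have n0 : psiorth n.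
  move=> l m I; rewrite ipn; last exact: L2psi.
  have [l3|l4] := leqP l 3.
    have lw : lowpsi (@psi R l m I) by exists l, m, I.
    by rewrite Klow// (ipC (gk Br)) (lowpsi_cspan_S3high lw krhigh) subrr.
  by rewrite (gE Br) ?subrr//; apply: S3high_S3; exists l, m, I.
have oh f g : psiorth f -> L2 f -> cspan S3high g -> ip f g = 0.
  move=> f0 Lf; apply: cspan_ip => //; first exact: S3high_L2.
  by move=> _ [l [m [I [_ ->]]]].
have nE : aeq n (fun=> 0).
  apply: ip_eq0; first exact: D_L2.
  rewrite {2}/n ipBr//; [|exact/D_L2/D_L|exact: D_L2].
  rewrite (oh _ _ n0 (D_L2 Dn) krhigh) subr0 -L_sym//.
  by apply: oh => //; [exact: psiorth_L|exact/D_L2/D_L].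
have LrE : aeq (L (u Br)) (gk Br).
  by apply: filterS nE => x /(_ I)/eqP; rewrite subr_eq0 => /eqP.
apply: L_null_V0 => //.
have : ip (L (usum u)) (u Br) = 0.
  by rewrite hLU// S3high_ip//; exact: D_L2.
rewrite L_sym// ip_usum//; last exact/D_L2/D_L.
have z k : k <> B0 -> k <> Br -> ip (u k) (L (u Br)) = 0.
  move=> k0 kr; have [Vk Dk] := hu k k0.
  rewrite ipC (aeq_ip LrE); [|exact/D_L2/D_L|exact: D_L2|exact: D_L2].
  by rewrite ipC; exact: V_orth kr Vk Vkr.
by rewrite (z B1)// (z B2)// !add0r L_sym.
Qed.

(** Adding the hypotheses over the three blocks gives <L U, U> = 0 for the sum U, and L is definite
    off [V0]. *)
Lemma vblocks_unique u : vblocks u ->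
  (forall k, k <> B0 -> ip (L (usum u)) (u k) = 0) ->
  forall k, k <> B0 -> aeq (u k) (fun=> 0).
Proof.
move=> hu hz k k0; have DU := D_usum hu; have [Vk Dk] := hu k k0.
have U0 : aeq (usum u) (fun=> 0).
  apply: L_null_V0 => //; first by move=> v; exact: usum_V0.
  by rewrite ipC ip_usum ?(ipC (u _)) ?hz ?addr0//; exact/D_L2/D_L.
apply: ip_eq0; first exact: D_L2.
rewrite -(ip_usum_V k0 hu Vk) (aeq_ip U0) ?ip0l//; [exact: D_L2|exact: L2_0|exact: D_L2].
Qed.

(** * Maxwellian iterations *)

Implicit Types (ks : pred block) (k l : block) (S T G : diffop R) (F : block -> diffop R).

(** Unlike [aeq_V], this tests against elements of D only. That suffices because f - g is itself in
    D, and symmetry of L is at hand only there. *)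
Lemma aeq_VD k f g : V b k f -> D f -> V b k g -> D g ->
  (forall h, V b k h -> D h -> ip f h = ip g h) -> aeq f g.
Proof.
move=> Vf Df Vg Dg e; have Vd := V_B Vf Vg; have Dd := D_B Df Dg.
have := ip_eq0 (D_L2 Dd).
rewrite ipBl ?e// ?subrr; [|exact: D_L2..].
by move=> /(_ erefl); apply: filterS => x /(_ I)/eqP; rewrite subr_eq0 => /eqP.
Qed.

Lemma D_bsum ks (u : block -> vfun R) : (forall k, ks k -> D (u k)) ->
  D (fun x => bsum ks (fun l => u l x)).
Proof. exact: D_sum. Qed.

Lemma V_bsum k ks (u : block -> vfun R) : (forall l, ks l -> V b k (u l)) ->
  V b k (fun x => bsum ks (fun l => u l x)).
Proof. exact: V_sum. Qed.

Lemma ip_bsum ks (u : block -> vfun R) g : (forall k, ks k -> D (u k)) -> L2 g ->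
  ip (fun x => bsum ks (fun l => u l x)) g = bsum ks (fun l => ip (u l) g).
Proof. by move=> Du Lg; apply: ip_suml => // l kl; exact/D_L2/Du. Qed.

Lemma eq_bsum ks (f g : block -> R) : (forall k, ks k -> f k = g k) ->
  bsum ks f = bsum ks g.
Proof. exact: eq_bigr. Qed.

(** Extension by zero, which lets the systems with two and with three unknown blocks be read as
    equations for a single function [usum]. *)
Definition onblocks (ks : pred block) (u : block -> vfun R) : block -> vfun R :=
  fun k => if ks k then u k else fun=> 0.

Lemma bsumE ks (f : block -> R) : bsum ks f =
  (if ks B1 then f B1 else 0) + (if ks B2 then f B2 else 0) + (if ks Br then f Br else 0).
Proof.
rewrite /bsum !big_cons big_nil.
by case: (ks B1); case: (ks B2); case: (ks Br); rewrite ?addr0 ?add0r ?addrA.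
Qed.

Lemma bsum_usum ks (u : block -> vfun R) :
  (fun x => bsum ks (fun l => u l x)) = usum (onblocks ks u).
Proof.
apply/funext => x; rewrite bsumE /usum /onblocks.
by case: (ks B1); case: (ks B2); case: (ks Br).
Qed.

Definition ksvals (ks : pred block) (u : block -> vfun R) :=
  forall k, ks k -> V b k (u k) /\ D (u k).

Lemma vblocks_onblocks ks u : ksvals ks u -> vblocks (onblocks ks u).
Proof.
move=> hu k _; rewrite /onblocks; case: ifP => [/hu//|_].
by split; [exact: V_0|exact: D_0].
Qed.

Lemma D_Lop k f : D f -> D (Lop b L k f).
Proof. by move=> Df; apply: D_orthproj; exact: D_L. Qed.

Lemma V_Lop k f : D f -> V b k (Lop b L k f).
Proof. by move=> Df; apply: V_orthproj; exact: D_L. Qed.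

Lemma ip_Lop k f g : D f -> V b k g -> ip (Lop b L k f) g = ip (L f) g.
Proof. by move=> Df Vg; rewrite ip_orthproj//; exact: D_L. Qed.

Lemma ip_bsum_Lop ks k u g : ksvals ks u -> V b k g -> D g ->
  ip (fun x => bsum ks (fun l => Lop b L k (u l) x)) g = ip (L (usum (onblocks ks u))) g.
Proof.
move=> hu Vg Dg; have Du l : ks l -> D (u l) by move=> /hu[].
rewrite -bsum_usum L_sym//; last exact: D_bsum.
rewrite !ip_bsum//; [|exact/D_L2/D_L|by move=> l /Du; exact: D_Lop|exact: D_L2].
by apply: eq_bsum => l kl; rewrite ip_Lop ?L_sym//; exact: Du.
Qed.

Definition solves (ks : pred block) (u r : block -> vfun R) := forall k, ks k ->
  aeq (fun x => bsum ks (fun l => Lop b L k (u l) x)) (r k).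

Lemma solves_ip ks k u r g : ksvals ks u -> ksvals ks r -> solves ks u r -> ks k ->
  V b k g -> D g -> ip (L (usum (onblocks ks u))) g = ip (r k) g.
Proof.
move=> hu hr s kk Vg Dg; rewrite -(ip_bsum_Lop hu Vg Dg); apply: aeq_ip.
- exact: s.
- by apply/D_L2/D_bsum => l /hu[_ Dl]; exact: D_Lop.
- exact/D_L2/(hr k kk).2.
- exact: D_L2.
Qed.

Lemma ip_solves ks u r : ksvals ks u -> ksvals ks r ->
  (forall k g, ks k -> V b k g -> D g -> ip (L (usum (onblocks ks u))) g = ip (r k) g) ->
  solves ks u r.
Proof.
move=> hu hr e k kk; have [Vr Dr] := hr k kk.
have Du l : ks l -> D (u l) by move=> /hu[].
apply: (@aeq_VD k) => //.
- by apply: V_bsum => l /Du; exact: V_Lop.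
- by apply: D_bsum => l /Du; exact: D_Lop.
- by move=> h Vh Dh; rewrite ip_bsum_Lop// (e k).
Qed.

(** Testing the difference of the two systems against the differences of the unknowns brings the
    claim to [vblocks_unique]. *)
Lemma solves_unique ks u u' r r' : ks B0 = false ->
  ksvals ks u -> ksvals ks u' -> ksvals ks r -> ksvals ks r' ->
  solves ks u r -> solves ks u' r' -> (forall k, ks k -> aeq (r k) (r' k)) ->
  forall k, ks k -> aeq (u k) (u' k).
Proof.
move=> ks0 hu hu' hr hr' s s' rr k kk.
pose d l : vfun R := fun x => u l x - u' l x.
have hd : ksvals ks d.
  move=> l kl; have [Vu Du] := hu l kl; have [Vu' Du'] := hu' l kl.
  by split; [exact: V_B|exact: D_B].
have md : usum (onblocks ks d) = lin (-1) (usum (onblocks ks u')) (usum (onblocks ks u)).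
  apply/funext => x; rewrite /lin /usum /onblocks /d.
  by case: (ks B1); case: (ks B2); case: (ks Br); ring.
have hz l : l <> B0 -> ip (L (usum (onblocks ks d))) (onblocks ks d l) = 0.
  move=> l0; rewrite {2}/onblocks; case: ifP => kl; last by rewrite ip0r.
  have [Vd Dd] := hd l kl.
  rewrite md L_lin//; [|exact/D_usum/vblocks_onblocks..].
  rewrite (solves_ip hu hr s kl)// (solves_ip hu' hr' s' kl)//.
  rewrite (aeq_ip (rr l kl)); [by ring|exact/D_L2/(hr l kl).2|exact/D_L2/(hr' l kl).2|exact: D_L2].
have k0 : k <> B0 by move=> e; rewrite e ks0 in kk.
have := vblocks_unique (vblocks_onblocks hd) hz k0.
by rewrite /onblocks kk; apply: filterS => x /(_ I)/eqP; rewrite subr_eq0 => /eqP.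
Qed.

(** * Differential operators on V^(0) and existence of the iterates *)

Lemma diffop_0 k : is_diffop b D k (fun _ _ _ _ => 0).
Proof.
split=> [m al w _|m al c w1 w2 _ _|]; first by split; [exact: V_0|exact: D_0].
  by apply: aeW => x _; rewrite /lin mulr0 addr0.
by exists 0%N => m al w _ _; exact: aeq_refl.
Qed.

Lemma opidE m al (w : vfun R) : @opid R m al w =
  if (m == 0%N) && [forall i : 'I_3, al i == 0%N] then w else fun=> 0.
Proof. by apply/funext => x; rewrite /opid; case: ifP. Qed.

Lemma kn_truncateE j S m al w : kn_truncate j S m al w =
  if (0 < m <= j.+1)%N then S m.-1 al w else fun=> 0.
Proof. by case: m => [|m]//; apply/funext => x; rewrite /= ltnS; case: ifP. Qed.

Lemma diffop_id : is_diffop b D B0 (@opid R).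
Proof.
split=> [m al w Vw|m al c w1 w2 _ _|].
- rewrite opidE; case: ifP => _; first by split=> //; exact: V0_D.
  by split; [exact: (V_0 B0)|exact: D_0].
- apply: aeW => x _; rewrite /opid /lin; case: ifP => // _.
  by rewrite mulr0 addr0.
exists 0%N => m al w _ h; apply: aeW => x _; rewrite /opid; case: ifP => //.
move=> /andP[/eqP m0 /forallP al0]; move: h; rewrite m0 add0n big1// => i _.
exact/eqP.
Qed.

Lemma diffop_add k S T : is_diffop b D k S -> is_diffop b D k T ->
  is_diffop b D k (opadd S T).
Proof.
move=> [vS lS [N dS]] [vT lT [M dT]]; split=> [m al w Vw|m al c w1 w2 V1 V2|].
- have [V1 D1] := vS m al w Vw; have [V2 D2] := vT m al w Vw.
  by split; [exact: V_D|exact: D_D].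
- apply: aeq_trans (aeqD (lS m al c w1 w2 V1 V2) (lT m al c w1 w2 V1 V2)) _.
  by apply: aeW => x _; rewrite /lin /opadd; ring.
exists (N + M)%N => m al w Vw h.
have hS := dS m al w Vw ltac:(lia); have hT := dT m al w Vw ltac:(lia).
apply: aeq_trans (aeqD hS hT) _; by apply: aeW => x _; rewrite addr0.
Qed.

Lemma diffop_opp k S : is_diffop b D k S -> is_diffop b D k (opopp S).
Proof.
move=> [vS lS [N dS]]; split=> [m al w Vw|m al c w1 w2 V1 V2|].
- by have [V1 D1] := vS m al w Vw; split; [exact: V_N|exact: D_N].
- apply: aeq_trans (aeqN (lS m al c w1 w2 V1 V2)) _.
  by apply: aeW => x _; rewrite /lin /opopp; ring.
exists N => m al w Vw h; apply: aeq_trans (aeqN (dS m al w Vw h)) _.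
by apply: aeW => x _; rewrite oppr0.
Qed.

Lemma diffop_sum k ks F : (forall l, ks l -> is_diffop b D k (F l)) ->
  is_diffop b D k (opsum ks F).
Proof.
move=> dF.
have dM l : is_diffop b D k (if ks l then F l else fun _ _ _ _ => 0).
  by case: ifP => kl; [exact: dF|exact: diffop_0].
have := diffop_add (diffop_add (dM B1) (dM B2)) (dM Br).
congr is_diffop; apply/funext => m; apply/funext => al; apply/funext => w.
apply/funext => x; rewrite /opsum bsumE /opadd.
by case: (ks B1); case: (ks B2); case: (ks Br).
Qed.

Lemma diffop_Aop k l S : is_diffop b D l S -> is_diffop b D k (Aop b k S).
Proof.
move=> [vS lS [N dS]].
have Dx m al w i : V0 w -> D (mulxi i (S m al w)).
  by move=> Vw; apply: D_mulxi; exact: (vS m al w Vw).2.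
split=> [m al w Vw|m al c w1 w2 V1 V2|].
- split; first by apply: V_sum => i _; apply: V_orthproj; exact: Dx.
  by apply: D_sum => i _; apply: D_orthproj; exact: Dx.
- have Vl : V0 (lin c w1 w2) by exact: (@V_lin B0).
  have h i : aeq (orthproj (V b k) (mulxi i (S m (fun j => al j - (j == i))%N (lin c w1 w2))))
     (lin c (orthproj (V b k) (mulxi i (S m (fun j => al j - (j == i))%N w1)))
            (orthproj (V b k) (mulxi i (S m (fun j => al j - (j == i))%N w2)))).
    apply: aeq_trans (orthproj_lin _ _ (Dx _ _ _ _ V1) (Dx _ _ _ _ V2)).
    apply: orthproj_aeq; [exact: Dx|by apply: D_lin; exact: Dx|].
    apply: filterS (lS m (fun j => al j - (j == i))%N c w1 w2 V1 V2) => x e _.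
    by rewrite /mulxi e// /lin; ring.
  have := aeq_sum (index_enum 'I_3) (fun i (_ : (0 < al i)%N) => h i).
  move=> e; apply: aeq_trans e _; apply: aeW => x _.
  by rewrite /lin /Aop mulr_sumr -big_split.
exists N.+1 => m al w Vw h.
have hi i : (0 < al i)%N ->
    aeq (orthproj (V b k) (mulxi i (S m (fun j => al j - (j == i))%N w))) (fun=> 0).
  move=> ai; apply: aeq_trans (orthproj_0 k); apply: orthproj_aeq; [exact: Dx|exact: D_0|].
  apply: filterS (dS m (fun j => al j - (j == i))%N w Vw _) => [x e _|].
    by rewrite /mulxi e// mulr0.
  move: h; rewrite (bigD1 i)//= [X in _ -> (_ < _ + X)%N](bigD1 i)//= eqxx.
  have -> : (\sum_(j < 3 | j != i) (al j - (j == i)) = \sum_(j < 3 | j != i) al j)%N.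
    by apply: eq_bigr => j /negPf ->; rewrite subn0.
  rewrite subn1; move: ai; move: (\sum_(j < 3 | j != i) al j)%N (al i) => s ai.
  by move=> a0 h; lia.
apply: aeq_trans (aeq_sum (index_enum 'I_3) hi) _.
by apply: aeW => x _; rewrite big1.
Qed.

(** Linearity up to null sets is strict here by [V0_aeq_eq]; this is needed when the output of G is
    the argument of another operator. *)
Lemma diffop_V0_lin G m al c (w1 w2 : vfun R) : is_diffop b D B0 G -> V0 w1 -> V0 w2 ->
  G m al (lin c w1 w2) = lin c (G m al w1) (G m al w2).
Proof.
move=> [vG lG _] V1 V2; apply: V0_aeq_eq; last exact: lG.
  by apply: (vG m al _ _).1; exact: (@V_lin B0).
by apply: (@V_lin B0); [exact: (vG m al w1 V1).1|exact: (vG m al w2 V2).1].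
Qed.

Lemma diffop_0arg k S m al : is_diffop b D k S -> aeq (S m al (fun=> 0)) (fun=> 0).
Proof.
move=> [_ lS _]; have z : V0 (fun=> 0 : R) by exact: (V_0 B0).
have := lS m al (-1) _ _ z z.
rewrite (_ : lin (-1) (fun=> 0) (fun=> 0) = fun=> 0); last first.
  by apply/funext => x; rewrite /lin mulr0 addr0.
by apply: filterS => x h _; rewrite h// /lin mulN1r addNr.
Qed.

Lemma diffop_comp k S G : is_diffop b D k S -> is_diffop b D B0 G ->
  is_diffop b D k (opcomp S G).
Proof.
move=> dS dG; have [vS lS [N nS]] := dS; have [vG lG [M nG]] := dG.
split=> [m al w Vw|m al c w1 w2 V1 V2|].
- split; [do 2 (apply: V_sum => ? _)|do 2 (apply: D_sum => ? _)].
    by apply: (vS _ _ _ _).1; exact: (vG _ _ _ Vw).1.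
  by apply: (vS _ _ _ _).2; exact: (vG _ _ _ Vw).1.
- have h (p : 'I_m.+1) (be : {dffun forall i : 'I_3, 'I_(al i).+1}) :
    aeq (S p (fun i => be i : nat) (G (m - p)%N (fun i => al i - be i)%N (lin c w1 w2)))
     (lin c (S p (fun i => be i : nat) (G (m - p)%N (fun i => al i - be i)%N w1))
            (S p (fun i => be i : nat) (G (m - p)%N (fun i => al i - be i)%N w2))).
    rewrite (diffop_V0_lin _ _ _ dG)//; apply: lS; exact: (vG _ _ _ _).1.
  have := aeq_sum (index_enum 'I_m.+1) (fun p (_ : true) =>
    aeq_sum (index_enum {dffun forall i : 'I_3, 'I_(al i).+1}) (fun be (_ : true) => h p be)).
  move=> e; apply: aeq_trans e _; apply: aeW => x _.
  rewrite /lin /opcomp mulr_sumr -big_split; apply: eq_bigr => p _.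
  by rewrite mulr_sumr -big_split.
exists (N + M)%N => m al w Vw hm.
have h (p : 'I_m.+1) (be : {dffun forall i : 'I_3, 'I_(al i).+1}) :
    aeq (S p (fun i => be i : nat) (G (m - p)%N (fun i => al i - be i)%N w)) (fun=> 0).
  (* The total order exceeds N + M, so either the part in S exceeds N or the part in G exceeds M. *)
  have [hS|hS] := boolP (N < p + \sum_(i < 3) be i)%N.
    by apply: nS => //; exact: (vG _ _ _ Vw).1.
  have G0 : G (m - p)%N (fun i => al i - be i)%N w = fun=> 0.
    apply: V0_aeq_eq; [exact: (vG _ _ _ Vw).1|exact: (V_0 B0)|apply: nG => //].
    have : (\sum_(i < 3) al i = \sum_(i < 3) be i + \sum_(i < 3) (al i - be i))%N.
      by rewrite -big_split; apply: eq_bigr => i _ /=; rewrite subnKC// -ltnS.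
    have pm : (p <= m)%N by rewrite -ltnS.
    by move: hS hm; lia.
  by rewrite G0; exact: diffop_0arg dS.
have := aeq_sum (index_enum 'I_m.+1) (fun p (_ : true) =>
    aeq_sum (index_enum {dffun forall i : 'I_3, 'I_(al i).+1}) (fun be (_ : true) => h p be)).
move=> e; apply: aeq_trans e _; apply: aeW => x _.
by rewrite big1// => p _; rewrite big1.
Qed.

Lemma diffop_truncate k j S : is_diffop b D k S -> is_diffop b D k (kn_truncate j S).
Proof.
move=> [vS lS [N nS]]; split=> [m al w Vw|m al c w1 w2 V1 V2|].
- rewrite kn_truncateE; case: ifP => _; first exact: vS.
  by split; [exact: V_0|exact: D_0].
- rewrite !kn_truncateE; case: ifP => _; first exact: lS.
  by apply: aeW => x _; rewrite /lin mulr0 addr0.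
exists N.+1 => m al w Vw h; rewrite kn_truncateE; case: ifP => _; last exact: aeq_refl.
by apply: nS => //; move: h; lia.
Qed.

Lemma diffop_closed ks F : (forall l, ks l -> is_diffop b D l (F l)) ->
  is_diffop b D B0 (closed_op b ks F).
Proof.
move=> dF; apply: diffop_add; first exact: diffop_Aop diffop_id.
by apply: diffop_sum => l /dF; exact: diffop_Aop.
Qed.

Lemma diffop_ddt ks F k : (forall l, ks l -> is_diffop b D l (F l)) -> ks k ->
  is_diffop b D k (ddt b ks F k).
Proof.
move=> dF kk; apply: diffop_comp; first exact: dF.
by apply: diffop_opp; exact: diffop_closed.
Qed.

Lemma diffop_lhs_boltzmann F k : boltzmann_blocks k ->
  (forall l, boltzmann_blocks l -> is_diffop b D l (F l)) ->
  is_diffop b D k (lhs_boltzmann b F k).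
Proof.
move=> kk dF; apply: diffop_add; first exact: diffop_ddt.
apply: diffop_add; first exact: diffop_Aop diffop_id.
by apply: diffop_sum => l /dF; exact: diffop_Aop.
Qed.

Lemma diffop_lhs_r13 F k : r13_blocks k ->
  (forall l, r13_blocks l -> is_diffop b D l (F l)) ->
  is_diffop b D k (lhs_r13 b F k).
Proof.
move=> kk dF; case: k kk => // _.
  apply: diffop_add; first exact: diffop_ddt.
  apply: diffop_add; first exact: diffop_Aop diffop_id.
  apply: diffop_add; [exact: diffop_Aop (dF B1 isT)|exact: diffop_Aop (dF B2 isT)].
apply: diffop_add; first exact: diffop_Aop diffop_id.
exact: diffop_Aop (dF B1 isT).
Qed.

Lemma solves_lin ks c u u' r r' : ksvals ks u -> ksvals ks u' ->
  ksvals ks r -> ksvals ks r' -> solves ks u r -> solves ks u' r' ->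
  solves ks (fun l => lin c (u l) (u' l)) (fun l => lin c (r l) (r' l)).
Proof.
move=> hu hu' hr hr' s s'.
have hl v v' : ksvals ks v -> ksvals ks v' -> ksvals ks (fun l => lin c (v l) (v' l)).
  move=> hv hv' l kl; have [V1 D1] := hv l kl; have [V2 D2] := hv' l kl.
  by split; [exact: V_lin|exact: D_lin].
apply: ip_solves => [||k g kk Vg Dg]; [exact: hl|exact: hl|].
have -> : usum (onblocks ks (fun l => lin c (u l) (u' l))) =
    lin c (usum (onblocks ks u)) (usum (onblocks ks u')).
  apply/funext => x; rewrite /lin /usum /onblocks.
  by case: (ks B1); case: (ks B2); case: (ks Br); ring.
rewrite L_lin//; [|exact/D_usum/vblocks_onblocks..].
rewrite (solves_ip hu hr s kk Vg Dg) (solves_ip hu' hr' s' kk Vg Dg).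
by rewrite ip_linl//; [exact/D_L2/(hr k kk).2|exact/D_L2/(hr' k kk).2|exact: D_L2].
Qed.

Lemma ksvals_0 ks : ksvals ks (fun _ _ => 0).
Proof. by move=> k _; split; [exact: V_0|exact: D_0]. Qed.

Lemma solves_0 ks : solves ks (fun _ _ => 0) (fun _ _ => 0).
Proof.
apply: ip_solves => [||k g kk Vg Dg]; try exact: ksvals_0.
rewrite -bsum_usum (_ : (fun x => _) = fun=> 0); last first.
  by apply/funext => x; rewrite bsumE !if_same !addr0.
by rewrite L_sym ?ip0l//; exact: D_0.
Qed.

(** Solutions are chosen separately for each coefficient and each w; uniqueness then makes the
    choice linear in w and zero in high order, so that it is a differential operator again. *)
Lemma diffop_solve ks F : ks B0 = false -> block_invertible b L D ks ->
  (forall k, ks k -> is_diffop b D k (F k)) ->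
  exists H : block -> diffop R, (forall k, ks k -> is_diffop b D k (H k)) /\
    forall m al w, V0 w -> solves ks (fun l => H l m al w) (fun l => F l m al w).
Proof.
move=> ks0 inv dF.
have hF m al w : V0 w -> ksvals ks (fun l => F l m al w).
  by move=> Vw l /dF[h _ _]; exact: h.
have ex (x : nat * multi * vfun R) : exists u : block -> vfun R, V0 x.2 ->
    ksvals ks u /\ solves ks u (fun l => F l x.1.1 x.1.2 x.2).
  have [Vw|nV] := pselect (V0 x.2); last by exists (fun _ _ => 0).
  have [u hu su] := inv _ (hF x.1.1 x.1.2 x.2 Vw).
  by exists u => _; split.
have [H hH] := choice ex.
pose H' l m al w := H (m, al, w) l.
have vH m al w : V0 w -> ksvals ks (fun l => H' l m al w).
  by move=> Vw; exact: (hH (m, al, w) Vw).1.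
have sH m al w : V0 w -> solves ks (fun l => H' l m al w) (fun l => F l m al w).
  by move=> Vw; exact: (hH (m, al, w) Vw).2.
exists H'; split=> // k kk; split=> [m al w Vw|m al c w1 w2 Vw1 Vw2|].
- exact: vH.
- have Vl : V0 (lin c w1 w2) by exact: (@V_lin B0).
  have h2 := vH m al w1 Vw1; have h3 := vH m al w2 Vw2.
  have hl v v' : ksvals ks v -> ksvals ks v' -> ksvals ks (fun l => lin c (v l) (v' l)).
    move=> hv hv' l kl; have [V1 D1] := hv l kl; have [V2 D2] := hv' l kl.
    by split; [exact: V_lin|exact: D_lin].
  have := @solves_unique ks _ _ _ _ ks0 (vH m al _ Vl) (hl _ _ h2 h3)
    (hF m al _ Vl) (hl _ _ (hF m al _ Vw1) (hF m al _ Vw2)) (sH m al _ Vl)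
    (solves_lin c h2 h3 (hF m al _ Vw1) (hF m al _ Vw2) (sH m al _ Vw1) (sH m al _ Vw2)).
  by apply=> // l /dF[_ lF _]; exact: lF.
have deg l : exists N, ks l -> forall m al w, V0 w ->
    (N < m + \sum_(i < 3) al i)%N -> aeq (F l m al w) (fun=> 0).
  have [kl|kl] := boolP (ks l); last by exists 0%N.
  by have [_ _ [N h]] := dF l kl; exists N.
have [[N1 h1] [N2 h2] [N3 h3]] := And3 (deg B1) (deg B2) (deg Br).
exists (N1 + N2 + N3)%N => m al w Vw hm.
have := @solves_unique ks _ _ _ _ ks0 (vH m al w Vw) (@ksvals_0 ks) (hF m al w Vw)
  (@ksvals_0 ks) (sH m al w Vw) (@solves_0 ks).
apply=> // -[|kl|kl|kl]; first by rewrite ks0.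
- by apply: h1 => //; move: hm; lia.
- by apply: h2 => //; move: hm; lia.
- by apply: h3 => //; move: hm; lia.
Qed.

(** The recursion runs in the type of families together with a proof that they are differential
    operators, since solving the next step requires this of the previous iterate. *)
Lemma iterates_exist ks lhs : ks B0 = false -> block_invertible b L D ks ->
  (forall F, (forall l, ks l -> is_diffop b D l (F l)) ->
     forall k, ks k -> is_diffop b D k (lhs F k)) ->
  exists F : nat -> block -> diffop R, maxwellian_iterates b L D ks lhs F.
Proof.
move=> ks0 inv dlhs.
pose St := {F : block -> diffop R | forall l, ks l -> is_diffop b D l (F l)}.
have ex (x : nat * St) : exists H : St, forall m al w, V0 w ->
    solves ks (fun l => sval H l m al w) (fun l => kn_truncate x.1 (lhs (sval x.2) l) m al w).
  have [|H [dH sH]] := @diffop_solve ks (fun l => kn_truncate x.1 (lhs (sval x.2) l)) ks0 inv.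
    by move=> k kk; apply: diffop_truncate; apply: dlhs => //; exact: (svalP x.2).
  by exists (exist _ H dH).
have [nxt hn] := choice ex.
have d0 l : ks l -> is_diffop b D l (fun _ _ _ _ => 0) by move=> _; exact: diffop_0.
pose F0 : St := exist _ (fun _ _ _ _ _ => 0) d0.
exists (fun j => sval (iteri j (fun i E => nxt (i, E)) F0)); split=> //.
  by move=> j k; exact: (svalP (iteri j (fun i E => nxt (i, E)) F0)).
move=> j k kk m al w Vw.
exact: (hn (j, iteri j (fun i E => nxt (i, E)) F0) m al w Vw k kk).
Qed.

(** * Comparison of the left-hand sides of the two systems *)

Definition opeq S T := forall m al w, V0 w -> aeq (S m al w) (T m al w).

Lemma diffop_D k S m al w : is_diffop b D k S -> V0 w -> D (S m al w).
Proof. by move=> [h _ _] Vw; exact: (h m al w Vw).2. Qed.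

Lemma diffop_V k S m al w : is_diffop b D k S -> V0 w -> V b k (S m al w).
Proof. by move=> [h _ _] Vw; exact: (h m al w Vw).1. Qed.

Lemma Aop_opeq k l l' S T : is_diffop b D l S -> is_diffop b D l' T ->
  opeq S T -> opeq (Aop b k S) (Aop b k T).
Proof.
move=> dS dT e m al w Vw; apply: aeq_sum => i _; apply: orthproj_aeq.
- exact/D_mulxi/(diffop_D _ _ dS).
- exact/D_mulxi/(diffop_D _ _ dT).
by apply: filterS (e m (fun j => al j - (j == i))%N w Vw) => x h _; rewrite /mulxi h.
Qed.

Lemma Aop_0 k : opeq (Aop b k (fun _ _ _ _ => 0)) (fun _ _ _ _ => 0).
Proof.
move=> m al w _.
have h (i : 'I_3) (_ : (0 < al i)%N) : aeq (orthproj (V b k) (mulxi i (fun=> 0))) (fun=> 0).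
  rewrite (_ : mulxi i _ = fun=> 0); first exact: orthproj_0.
  by apply/funext => x; rewrite /mulxi mulr0.
have e := aeq_sum (index_enum 'I_3) h.
by apply: aeq_trans e _; apply: aeW => x _; rewrite big1.
Qed.

Lemma Aop_eq0 k l S : is_diffop b D l S -> opeq S (fun _ _ _ _ => 0) ->
  opeq (Aop b k S) (fun _ _ _ _ => 0).
Proof.
move=> dS S0 m al w Vw; apply: aeq_trans (Aop_0 k m al Vw).
exact: Aop_opeq dS (diffop_0 l) S0 _ _ _ Vw.
Qed.

Lemma opadd_opeq S S' T T' : opeq S S' -> opeq T T' -> opeq (opadd S T) (opadd S' T').
Proof. by move=> h h' m al w Vw; exact: aeqD (h m al w Vw) (h' m al w Vw). Qed.

Lemma opcomp_opeq k S T G G' : is_diffop b D k S -> is_diffop b D k T ->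
  is_diffop b D B0 G -> is_diffop b D B0 G' -> opeq S T -> opeq G G' ->
  opeq (opcomp S G) (opcomp T G').
Proof.
move=> dS dT dG dG' ST GG m al w Vw; apply: aeq_sum => p _; apply: aeq_sum => be _.
(* Operators are maps on functions, not on classes, so the inner values must be equal and not merely
   equal almost everywhere. *)
have -> : G (m - p)%N (fun i => al i - be i)%N w = G' (m - p)%N (fun i => al i - be i)%N w.
  by apply: V0_aeq_eq; [exact: (diffop_V _ _ dG)|exact: (diffop_V _ _ dG')|exact: GG].
by apply: ST; exact: (diffop_V _ _ dG').
Qed.

Lemma opcomp_eq0 k S G : is_diffop b D k S -> is_diffop b D B0 G ->
  opeq S (fun _ _ _ _ => 0) -> opeq (opcomp S G) (fun _ _ _ _ => 0).
Proof.
move=> dS dG S0 m al w Vw.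
apply: aeq_trans (opcomp_opeq dS (diffop_0 k) dG dG S0 _ m al Vw) _.
  by move=> m' al' w' _; exact: aeq_refl.
by apply: aeW => x _; rewrite /opcomp big1// => p _; rewrite big1.
Qed.

Lemma opsum_boltzmann (F : block -> diffop R) :
  opsum boltzmann_blocks F = opadd (opadd (F B1) (F B2)) (F Br).
Proof.
by do 3 apply/funext => ?; apply/funext => x; rewrite /opsum bsumE /opadd.
Qed.

Lemma opsum_r13 (F : block -> diffop R) : opsum r13_blocks F = opadd (F B1) (F B2).
Proof.
by do 3 apply/funext => ?; apply/funext => x; rewrite /opsum bsumE /opadd/= addr0.
Qed.

Lemma opadd_eq0r S T T' : opeq S T -> opeq T' (fun _ _ _ _ => 0) -> opeq (opadd S T') T.
Proof.
move=> h h' m al w Vw; apply: aeq_trans (aeqD (h m al w Vw) (h' m al w Vw)) _.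
by apply: aeW => x _; rewrite addr0.
Qed.

Lemma opeq_refl S : opeq S S. Proof. by move=> m al w _; exact: aeq_refl. Qed.

Section Compare.
Variables F G : block -> diffop R.
Hypotheses (dF : forall l, boltzmann_blocks l -> is_diffop b D l (F l))
  (dG : forall l, r13_blocks l -> is_diffop b D l (G l))
  (FG1 : opeq (F B1) (G B1)) (FG2 : opeq (F B2) (G B2))
  (Fr : opeq (F Br) (fun _ _ _ _ => 0)).

Let dFB1 : is_diffop b D B1 (F B1). Proof. exact: dF. Qed.
Let dFB2 : is_diffop b D B2 (F B2). Proof. exact: dF. Qed.
Let dFBr : is_diffop b D Br (F Br). Proof. exact: dF. Qed.
Let dGB1 : is_diffop b D B1 (G B1). Proof. exact: dG. Qed.
Let dGB2 : is_diffop b D B2 (G B2). Proof. exact: dG. Qed.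

Lemma opsum_Aop_opeq k : opeq (opsum boltzmann_blocks (fun l => Aop b k (F l)))
  (opadd (Aop b k (G B1)) (Aop b k (G B2))).
Proof.
rewrite opsum_boltzmann; apply: opadd_eq0r; last exact: Aop_eq0 dFBr Fr.
apply: opadd_opeq; [exact: Aop_opeq dFB1 dGB1 FG1|].
exact: Aop_opeq dFB2 dGB2 FG2.
Qed.

Lemma closed_opeq : opeq (closed_op b boltzmann_blocks F) (closed_op b r13_blocks G).
Proof.
apply: opadd_opeq; first exact: opeq_refl.
rewrite opsum_r13; exact: opsum_Aop_opeq.
Qed.

(** No vanishing of F B2 is required, which matters at the last step, where the second iterate may
    have a V^(2) component. *)
Lemma lhs_opeq1 : opeq (lhs_boltzmann b F B1) (lhs_r13 b G B1).
Proof.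
apply: opadd_opeq.
  apply: opcomp_opeq dFB1 dGB1 _ _ FG1 _.
  - by apply: diffop_opp; exact: diffop_closed.
  - by apply: diffop_opp; exact: diffop_closed.
  - by move=> m al w Vw; apply: aeqN; exact: closed_opeq.
apply: opadd_opeq; [exact: opeq_refl|exact: opsum_Aop_opeq].
Qed.

(** The third moment equation omits the time derivative of f^(2) and the term A^(22) f^(2). Both are
    0 when F B2 vanishes, as it does for the iterates of index 0 and 1. *)
Lemma lhs_opeq2 : opeq (F B2) (fun _ _ _ _ => 0) ->
  opeq (lhs_boltzmann b F B2) (lhs_r13 b G B2).
Proof.
move=> F20.
have h : opeq (ddt b boltzmann_blocks F B2) (fun _ _ _ _ => 0).
  by apply: opcomp_eq0 dFB2 _ F20; apply: diffop_opp; exact: diffop_closed.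
have h' : opeq (opsum boltzmann_blocks (fun l => Aop b B2 (F l))) (Aop b B2 (G B1)).
  rewrite opsum_boltzmann; apply: opadd_eq0r; last exact: Aop_eq0 dFBr Fr.
  apply: opadd_eq0r; last exact: Aop_eq0 dFB2 F20.
  exact: Aop_opeq dFB1 dGB1 FG1.
move=> m al w Vw.
have := aeqD (h m al w Vw) (opadd_opeq (opeq_refl (Aop b B2 (@opid R))) h' m al Vw).
move=> e; apply: aeq_trans e _; by apply: aeW => x _; rewrite add0r.
Qed.

End Compare.

(** * Iterates confined to the span of the phi functions, and their sources *)

Lemma ip_Aop k l S m al w g : is_diffop b D l S -> V0 w -> V b k g ->
  ip (Aop b k S m al w) g =
  \sum_(i < 3 | (0 < al i)%N) ip (mulxi i (S m (fun j => al j - (j == i))%N w)) g.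
Proof.
move=> dS Vw Vg; have Dx i : D (mulxi i (S m (fun j => al j - (j == i))%N w)).
  exact/D_mulxi/(diffop_D _ _ dS).
rewrite ip_suml; last exact: V_L2 Vg.
  by apply: eq_bigr => i _; rewrite ip_orthproj.
by move=> i _; apply/D_L2/D_orthproj.
Qed.

(** The coefficients of the phi functions are proportional to [beta1] and [beta2], and the quotients
    of betas in psihat are those that make the pairings with psihat vanish. The other generators of
    S^(2) have a different rank. *)
Lemma Phi_V1 f : fspan Phigens f -> V b B1 f.
Proof.
apply: fspan_sub => [|c u v|g].
- exact: V_0.
- exact: V_lin.
have [n1 n2 _ _ _] := hden.
have p11 I m J : (1 <= m)%N -> ip (phi1 I) (@psi R 1 m J) = beta1 b m * psiM R I J.
  move=> hm; rewrite /phi1 ip_Linv// hm mul1r; congr (_ * _).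
  by apply: (inverse_sym _ _ shape11).
have p22 I m J : ip (phi2 I) (@psi R 2 m J) = beta2 b m * psiM R I J.
  rewrite /phi2 ip_Linv// mul1r; congr (_ * _).
  by apply: (inverse_sym _ _ shape20).
have p1 I (l m : nat) (J : idx l) : 1%N != l -> ip (phi1 I) (psi m J) = 0.
  by move=> h; rewrite /phi1 ip_Linv0.
have p2 I (l m : nat) (J : idx l) : 2%N != l -> ip (phi2 I) (psi m J) = 0.
  by move=> h; rewrite /phi2 ip_Linv0.
have hat (u : vfun R) (l m m0 : nat) c (J : idx l) : L2 u ->
    ip u (fun x => psi m J x - c * psi m0 J x) = ip u (psi m J) - c * ip u (psi m0 J).
  by move=> Lu; rewrite ipBr ?ipZr//; try exact: L2psi; exact/L2_Z/L2psi.
move=> [[I ->]|[I ->]].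
  have Lf := D_L2 (D_phi1 I).
  split; split=> // h; first exact: Linv_V0.
  apply: cspan_ip => //; first exact: S2gens_L2.
  move=> _ [[[[m [J [hm ->]]]|[m [J ->]]]|[m [J [hm ->]]]]|[l [m [J [hl ->]]]]].
  - by rewrite hat// !p11//; field.
  - by rewrite hat// !p1// mulr0 subrr.
  - by rewrite p1.
  - by rewrite p1//; lia.
have Lf := D_L2 (D_phi2 I).
split; split=> // h; first exact: Linv_V0.
apply: cspan_ip => //; first exact: S2gens_L2.
move=> _ [[[[m [J [hm ->]]]|[m [J ->]]]|[m [J [hm ->]]]]|[l [m [J [hl ->]]]]].
- by rewrite hat// !p2// mulr0 subrr.
- by rewrite hat// !p22//; field.
- by rewrite p2.
- by rewrite p2//; lia.
Qed.

Definition flat F := forall m al w, V0 w ->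
  [/\ exists2 f, fspan Phigens f & aeq (F B1 m al w) f,
      aeq (F B2 m al w) (fun=> 0) & aeq (F Br m al w) (fun=> 0)].

(** One unprojected function whose pairings with V^(1), V^(2) and V^(r) give the left-hand sides of
    all three equations for a flat iterate; [weighted] can then be checked on it directly. *)
Definition flat_source F : diffop R := fun m al w x =>
  \sum_(i < 3 | (0 < al i)%N) (mulxi i (@opid R m (fun j => al j - (j == i))%N w) x
    + mulxi i (F B1 m (fun j => al j - (j == i))%N w) x)
  + ddt b boltzmann_blocks F B1 m al w x.

Section Flat.
Variable F : block -> diffop R.
Hypotheses (dF : forall l, boltzmann_blocks l -> is_diffop b D l (F l)) (fF : flat F).

Let dFB1 : is_diffop b D B1 (F B1). Proof. exact: dF. Qed.
Let dFB2 : is_diffop b D B2 (F B2). Proof. exact: dF. Qed.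
Let dFBr : is_diffop b D Br (F Br). Proof. exact: dF. Qed.
Let dddt : is_diffop b D B1 (ddt b boltzmann_blocks F B1). Proof. exact: diffop_ddt. Qed.

Let F20 : opeq (F B2) (fun _ _ _ _ => 0). Proof. by move=> m al w Vw; case: (fF m al Vw). Qed.
Let Fr0 : opeq (F Br) (fun _ _ _ _ => 0). Proof. by move=> m al w Vw; case: (fF m al Vw). Qed.

Let Dsum m al w : V0 w -> D (fun x => \sum_(i < 3 | (0 < al i)%N)
  (mulxi i (@opid R m (fun j => al j - (j == i))%N w) x
    + mulxi i (F B1 m (fun j => al j - (j == i))%N w) x)).
Proof.
move=> Vw; apply: D_sum => i _; apply: D_D; apply: D_mulxi.
  exact: diffop_D diffop_id _.
exact: diffop_D dFB1 _.
Qed.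

Lemma D_flat_source m al w : V0 w -> D (flat_source F m al w).
Proof. by move=> Vw; apply: D_D; [exact: Dsum|exact: diffop_D dddt _]. Qed.

(** The terms containing F B2 and F Br vanish, and test functions absorb the projections. The time
    derivative of f^(1) stays in V^(1), so it may be included in the source for every k. *)
Lemma ip_lhs_flat k m al w g : k <> B0 -> V0 w -> V b k g -> D g ->
  ip (lhs_boltzmann b F k m al w) g = ip (flat_source F m al w) g.
Proof.
move=> k0 Vw Vg Dg; have Lg := D_L2 Dg.
have kk : boltzmann_blocks k by case: (k) k0.
have dk := dF kk.
have LA l S : is_diffop b D l S -> L2 (Aop b k S m al w).
  by move=> dS; apply: D_L2; exact: diffop_D (diffop_Aop k dS) Vw.
have z S l : is_diffop b D l S -> opeq S (fun _ _ _ _ => 0) -> ip (Aop b k S m al w) g = 0.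
  move=> dS S0; rewrite (aeq_ip (Aop_eq0 k dS S0 m al Vw)) ?ip0l//; [exact: LA dS|exact: L2_0].
have Lddt : L2 (ddt b boltzmann_blocks F k m al w).
  by apply: D_L2; exact: diffop_D (diffop_ddt dF kk) Vw.
have Lsum : L2 (fun x => Aop b k (F B1) m al w x + Aop b k (F B2) m al w x
    + Aop b k (F Br) m al w x).
  by do 2 (apply: L2_D; last by [exact: LA dFB2|exact: LA dFBr]); exact: LA dFB1.
have Lid := LA _ _ diffop_id.
have -> : lhs_boltzmann b F k m al w = (fun x => ddt b boltzmann_blocks F k m al w x +
    (Aop b k (@opid R) m al w x + (Aop b k (F B1) m al w x + Aop b k (F B2) m al w x
    + Aop b k (F Br) m al w x))).
  by rewrite /lhs_boltzmann opsum_boltzmann.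
have Ls := L2_D (LA _ _ dFB1) (LA _ _ dFB2).
have e1 : ip (fun x => Aop b k (F B1) m al w x + Aop b k (F B2) m al w x
    + Aop b k (F Br) m al w x) g = ip (Aop b k (F B1) m al w) g.
  apply: etrans (ipDl Ls (LA _ _ dFBr) Lg) _.
  apply: etrans (congr2 +%R (ipDl (LA _ _ dFB1) (LA _ _ dFB2) Lg) (z _ _ dFBr Fr0)) _.
  rewrite addr0; apply: etrans (congr2 +%R erefl (z _ _ dFB2 F20)) _; exact: addr0.
apply: etrans (ipDl Lddt (L2_D Lid Lsum) Lg) _.
apply: etrans (congr2 +%R erefl (etrans (ipDl Lid Lsum Lg) (congr2 +%R erefl e1))) _.
rewrite /flat_source ipDl//; [|exact/D_L2/Dsum|exact/D_L2/(diffop_D _ _ dddt)].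
rewrite addrC; congr (_ + _).
  rewrite (ip_Aop _ _ diffop_id Vw Vg) (ip_Aop _ _ dFB1 Vw Vg) -big_split ip_suml//.
    apply: eq_bigr => i _; rewrite ipDl//.
      by apply/D_L2/D_mulxi; exact: diffop_D diffop_id _.
    by apply/D_L2/D_mulxi; exact: diffop_D dFB1 _.
  move=> i _; apply: D_L2; apply: D_D; apply: D_mulxi.
    exact: diffop_D diffop_id _.
  exact: diffop_D dFB1 _.
have dclosed := diffop_opp (diffop_closed dF).
have V1 := diffop_V m al dddt Vw.
case: (k) k0 kk Vg Lddt => // _ _ Vg Lddt.
- rewrite (V_orth _ V1 Vg)// (aeq_ip (opcomp_eq0 dFB2 dclosed F20 m al Vw)) ?ip0l//.
  exact: L2_0.
- rewrite (V_orth _ V1 Vg)// (aeq_ip (opcomp_eq0 dFBr dclosed Fr0 m al Vw)) ?ip0l//.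
  exact: L2_0.
Qed.

Lemma weighted_sum I (r : seq I) (P : pred I) (f : I -> vfun R) :
  (forall i, P i -> D (f i) /\ weighted (f i)) ->
  weighted (fun x => \sum_(i <- r | P i) f i x).
Proof.
move=> hf; suff [] : D (fun x => \sum_(i <- r | P i) f i x) /\
  weighted (fun x => \sum_(i <- r | P i) f i x) by [].
apply: (lin_closed_sum (E := fun f => D f /\ weighted f)) => // [|c u v [Du wu] [Dv wv]].
  by split; [exact: D_0|exact: weighted_0].
by split; [exact: D_lin|exact: weighted_lin].
Qed.

Lemma weighted_D f g : D f -> D g -> weighted f -> weighted g ->
  weighted (fun x => f x + g x).
Proof.
move=> Df Dg wf wg; have := weighted_lin 1 Df Dg wf wg.
by congr (weighted _); apply/funext => x; rewrite /lin mul1r.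
Qed.

(** f^(0) enters through xi_i V^(0) and f^(1) through xi_i phi, while the time derivative of f^(1)
    is again a combination of phi functions, the coefficients of F B1 being applied to other
    elements of [V0]. *)
Lemma weighted_flat_source m al w : V0 w -> weighted (flat_source F m al w).
Proof.
move=> Vw.
have FP m' al' w' : V0 w' -> exists f, [/\ fspan Phigens f, D (F B1 m' al' w') &
    aeq (F B1 m' al' w') f].
  by move=> Vw'; have [[f sf e] _ _] := fF m' al' Vw'; exists f; split=> //; exact: diffop_D dFB1 _.
have Did i : D (mulxi i (@opid R m (fun j => al j - (j == i))%N w)).
  by apply: D_mulxi; exact: diffop_D diffop_id _.
have DF1 i : D (mulxi i (F B1 m (fun j => al j - (j == i))%N w)).
  by apply: D_mulxi; exact: diffop_D dFB1 _.
apply: weighted_D; [exact: Dsum|exact: diffop_D dddt _| |].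
  apply: weighted_sum => i _; split; first exact: D_D.
  apply: weighted_D => //.
    have Vid : V0 (@opid R m (fun j => al j - (j == i))%N w) by exact: (diffop_V _ _ diffop_id).
    have [s ss e] := mulxi_V0 i Vid.
    apply: weighted_aeq (aeq_sym e) (weighted_xiV0 ss); [exact/D_L2/xiV0_D|exact: D_L2].
  have [f [sf DF e]] := FP m (fun j => al j - (j == i))%N w Vw.
  have e' : aeq (mulxi i f) (mulxi i (F B1 m (fun j => al j - (j == i))%N w)).
    by apply: filterS e => x h _; rewrite /mulxi h.
  apply: weighted_aeq e' ((weighted_Phi sf).2 i); [exact/D_L2/D_mulxi/Phi_D|exact: D_L2].
have dclosed := diffop_opp (diffop_closed dF).
apply: weighted_sum => p _; split.
  by apply: D_sum => be _; apply: diffop_D dFB1 _; exact: (diffop_V _ _ dclosed).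
apply: weighted_sum => be _.
have Vc := diffop_V (m - p)%N (fun i => al i - be i)%N dclosed Vw.
have [f [sf DF e]] := FP p (fun i => be i : nat) _ Vc.
split=> //; apply: weighted_aeq (aeq_sym e) (weighted_Phi sf).1; [exact/D_L2/Phi_D|exact: D_L2].
Qed.

End Flat.

(** * The first three iterates and the closed equations *)

Section Iterates.
Variables F G : nat -> block -> diffop R.
Hypotheses (hF : boltzmann_iterates b L D F) (hG : r13_iterates b L D G).

Let dF j l : boltzmann_blocks l -> is_diffop b D l (F j l).
Proof. by case: hF => h _ _; exact: h. Qed.
Let dG j l : r13_blocks l -> is_diffop b D l (G j l).
Proof. by case: hG => h _ _; exact: h. Qed.

Let rF j m al w (k : block) : vfun R :=
  kn_truncate j (lhs_boltzmann b (F j) k) m al w.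
Let rG j m al w (k : block) : vfun R := kn_truncate j (lhs_r13 b (G j) k) m al w.

Let vF j m al w : V0 w -> ksvals boltzmann_blocks (fun l => F j l m al w).
Proof. by move=> Vw l /(dF j)[h _ _]; exact: h. Qed.
Let vG j m al w : V0 w -> ksvals r13_blocks (fun l => G j l m al w).
Proof. by move=> Vw l /(dG j)[h _ _]; exact: h. Qed.

Let vrF j m al w : V0 w -> ksvals boltzmann_blocks (rF j m al w).
Proof.
move=> Vw l ll; have [h _ _] := diffop_truncate j (diffop_lhs_boltzmann ll (@dF j)).
exact: h.
Qed.
Let vrG j m al w : V0 w -> ksvals r13_blocks (rG j m al w).
Proof.
move=> Vw l ll; have [h _ _] := diffop_truncate j (diffop_lhs_r13 ll (@dG j)).
exact: h.
Qed.

Let sF j m al w : V0 w -> solves boltzmann_blocks (fun l => F j.+1 l m al w) (rF j m al w).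
Proof. by move=> Vw k kk; case: hF => _ _ h; exact: h. Qed.
Let sG j m al w : V0 w -> solves r13_blocks (fun l => G j.+1 l m al w) (rG j m al w).
Proof. by move=> Vw k kk; case: hG => _ _ h; exact: h. Qed.

Let ip_rF j m al w k g : flat (F j) -> k <> B0 -> V0 w -> V b k g -> D g ->
  ip (rF j m al w k) g =
  ip (if (0 < m <= j.+1)%N then flat_source (F j) m.-1 al w else fun=> 0) g.
Proof.
move=> fj k0 Vw Vg Dg; rewrite /rF kn_truncateE; case: ifP => // _.
by apply: ip_lhs_flat => // l; exact: dF.
Qed.

Lemma iterate0_flat : flat (F 0).
Proof.
case: hF => _ h _ m al w Vw; rewrite !h//; split; try exact: aeq_refl.
by exists (fun=> 0); [exact: fspan0|exact: aeq_refl].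
Qed.

Lemma source0 m al w : V0 w -> exists v f,
  [/\ V0 v, fspan Phigens f & aeq (flat_source (F 0) m al w) (fun x => v x + L f x)].
Proof.
move=> Vw; have F0 : F 0%N B1 = (fun _ _ _ _ => 0) by case: hF => _ h _; exact: h.
have -> : flat_source (F 0) m al w = fun x =>
    \sum_(i < 3 | (0 < al i)%N) 1 * mulxi i (@opid R m (fun j => al j - (j == i))%N w) x.
  apply/funext => x; rewrite /flat_source /ddt /opcomp F0.
  rewrite [X in _ + X]big1 ?addr0 => [|p _]; last by rewrite big1.
  by apply: eq_bigr => i _; rewrite /mulxi mulr0 addr0 mul1r.
have ex (i : 'I_3) : exists s, fspan (xiV0gens) s /\
    aeq (mulxi i (@opid R m (fun j => al j - (j == i))%N w)) s.
  have [|s ss e] := @mulxi_V0 i (@opid R m (fun j => al j - (j == i))%N w).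
    exact: (diffop_V _ _ diffop_id).
  by exists s.
have [s hs] := choice ex.
have ss : fspan (xiV0gens) (fun x => \sum_(i < 3 | (0 < al i)%N) 1 * s i x).
  by apply: fspan_sum => i _; exact: (hs i).1.
have [v [f [Vv sf e]]] := xiV0_L ss.
exists v, f; split=> //; apply: aeq_trans e; apply: aeq_sum => i _.
by apply: aeqZ; exact: (hs i).2.
Qed.

(* L^-1 applied to a source in V^(0) + L(span of the phi's) *)
Lemma iterate1_flat : flat (F 1).
Proof.
move=> m al w Vw.
have [f [sf hf]] : exists f, fspan Phigens f /\ forall k g, k <> B0 -> V b k g -> D g ->
    ip (rF 0 m al w k) g = ip (L f) g.
  case c : (0 < m <= 1)%N; last first.
    exists (fun=> 0); split=> [|k g k0 Vg Dg]; first exact: fspan0.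
    by rewrite (ip_rF m al iterate0_flat k0 Vw Vg Dg) c ip0l L_sym ?ip0l//; exact: D_0.
  have [v [f [Vv sf e]]] := source0 m.-1 al Vw.
  exists f; split=> // k g k0 Vg Dg; have Df := Phi_D sf.
  rewrite (ip_rF m al iterate0_flat k0 Vw Vg Dg) c (aeq_ip e); last 3 first.
  - by apply/D_L2/D_flat_source => // l; exact: dF.
  - by apply: L2_D; [exact: V0_L2|exact/D_L2/D_L].
  - exact: D_L2.
  rewrite ipDl; [|exact: V0_L2|exact/D_L2/D_L|exact: D_L2].
  rewrite (@V_orth B0 k v g _ Vv Vg) ?add0r//.
  by move=> h; apply: k0.
have Df := Phi_D sf; have Vf := Phi_V1 sf.
pose u k : vfun R := if k is B1 then f else fun=> 0.
have vu : ksvals boltzmann_blocks u.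
  by move=> [|||] // _; split=> //; try exact: D_0; exact: V_0.
have uE : usum (onblocks boltzmann_blocks u) = f.
  by rewrite -bsum_usum; apply/funext => x; rewrite bsumE/= !addr0.
have su : solves boltzmann_blocks u (rF 0 m al w).
  apply: ip_solves => // [|k g kk Vg Dg]; first exact: vrF.
  by rewrite uE hf//; case: (k) kk.
have e := solves_unique erefl (vF 1 m al Vw) vu (vrF 0 m al Vw) (vrF 0 m al Vw)
  (sF 0 m al Vw) su (fun k _ => aeq_refl _).
by split; [exists f => //; exact: (e B1)|exact: (e B2)|exact: (e Br)].
Qed.

(** Applies [Br_eq0] with the flat source as h; it is used for j = 1. *)
Lemma iterate_Br0 j : flat (F j) -> opeq (F j.+1 Br) (fun _ _ _ _ => 0).
Proof.
move=> fj m al w Vw.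
pose h : vfun R := if (0 < m <= j.+1)%N then flat_source (F j) m.-1 al w else fun=> 0.
have Dh : D h.
  by rewrite /h; case: ifP => _; [apply: D_flat_source => // l; exact: dF|exact: D_0].
have wh : weighted h.
  rewrite /h; case: ifP => _; last exact: weighted_0.
  by apply: weighted_flat_source => // l; exact: dF.
have vu := vblocks_onblocks (vF j.+1 m al Vw).
have DU := D_usum vu.
apply: (Br_eq0 vu Dh wh) => g Dg g0.
(* The equation of block k gives <L U, P_k g> = <g, P_k h>. Summing over k turns this into <L U, g>
   = <h, g>, since g and L U are orthogonal to V^(0). *)
have e k : k <> B0 ->
    ip (L (usum (onblocks boltzmann_blocks (fun l => F j.+1 l m al w))))
       (orthproj (V b k) g) = ip g (orthproj (V b k) h).
  move=> k0; have kk : boltzmann_blocks k by case: (k) k0.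
  have Vp := V_orthproj k Dg; have Dp := D_orthproj k Dg.
  rewrite (solves_ip (vF j.+1 m al Vw) (vrF j m al Vw) (sF j m al Vw) kk Vp Dp).
  rewrite (ip_rF m al fj k0 Vw Vp Dp) -/h.
  exact: (etrans (esym (ip_orthproj Dh Vp)) (etrans (ipC _ _) (ip_orthproj Dg (V_orthproj k Dh)))).
rewrite (ipC h) (ip_decomp Dg Dh g0) (ip_decomp (D_L DU) Dg) ?e//.
by move=> v Vv; rewrite L_sym//; [rewrite ipC L_V0|exact: V0_D].
Qed.

(** Without its V^(r) component the Boltzmann iterate solves the two-block system of the moment
    equations with the same data, so [solves_unique] applies. *)
Lemma iterate_step j : opeq (lhs_boltzmann b (F j) B1) (lhs_r13 b (G j) B1) ->
  opeq (lhs_boltzmann b (F j) B2) (lhs_r13 b (G j) B2) ->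
  opeq (F j.+1 Br) (fun _ _ _ _ => 0) ->
  forall k, r13_blocks k -> opeq (F j.+1 k) (G j.+1 k).
Proof.
move=> e1 e2 Fr k kk m al w Vw.
have sub l : r13_blocks l -> boltzmann_blocks l by case: l.
have vF' : ksvals r13_blocks (fun l => F j.+1 l m al w).
  by move=> l /sub; exact: vF.
have vrF' : ksvals r13_blocks (rF j m al w) by move=> l /sub; exact: vrF.
have DFr : D (F j.+1 Br m al w) by exact: diffop_D (dF j.+1 _) Vw.
have sF' : solves r13_blocks (fun l => F j.+1 l m al w) (rF j m al w).
  move=> l ll; have := sF j m al Vw (sub l ll).
  have z : aeq (Lop b L l (F j.+1 Br m al w)) (fun=> 0).
    apply: aeq_trans (orthproj_0 l); apply: orthproj_aeq; [exact: D_L|exact: D_0|].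
    have h0 := co_aeq hL (D_dom DFr) (D_dom D_0) (Fr m al w Vw).
    by apply: aeq_trans h0 (L_null D_0 _); rewrite ip0r.
  apply: aeq_trans; apply: aeq_sym.
  apply: filterS z => x h _; rewrite !bsumE/= h//.
have re l : r13_blocks l -> aeq (rF j m al w l) (rG j m al w l).
  rewrite /rF /rG !kn_truncateE; case: ifP => _; last by move=> _; exact: aeq_refl.
  by case: l => // _; [exact: e1|exact: e2].
exact: (solves_unique erefl vF' (vG j.+1 m al Vw) vrF' (vrG j m al Vw) sF' (sG j m al Vw) re).
Qed.

Lemma iterates_agree :
  [/\ opeq (F 2 B1) (G 2 B1), opeq (F 2 B2) (G 2 B2) & opeq (F 2 Br) (fun _ _ _ _ => 0)].
Proof.
have z k : r13_blocks k -> opeq (F 0%N k) (G 0%N k).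
  case: hF => _ hF0 _; case: hG => _ hG0 _ kk m al w _.
  by rewrite hF0 ?hG0//; [exact: aeq_refl|case: (k) kk].
have F0r : opeq (F 0%N Br) (fun _ _ _ _ => 0) by move=> m al w Vw; case: (iterate0_flat m al Vw).
have F02 : opeq (F 0%N B2) (fun _ _ _ _ => 0) by move=> m al w Vw; case: (iterate0_flat m al Vw).
have F1r : opeq (F 1%N Br) (fun _ _ _ _ => 0) by move=> m al w Vw; case: (iterate1_flat m al Vw).
have F12 : opeq (F 1%N B2) (fun _ _ _ _ => 0) by move=> m al w Vw; case: (iterate1_flat m al Vw).
have F2r := iterate_Br0 iterate1_flat.
have s1 := iterate_step (lhs_opeq1 (@dF 0) (@dG 0) (z B1 isT) (z B2 isT) F0r)
  (lhs_opeq2 (@dF 0) (@dG 0) (z B1 isT) F0r F02) F1r.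
have s2 := iterate_step (lhs_opeq1 (@dF 1) (@dG 1) (s1 B1 isT) (s1 B2 isT) F1r)
  (lhs_opeq2 (@dF 1) (@dG 1) (s1 B1 isT) F1r F12) F2r.
by split; [exact: s2|exact: s2|].
Qed.

(** Multiplication by xi_i is moved onto the test function, where xi_i v can be expressed through L
    and the phi functions. *)
Lemma ip_closed ks (H : block -> diffop R) m al (w v : vfun R) :
  (forall l, ks l -> is_diffop b D l (H l)) -> V0 w -> V0 v ->
  ip (closed_op b ks H m al w) v = \sum_(i < 3 | (0 < al i)%N)
    (ip (mulxi i (@opid R m (fun j => al j - (j == i))%N w)) v +
     ip (usum (onblocks ks (fun l => H l m (fun j => al j - (j == i))%N w))) (mulxi i v)).
Proof.
move=> dH Vw Vv; have Lv := V0_L2 Vv; have Dv := V0_D Vv.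
pose A l : diffop R := if ks l then Aop b B0 (H l) else fun _ _ _ _ => 0.
have dA l : is_diffop b D B0 (A l).
  by rewrite /A; case: ifP => [/dH|_]; [exact: diffop_Aop|exact: diffop_0].
have LA l : L2 (A l m al w) by apply: D_L2; exact: diffop_D (dA l) Vw.
have ipA l : ip (A l m al w) v = \sum_(i < 3 | (0 < al i)%N)
    ip (onblocks ks (fun l => H l m (fun j => al j - (j == i))%N w) l) (mulxi i v).
  rewrite /A /onblocks; case: ifP => [kl|_].
    rewrite (@ip_Aop B0 l _ m al w v (dH l kl) Vw Vv).
    by apply: eq_bigr => i _; rewrite ip_mulxi.
  by rewrite ip0l big1// => i _; rewrite ip0l.
have -> : closed_op b ks H m al w = (fun x => Aop b B0 (@opid R) m al w x +
    (A B1 m al w x + A B2 m al w x + A Br m al w x)).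
  apply/funext => x; rewrite /closed_op /opadd /opsum bsumE /A.
  by case: (ks B1); case: (ks B2); case: (ks Br).
have vH i : vblocks (onblocks ks (fun l => H l m (fun j => al j - (j == i))%N w)).
  by apply: vblocks_onblocks => l /dH[h _ _]; exact: h.
rewrite ipDl//; [|exact/D_L2/(diffop_D _ _ (diffop_Aop B0 diffop_id))|by do 2 (apply: L2_D => //)].
rewrite ipDl ?ipDl//; last exact: L2_D.
rewrite !ipA (@ip_Aop B0 B0 _ m al w v diffop_id Vw Vv) -!big_split.
apply: eq_bigr => i _ /=; rewrite ip_usum//; exact/D_L2/D_mulxi.
Qed.

Lemma closed_agree m al w : V0 w ->
  aeq (closed_op b boltzmann_blocks (F 3) m al w) (closed_op b r13_blocks (G 3) m al w).
Proof.
move=> Vw; have [e1 e2 er] := iterates_agree.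
have dcF := diffop_closed (@dF 3); have dcG := diffop_closed (@dG 3).
apply: (@aeq_VD B0); try exact: (diffop_V _ _ dcF); try exact: (diffop_V _ _ dcG).
- exact: diffop_D dcF Vw.
- exact: diffop_D dcG Vw.
move=> v Vv Dv; rewrite (ip_closed m al (@dF 3) Vw Vv) (ip_closed m al (@dG 3) Vw Vv).
apply: eq_bigr => i _; congr (_ + _).
move: (fun j : 'I_3 => _) => al'.
have [s ss es] := mulxi_V0 i Vv; have [v' [f [Vv' sf e]]] := xiV0_L ss.
have Df := Phi_D sf; have Vf := Phi_V1 sf.
(* Stated for any set of blocks containing [B1], so that the same identity serves both systems; only
   the V^(1) equation enters because f lies in V^(1). *)
have main ks u r : ks B1 -> ksvals ks u -> ksvals ks r -> solves ks u r ->
    ip (usum (onblocks ks u)) (mulxi i v) = ip (r B1) f.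
  move=> k1 hu hr su; have hv := vblocks_onblocks hu; have DU := D_usum hv.
  rewrite ipC (aeq_ip (aeq_trans es e)); last 3 first.
  - exact/D_L2/D_mulxi.
  - by apply: L2_D; [exact: V0_L2|exact/D_L2/D_L].
  - exact: D_L2.
  rewrite ipDl; [|exact: V0_L2|exact/D_L2/D_L|exact: D_L2].
  rewrite (ipC v') (usum_V0 hv Vv') add0r ipC -L_sym//.
  exact: solves_ip su k1 Vf Df.
rewrite (main _ _ _ _ (vF 3 m al' Vw) (vrF 2 m al' Vw) (sF 2 m al' Vw))//.
rewrite (main _ _ _ _ (vG 3 m al' Vw) (vrG 2 m al' Vw) (sG 2 m al' Vw))//.
apply: aeq_ip.
- have l1 := lhs_opeq1 (@dF 2) (@dG 2) e1 e2 er.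
  by rewrite /rF /rG !kn_truncateE; case: ifP => _; [exact: l1|exact: aeq_refl].
- by have [_ /D_L2] := vrF 2 m al' Vw (isT : boltzmann_blocks B1).
- by have [_ /D_L2] := vrG 2 m al' Vw (isT : r13_blocks B1).
- exact: D_L2.
Qed.

End Iterates.

End Operators.

(** Existence of iterates for both systems is included so that the comparison of the closed
    operators is not vacuous. *)
Theorem mainTheorem2 (R : realType)
    (dom : set (vfun R)) (L : vfun R -> vfun R)
    (a : nat -> nat -> nat -> R) (b : nat -> nat -> nat -> nat -> R)
    (D : set (vfun R))
    (hL : collision_operator dom L)
    (ha : collision_matrix L a)
    (hD : formal_domain b dom L D)
    (hb : matrix_inverses a b D)
    (hgamma : gamma_converge b)
    (hden : denominators_nonzero b)
    (hinvB : block_invertible b L D boltzmann_blocks)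
    (hinvR : block_invertible b L D r13_blocks) :
  (exists F, boltzmann_iterates b L D F) /\
  (exists G, r13_iterates b L D G) /\
  (forall F G, boltzmann_iterates b L D F -> r13_iterates b L D G ->
     forall m al w, V0 w ->
       aeq (closed_op b boltzmann_blocks (F 3%N) m al w)
           (closed_op b r13_blocks (G 3%N) m al w)).
Proof.
split; [|split].
- have h := iterates_exist hL hD (ks := boltzmann_blocks) (lhs := lhs_boltzmann b) erefl hinvB.
  apply: h => F dF k kk; exact: (diffop_lhs_boltzmann hD kk).
- have h := iterates_exist hL hD (ks := r13_blocks) (lhs := lhs_r13 b) erefl hinvR.
  apply: h => G dG k kk; exact: (diffop_lhs_r13 hD kk).
- move=> F G hF hG m al w.
  exact: (closed_agree hL hD ha hb hgamma hden hF hG).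
Qed.
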